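(* Let $G$ be a finitely generated group and $\mathcal{m}$ a probability measure on $G$ such that (A1) the support of $\mathcal{m}$ generates $G$, and (A2${}^+$) there exists $\delta>0$ with $\int (\mathrm{length}(g))^{1+\delta}\,d\mathcal{m}(g)<\infty$. Let $\rho: G\to \mathrm{SL}(2,\mathbb{M})$ be any group homomorphism. Then $$\frac{1}{\log|t|^{-1}}\,\chi(t)\longrightarrow \chi_{\mathsf{na}} \quad\text{as } t\to 0.$$
   Context: $\mathrm{length}(g)$ is the word length of $g$ with respect to a fixed finite symmetric generating set of $G$. $\mathbb{M}$ denotes the ring of holomorphic functions on the punctured unit disk $\mathbb{D}^*$ which extend meromorphically through $0$; a homomorphism $\rho:G\to\mathrm{SL}(2,\mathbb{M})$ is the same as a family of representations $\rho_t:G\to\mathrm{SL}(2,\mathbb{C})$, $t\in\mathbb{D}^*$, with $t\mapsto\rho_t(g)$ holomorphic on $\mathbb{D}^*$ and meromorphic at $0$ for each $g$. Let $\mathcal{m}^n$ be the image of $\mathcal{m}^{\otimes n}$ under $(g_1,\dots,g_n)\mapsto g_n\cdots g_1$. For $t\in\mathbb{D}^*$, $\chi(t)=\lim_{n\to\infty}\frac1n\int\log\|\rho_t(g)\|\,d\mathcal{m}^n(g)$, where $\|\cdot\|$ is any matrix norm on $\mathrm{SL}(2,\mathbb{C})$ (e.g. the operator norm for the max norm on $\mathbb{C}^2$). Let $\mathbb{L}=\mathbb{C}((t))$ with the $t$-adic absolute value $|f|_{\mathsf{na}}=\exp(-\mathrm{ord}_{t=0}f)$; viewing $\mathbb{M}\subset\mathbb{L}$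 (Laurent expansion at $0$), $\rho$ induces $\rho_{\mathsf{na}}:G\to\mathrm{SL}(2,\mathbb{L})$. For $A\in\mathrm{SL}(2,\mathbb{L})$ let $\|A\|_{\mathsf{na}}$ be the maximum of the $t$-adic absolute values of its entries, and $\chi_{\mathsf{na}}=\lim_{n\to\infty}\frac1n\int\log\|\rho_{\mathsf{na}}(g)\|_{\mathsf{na}}\,d\mathcal{m}^n(g)$. *)

(* Defs.v *)
From HB Require Import structures.
From mathcomp Require Import all_boot all_order all_algebra.
From mathcomp Require Import all_classical all_reals all_analysis.
From mathcomp Require Import complex.
Set Implicit Arguments. Unset Strict Implicit. Unset Printing Implicit Defensive.
Import Order.TTheory GRing.Theory Num.Theory.
Export numFieldTopology.Exports.
Local Open Scope classical_set_scope.
Local Open Scope ring_scope.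

HB.instance Definition _ (R : realType) := PseudoPointedMetric.copy R[i] R[i]^o.

Definition cabs (R : realType) (z : R[i]) : R := ComplexField.Normc.normc z.

Definition gprod (G : groupType) (s : seq G) : G :=
  foldr (@monoid.mul G) (@monoid.one G) s.

Definition sym_gen_set (G : groupType) (S : seq G) : Prop :=
  (forall x, x \in S -> monoid.inv x \in S) /\
  (forall g : G, exists s : seq G, all (fun x => x \in S) s /\ g = gprod s).

Definition word_of_len (G : groupType) (S : seq G) (g : G) (n : nat) : Prop :=
  exists s : seq G, [/\ all (fun x => x \in S) s, size s = n & g = gprod s].

Definition word_length (G : groupType) (S : seq G) (g : G) : nat :=
  xget 0%N [set n | word_of_len S g n /\ forall k, word_of_len S g k -> (n <= k)%N].

Definition prob_on (R : realType) (G : groupType) (m : G -> R) : Prop :=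
  (forall g, 0 <= m g) /\ (\esum_(g in [set: G]) (m g)%:E = 1)%E.

Definition supp_generates (R : realType) (G : groupType) (m : G -> R) : Prop :=
  forall g : G, exists s : seq G,
    all (fun x => (0 < m x) || (0 < m (monoid.inv x))) s /\ g = gprod s.

(* integral of a nonnegative function f against m^n, the image of m^{(x)n}
   under (g_1,...,g_n) |-> g_n ... g_1 *)
Definition int_conv (R : realType) (G : groupType) (m : G -> R) (n : nat)
    (f : G -> R) : \bar R :=
  (\esum_(s in [set: n.-tuple G])
     ((\prod_(i < n) m (tnth s i)) * f (gprod (rev s)))%:E)%E.

Definition cdisk (R : realType) : set R[i] := [set z | cabs z < 1].
Definition cpdisk (R : realType) : set R[i] := [set z | cabs z < 1 /\ z != 0].

Definition holo_on (R : realType) (U : set R[i]) (f : R[i] -> R[i]) : Prop :=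
  forall z, U z -> exists l : R[i], (fun h => (f (z + h) - f z) / h) @ dnbhs 0 --> l.

(* f (a function on D^*, values outside D^* irrelevant) belongs to M *)
Definition in_M (R : realType) (f : R[i] -> R[i]) : Prop :=
  holo_on (@cpdisk R) f /\
  exists (k : nat) (g : R[i] -> R[i]),
    holo_on (@cdisk R) g /\ forall z, cpdisk z -> f z = g z / z ^+ k.

Definition ord_ge (R : realType) (f : R[i] -> R[i]) (n : int) : Prop :=
  exists g : R[i] -> R[i],
    holo_on (@cdisk R) g /\ forall z, cpdisk z -> f z = z ^ n * g z.

Definition eval_rep (R : realType) (G : groupType)
    (rho : G -> 'I_2 -> 'I_2 -> R[i] -> R[i]) (t : R[i]) (g : G) : 'M[R[i]]_2 :=
  \matrix_(i, j) rho g i j t.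

Definition is_SL2M_hom (R : realType) (G : groupType)
    (rho : G -> 'I_2 -> 'I_2 -> R[i] -> R[i]) : Prop :=
  [/\ forall g i j, in_M (rho g i j),
      forall g t, cpdisk t -> \det (eval_rep rho t g) = 1 &
      forall g h t, cpdisk t ->
        eval_rep rho t (monoid.mul g h) = eval_rep rho t g *m eval_rep rho t h].

(* operator norm for the max norm on C^2 : max row sum *)
Definition opnorm (R : realType) (A : 'M[R[i]]_2) : R :=
  \big[Num.max/0]_(i < 2) \sum_(j < 2) cabs (A i j).

Definition chi (R : realType) (G : groupType) (m : G -> R)
    (rho : G -> 'I_2 -> 'I_2 -> R[i] -> R[i]) (t : R[i]) : R :=
  lim ((fun n : nat => n%:R^-1 * fine (int_conv m n
          (fun g => ln (opnorm (eval_rep rho t g))))) @ \oo).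

(* log of the non-archimedean norm of rho_na(g):
   log max_{i,j} exp(-ord a_ij) = - min_{i,j} ord a_ij
   = least integer k with ord a_ij >= -k for all i j *)
Definition nalog (R : realType) (G : groupType)
    (rho : G -> 'I_2 -> 'I_2 -> R[i] -> R[i]) (g : G) : R :=
  inf [set x : R | exists k : int, x = k%:~R /\ forall i j, ord_ge (rho g i j) (- k)].

Definition chi_na (R : realType) (G : groupType) (m : G -> R)
    (rho : G -> 'I_2 -> 'I_2 -> R[i] -> R[i]) : R :=
  lim ((fun n : nat => n%:R^-1 * fine (int_conv m n (nalog rho))) @ \oo).

(* Main.v *)
Require Import Defs.
From HB Require Import structures.
From mathcomp Require Import all_boot all_order all_algebra.
From mathcomp Require Import all_classical all_reals all_analysis.
From mathcomp Require Import complex.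
From mathcomp Require Import ring lra zify.
Import Order.TTheory GRing.Theory Num.Theory.
Import numFieldNormedType.Exports.
Local Open Scope classical_set_scope.
Local Open Scope ring_scope.
Set Implicit Arguments.
Unset Strict Implicit.
Unset Printing Implicit Defensive.

(** Divide logarithms of norms by [ln |t|^-1]. The resulting lengths [N_t] on [G]
    converge pointwise to the non-archimedean length [N] (the order of the pole of
    the matrix entries), and all of them are dominated by the word length. The upper
    bound [limsup chi(t) / ln |t|^-1 <= chi_na] then follows from subadditivity.

    For the lower bound suppose [chi_na > 0], and look at the functions
    [det (rho_t(g) rho_t(h) - rho_t(h) rho_t(g))] of [t], which detect common
    eigenlines.
    - If all of them vanish near [0], then [rho_t] has an invariant line. Up to
      [o(1)], [N_t(gh) <= max (phi_t(g) + N_t(h), N_t(g) - phi_t(h))], where the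
      homomorphism [phi_t] comes from the eigenvalue on this line. Hence [chi_na] is
      at most the absolute value of the mean of [phi_t], which bounds
      [chi(t) / ln |t|^-1] from below, up to [o(1)].
    - Otherwise use that [N] satisfies the four-point inequality of a tree, by the
      Pluecker relation. The Gromov products of two independent walks are [o(n)]
      with high probability: if not, the walk would concentrate in one direction,
      which all of [G] would almost fix, so that the determinants above would vanish.
      Therefore for some [n] and every vector [v] the mean of [ln (|g v| / |v|)]
      after [n] steps is at least [n (chi_na - eps)], uniformly in [v]. This
      inequality persists for small [t], and iterating it bounds [chi(t)] from below. *)

(** * Complex differentiability *)

(** The difficulty is an exchange of limits. At a fixed time [n], dominated convergence takes the
    mean of [Nt t] to the mean of [nalog rho]. A drift is the infimum over [n] of means divided by
    [n], so one well-chosen [n] bounds it from above but not from below. A lower bound must survive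
    concatenation of blocks of steps. The growth [psi] of a vector is exactly additive along
    products, so an estimate at one time, uniform in the starting vector, can be iterated for ever
    at fixed [t]. In the reducible case the homomorphism plays this role. It is chosen for each [t]
    separately, without regularity in [t], so the law of large numbers has to be uniform over all
    functions with a given domination constant.

    Complex analysis serves two ends. Dividing out zeros turns the least pole order into a nonzero
    leading coefficient, hence into the exact growth of norms. And one radius, common to all
    functions, on which vanishing to infinite order forces zero: the dichotomy on determinants
    concerns infinitely many pairs at once.

    Times are powers of two, because the directions at times [n] and [2 n] are compared
    repeatedly. *)

Section ComplexBasics.
Variable R : realType.
Local Notation C := R[i].
Local Notation Re := (@complex.Re R).
Local Notation Im := (@complex.Im R).
Implicit Types (x y z w : C) (f g q : C -> C).

Lemma normE z : `|z| = (cabs z)%:C%C. Proof. by []. Qed.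

Lemma cabs0 : cabs (0 : C) = 0. Proof. exact: ComplexField.Normc.normc0. Qed.
Lemma cabs1 : cabs (1 : C) = 1. Proof. exact: ComplexField.Normc.normc1. Qed.
Lemma cabsM z w : cabs (z * w) = cabs z * cabs w.
Proof. exact: ComplexField.Normc.normcM. Qed.
Lemma cabsV z : cabs z^-1 = (cabs z)^-1.
Proof. exact: ComplexField.Normc.normcV. Qed.
Lemma cabsN z : cabs (- z) = cabs z.
Proof. by have := normrN z; rewrite !normE => -[]. Qed.
Lemma cabsB z w : cabs (z - w) = cabs (w - z).
Proof. by rewrite -cabsN opprB. Qed.
Lemma cabsD z w : cabs (z + w) <= cabs z + cabs w.
Proof. by have := ler_normD z w; rewrite !normE -rmorphD lecR. Qed.
Lemma cabs_ge0 z : 0 <= cabs z.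
Proof. by have := normr_ge0 z; rewrite normE -(rmorph0 (real_complex R)) lecR. Qed.
Lemma cabs_eq0 z : (cabs z == 0) = (z == 0).
Proof.
apply/eqP/eqP => [|->]; last exact: cabs0.
exact: ComplexField.Normc.eq0_normc.
Qed.
Lemma cabs_gt0 z : (0 < cabs z) = (z != 0).
Proof. by rewrite lt_def cabs_ge0 andbT cabs_eq0. Qed.
Lemma cabsX z n : cabs (z ^+ n) = cabs z ^+ n.
Proof. by elim: n => [|n IH]; rewrite ?expr0 ?cabs1// !exprS cabsM IH. Qed.
Lemma cabs_real (a : R) : cabs (a%:C)%C = `|a|.
Proof. by rewrite /cabs/ComplexField.Normc.normc /= expr0n /= addr0 sqrtr_sqr. Qed.
Lemma cabs_i : cabs ('i%C : C) = 1.
Proof. by rewrite /cabs/ComplexField.Normc.normc /= expr0n /= add0r expr1n sqrtr1. Qed.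
Lemma Re_le_cabs z : `|Re z| <= cabs z.
Proof. by have := normc_ge_Re z; rewrite normE lecR. Qed.
Lemma Im_le_cabs z : `|Im z| <= cabs z.
Proof.
have := Re_le_cabs ('i%C * z); rewrite cabsM cabs_i mul1r.
have -> : Re ('i%C * z) = - Im z by case: z => a b /=; ring.
by rewrite normrN.
Qed.
Lemma cabs_le_ReIm z : cabs z <= `|Re z| + `|Im z|.
Proof.
have -> : z = (Re z)%:C%C + 'i%C * (Im z)%:C%C.
  by case: z => a b; apply/eqP; rewrite eq_complex /=; apply/andP; split; apply/eqP; ring.
apply: le_trans (cabsD _ _) _; rewrite cabsM cabs_i mul1r !cabs_real.
have -> : Re ((Re z)%:C + 'i * (Im z)%:C)%C = Re z by case: z => a b /=; ring.
by have -> : Im ((Re z)%:C + 'i * (Im z)%:C)%C = Im z by case: z => a b /=; ring.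
Qed.

(** Radii are real here, whereas the balls of [R[i]] have radii in [R[i]]; [nbhs_cabsP] translates
    between the two. *)
Definition cts f z := forall e : R, 0 < e ->
  exists2 d : R, 0 < d & forall w, cabs (w - z) < d -> cabs (f w - f z) < e.

Lemma nbhs_cabsP z (P : set C) : nbhs z P <->
  exists2 d : R, 0 < d & forall w, cabs (w - z) < d -> P w.
Proof.
split.
  move=> /nbhs_ballP[e /= e0 He].
  (* A positive element of [R[i]] has imaginary part 0, so the radius is real. *)
  have eE : e = (Re e)%:C%C.
    by case: e e0 {He} => a b; rewrite ltcE /= => /andP[/eqP -> _].
  exists (Re e); first by move: e0; rewrite {1}eE -(rmorph0 (real_complex R)) ltcR.
  move=> w wd; apply: He; rewrite /ball /= normE eE ltcR /=.
  by rewrite cabsB.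
move=> [d d0 H]; apply/nbhs_ballP; exists (d%:C)%C => /=.
  by rewrite -(rmorph0 (real_complex R)) ltcR.
move=> w; rewrite /ball /= normE ltcR => wd; apply: H.
by rewrite cabsB.
Qed.

Lemma ctsP f z : cts f z <-> f x @[x --> z] --> f z.
Proof.
split.
  move=> H P /nbhs_cabsP[e e0 He].
  have [d d0 Hd] := H e e0.
  by apply/nbhs_cabsP; exists d => // w /Hd /He.
move=> H e e0.
have : nbhs (f z) [set y | cabs (y - f z) < e].
  by apply/nbhs_cabsP; exists e.
by move=> /H /nbhs_cabsP[d d0 Hd]; exists d.
Qed.

Lemma cts_cst c z : cts (fun=> c) z.
Proof. by move=> e e0; exists 1 => // w _; rewrite subrr cabs0. Qed.
Lemma cts_id z : cts id z.
Proof. by move=> e e0; exists e. Qed.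
Lemma ctsD f g z : cts f z -> cts g z -> cts (fun x => f x + g x) z.
Proof.
move=> cf cg e e0.
have [d1 d10 H1] := cf (e / 2) ltac:(by rewrite divr_gt0).
have [d2 d20 H2] := cg (e / 2) ltac:(by rewrite divr_gt0).
exists (Num.min d1 d2); first by rewrite lt_min d10.
move=> w; rewrite lt_min => /andP[/H1 h1 /H2 h2].
have -> : f w + g w - (f z + g z) = (f w - f z) + (g w - g z) by ring.
by apply: le_lt_trans (cabsD _ _) _; lra.
Qed.
Lemma ctsN f z : cts f z -> cts (fun x => - f x) z.
Proof.
move=> cf e e0; have [d d0 H] := cf e e0; exists d => // w /H.
by rewrite cabsB; have -> : f z - f w = - f w - - f z by ring.
Qed.
Lemma ctsB f g z : cts f z -> cts g z -> cts (fun x => f x - g x) z.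
Proof. by move=> a b; apply: ctsD => //; apply: ctsN. Qed.
Lemma ctsM f g z : cts f z -> cts g z -> cts (fun x => f x * g x) z.
Proof. by move=> /ctsP a /ctsP b; apply/ctsP; exact: (@cvgM R[i] _ _ _ f g _ _ a b). Qed.
Lemma ctsV f z : f z != 0 -> cts f z -> cts (fun x => (f x)^-1) z.
Proof. by move=> a /ctsP b; apply/ctsP; exact: (@cvgV R[i] _ _ _ f _ a b). Qed.
Lemma ctsX f n z : cts f z -> cts (fun x => f x ^+ n) z.
Proof.
move=> cf; elim: n => [|n IH]; first exact: cts_cst.
by under eq_fun do rewrite exprS; apply: ctsM.
Qed.
Lemma cts_near f g z (d : R) : 0 < d -> (forall w, cabs (w - z) < d -> f w = g w) ->
  cts f z -> cts g z.
Proof.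
move=> d0 fg cf e e0; have [d1 d10 H] := cf e e0.
exists (Num.min d d1); first by rewrite lt_min d0.
move=> w; rewrite lt_min => /andP[wd wd1].
by rewrite -!fg ?subrr ?cabs0//; exact: H.
Qed.

(* Caratheodory's form of complex differentiability *)
Definition cdiff f z := exists q, (forall w, f w - f z = (w - z) * q w) /\ cts q z.

Lemma cdiffE f z : cdiff f z <->
  exists l : C, (fun h => (f (z + h) - f z) / h) @ dnbhs 0 --> l.
Proof.
split.
  move=> [q [Hq cq]]; exists (q z) => P /nbhs_cabsP[e e0 He].
  have [d d0 Hd] := cq e e0.
  apply/nbhs_cabsP; exists d => // h hd h0; apply: He.
  have -> : (f (z + h) - f z) / h = q (z + h).
    rewrite Hq; have -> : z + h - z = h by ring.
    by rewrite mulrC mulKf.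
  by apply: Hd; move: hd; rewrite subr0; have -> : z + h - z = h by ring.
move=> [l Hl].
exists (fun w => if w == z then l else (f w - f z) / (w - z)); split.
  move=> w; case: eqP => [->|/eqP wz]; first by rewrite !subrr mul0r.
  by rewrite mulrC divfK// subr_eq0.
move=> e e0; rewrite eqxx.
have : nbhs l [set y | cabs (y - l) < e] by apply/nbhs_cabsP; exists e.
move=> /Hl /nbhs_cabsP[d d0 Hd]; exists d => // w wd.
case: eqP => [_|/eqP wz]; first by rewrite subrr cabs0.
have := Hd (w - z); rewrite subr0 => /(_ wd) /=.
have -> : z + (w - z) = w by ring.
by apply; rewrite subr_eq0.
Qed.

Lemma cdiff_cts f z : cdiff f z -> cts f z.
Proof.
move=> [q [Hq cq]].
have : cts (fun w => f z + (w - z) * q w) z.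
  by apply: ctsD; [exact: cts_cst|apply: ctsM => //; apply: ctsB; [exact: cts_id|exact: cts_cst]].
by apply: (@cts_near _ _ _ 1) => // w _; rewrite -Hq; ring.
Qed.

Lemma cdiff_cst c z : cdiff (fun=> c) z.
Proof. by exists (fun=> 0); split=> [w|]; [ring|exact: cts_cst]. Qed.
Lemma cdiff_id z : cdiff id z.
Proof. by exists (fun=> 1); split=> [w|]; [rewrite mulr1|exact: cts_cst]. Qed.
Lemma cdiffD f g z : cdiff f z -> cdiff g z -> cdiff (fun x => f x + g x) z.
Proof.
move=> [p [Hp cp]] [q [Hq cq]]; exists (fun w => p w + q w); split; last exact: ctsD.
by move=> w; rewrite mulrDr -Hp -Hq; ring.
Qed.
Lemma cdiffM f g z : cdiff f z -> cdiff g z -> cdiff (fun x => f x * g x) z.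
Proof.
move=> df dg; have cf := cdiff_cts df.
move: df dg => [p [Hp cp]] [q [Hq cq]].
exists (fun w => f w * q w + g z * p w); split.
  move=> w; have -> : (w - z) * (f w * q w + g z * p w) =
    f w * ((w - z) * q w) + g z * ((w - z) * p w) by ring.
  by rewrite -Hp -Hq; ring.
by apply: ctsD; apply: ctsM => //; exact: cts_cst.
Qed.
Lemma cdiffV f z : f z != 0 -> cdiff f z -> cdiff (fun x => (f x)^-1) z.
Proof.
move=> fz df; have cf := cdiff_cts df.
have [d d0 Hd] := cf (cabs (f z)) ltac:(by rewrite cabs_gt0).
have nz w : cabs (w - z) < d -> f w != 0.
  by move=> /Hd H; apply: contraTneq H => ->; rewrite sub0r cabsN ltxx.
move: df => [p [Hp cp]].
exists (fun w => if w == z then - p z / f z ^+ 2 else ((f w)^-1 - (f z)^-1) / (w - z)); split.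
  move=> w; case: eqP => [->|/eqP wz]; first by rewrite !subrr mul0r.
  by rewrite mulrC divfK// subr_eq0.
apply: (@cts_near (fun w => - p w / (f w * f z)) _ _ d) => //.
  move=> w wd; case: eqP => [->|/eqP wz]; first by rewrite expr2.
  have wz' : w - z != 0 by rewrite subr_eq0.
  have -> : (f w)^-1 - (f z)^-1 = - (f w - f z) / (f w * f z).
    by field; rewrite fz nz.
  by rewrite Hp; field; rewrite fz wz' nz.
apply: ctsM; first exact: ctsN.
by apply: ctsV; [rewrite mulf_neq0|apply: ctsM => //; exact: cts_cst].
Qed.
Lemma cdiffX f n z : cdiff f z -> cdiff (fun x => f x ^+ n) z.
Proof.
move=> cf; elim: n => [|n IH]; first exact: cdiff_cst.
by under eq_fun do rewrite exprS; apply: cdiffM.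
Qed.
Lemma cdiffN f z : cdiff f z -> cdiff (fun x => - f x) z.
Proof.
move=> cf; under eq_fun do rewrite -mulN1r.
by apply: cdiffM => //; exact: cdiff_cst.
Qed.
Lemma cdiffB f g z : cdiff f z -> cdiff g z -> cdiff (fun x => f x - g x) z.
Proof. by move=> a b; apply: cdiffD => //; apply: cdiffN. Qed.
Lemma cdiff_near f g z (d : R) : 0 < d -> (forall w, cabs (w - z) < d -> f w = g w) ->
  cdiff f z -> cdiff g z.
Proof.
move=> d0 fg [q [Hq cq]].
exists (fun w => if w == z then q z else (g w - g z) / (w - z)); split.
  move=> w; case: eqP => [->|/eqP wz]; first by rewrite !subrr mul0r.
  by rewrite mulrC divfK// subr_eq0.
apply: (cts_near d0 _ cq) => w wd; case: eqP => [->//|/eqP wz].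
by rewrite -!fg ?subrr ?cabs0// Hq mulrC mulKf// subr_eq0.
Qed.

Lemma holo_onP (U : set C) f : holo_on U f <-> forall z, U z -> cdiff f z.
Proof. by split=> H z /H /cdiffE. Qed.

End ComplexBasics.

(** * Integration on segments *)

Section SegmentIntegral.
Variable R : realType.
Local Notation C := R[i].
Local Notation Re := (@complex.Re R).
Local Notation Im := (@complex.Im R).
Local Notation RI u a b := (\int[@lebesgue_measure R]_(x in `[a, b]) u x).
Implicit Types (u v : R -> C) (a b c : R).

(** Neighbourhoods are taken in the whole line, also at the endpoints, so the property restricts to
    subsegments. *)
Definition scts u a b := forall x, a <= x <= b -> forall e : R, 0 < e ->
  exists2 d : R, 0 < d & forall y, `|y - x| < d -> cabs (u y - u x) < e.

Definition ci u a b : C := ((RI (Re \o u) a b) +i* (RI (Im \o u) a b))%C.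

Lemma scts_real (k : C -> R) u a b :
  (forall z w, `|k z - k w| <= cabs (z - w)) -> scts u a b ->
  {within `[a, b], continuous (k \o u)}.
Proof.
move=> kl H; apply: continuous_in_subspaceT => x; rewrite inE /= in_itv /= => xab.
apply/cvgrPdist_lt => e e0; have [d d0 Hd] := H x xab e e0.
apply/nbhs_ballP; exists d => //= y; rewrite /ball /= => yd.
by apply: le_lt_trans (kl _ _) _; rewrite cabsB Hd// distrC.
Qed.

Lemma Re_lip (z w : C) : `|Re z - Re w| <= cabs (z - w).
Proof. by have := Re_le_cabs (z - w); case: z w => a b [c d]. Qed.
Lemma Im_lip (z w : C) : `|Im z - Im w| <= cabs (z - w).
Proof. by have := Im_le_cabs (z - w); case: z w => a b [c d]. Qed.

Lemma scts_int (k : C -> R) u a b :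
  (forall z w, `|k z - k w| <= cabs (z - w)) -> scts u a b ->
  lebesgue_measure.-integrable `[a, b] (EFin \o (k \o u)).
Proof.
move=> kl H; apply: continuous_compact_integrable; first exact: segment_compact.
exact: scts_real.
Qed.

Lemma ci_ext u v a b : (forall x, a <= x <= b -> u x = v x) -> ci u a b = ci v a b.
Proof.
move=> uv; congr Complex; apply: eq_Rintegral => x; rewrite inE /= in_itv /= => xab;
  by rewrite uv.
Qed.

Lemma ciD u v a b : scts u a b -> scts v a b ->
  ci (fun x => u x + v x) a b = ci u a b + ci v a b.
Proof.
move=> cu cv; rewrite /ci.
apply/eqP; rewrite eq_complex /=; apply/andP; split; apply/eqP.
  rewrite -RintegralD//; last 2 first.
  - exact: scts_int Re_lip cu.
  - exact: scts_int Re_lip cv.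
  by apply: eq_Rintegral => x _ /=; case: (u x) (v x) => ? ? [].
rewrite -RintegralD//; last 2 first.
- exact: scts_int Im_lip cu.
- exact: scts_int Im_lip cv.
by apply: eq_Rintegral => x _ /=; case: (u x) (v x) => ? ? [].
Qed.

Lemma ciZ k u a b : scts u a b -> ci (fun x => k * u x) a b = k * ci u a b.
Proof.
move=> cu; rewrite /ci.
have iR := scts_int Re_lip cu; have iI := scts_int Im_lip cu.
have mR (r : R) : lebesgue_measure.-integrable `[a, b] (EFin \o (fun x => r * Re (u x))).
  by apply: eq_integrable (integrableZl _ r iR).
have mI (r : R) : lebesgue_measure.-integrable `[a, b] (EFin \o (fun x => r * Im (u x))).
  by apply: eq_integrable (integrableZl _ r iI).
case: k => k1 k2.
apply/eqP; rewrite eq_complex /=; apply/andP; split; apply/eqP.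
  rewrite -(RintegralZl k1 _ iR)// -(RintegralZl k2 _ iI)//.
  rewrite -(RintegralB _ (mR _) (mI _))//.
  by apply: eq_Rintegral => x _ /=; case: (u x).
rewrite -(RintegralZl k2 _ iR)// -(RintegralZl k1 _ iI)//.
rewrite -(RintegralD _ (mI _) (mR _))//.
by apply: eq_Rintegral => x _ /=; case: (u x).
Qed.

Lemma ci_split u a b c : a <= c -> c <= b -> scts u a b ->
  ci u a b = ci u a c + ci u c b.
Proof.
move=> ac cb cu; rewrite /ci.
have split_R (k : R -> R) : lebesgue_measure.-integrable `[a, b] (EFin \o k) ->
    RI k a b = RI k a c + RI k c b.
  move=> ik; have := @Rintegral_itvB R k (BLeft a) (BRight b) c ik.
  rewrite !bnd_simp => /(_ ac cb) H.
  rewrite -(@Rintegral_itv_obnd_cbnd R c (BRight b)); last first.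
    apply: integrableS ik => // x /=; rewrite !in_itv /= => /andP[cx ->].
    by rewrite (le_trans ac (ltW cx)).
  by rewrite -H; ring.
apply/eqP; rewrite eq_complex /=; apply/andP; split; apply/eqP; apply: split_R.
  exact: scts_int Re_lip cu.
exact: scts_int Im_lip cu.
Qed.

Lemma RI_cst (r : R) a b : a <= b -> RI (fun=> r) a b = r * (b - a).
Proof.
move=> ab; rewrite Rintegral_cst//=.
by rewrite lebesgue_measure_itv /= lte_fin; case: ltP => //= ba;
  rewrite (@le_anti _ _ a b) ?ab ?ba// subrr.
Qed.

(** Real and imaginary parts are estimated separately, whence the factor 2. *)
Lemma ci_bound u a b (B : R) : a <= b -> scts u a b ->
  (forall x, a <= x <= b -> cabs (u x) <= B) -> cabs (ci u a b) <= 2 * B * (b - a).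
Proof.
move=> ab cu uB.
have bnd (k : C -> R) : (forall z w, `|k z - k w| <= cabs (z - w)) ->
    (forall z, `|k z| <= cabs z) -> `|RI (k \o u) a b| <= B * (b - a).
  move=> kl kc; have ik := scts_int kl cu.
  apply: le_trans (le_normr_Rintegral _ ik) _ => //.
  rewrite -RI_cst//; apply: le_Rintegral => //.
  - by apply: (integrable_norm ik).
  - apply: continuous_compact_integrable; first exact: segment_compact.
    by move=> ?; exact: cvg_cst.
  - by move=> x; rewrite /= in_itv /= => xab; apply: le_trans (kc _) (uB _ _).
apply: le_trans (cabs_le_ReIm _) _; rewrite /ci /=.
have h1 := bnd _ Re_lip (@Re_le_cabs R); have h2 := bnd _ Im_lip (@Im_le_cabs R).
by apply: le_trans (lerD h1 h2) _; rewrite -mulrA mulr_natl mulr2n.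
Qed.

Lemma ci_cst k a b : a <= b -> ci (fun=> k) a b = (b - a)%:C%C * k.
Proof.
move=> ab; rewrite /ci /= !(RI_cst _ ab).
by case: k => k1 k2; apply/eqP; rewrite eq_complex /=; apply/andP; split; apply/eqP; ring.
Qed.

Lemma RI_id a b : a <= b -> RI id a b = (b ^+ 2 - a ^+ 2) / 2.
Proof.
rewrite le_eqVlt => /orP[/eqP <-|ab].
  by rewrite set_itv1 Rintegral_set1 subrr mul0r.
rewrite /Rintegral (@continuous_FTC2 _ id (fun x => x ^+ 2 / 2)) //=.
- by rewrite -mulrBl.
- by apply: continuous_subspaceT => x; exact: cvg_id.
- have dx (x : R) : derivable (fun x : R => x ^+ 2 / 2) x 1 by apply: derivableM.
  have cx (x : R) : {for x, continuous (fun x : R => x ^+ 2 / 2)}.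
    by apply: differentiable_continuous; apply/derivable1_diffP.
  split=> [x _||]; first exact: dx.
    by apply: cvg_at_right_filter; exact: cx.
  by apply: cvg_at_left_filter; exact: cx.
- move=> x _; rewrite derive1E deriveM// derive_cst scaler0 add0r.
  rewrite exp_derive /= expr1 scaler1 /GRing.scale /=.
  by field.
Qed.

Lemma ci_id a b : a <= b -> ci (fun x => x%:C%C) a b = (((b ^+ 2 - a ^+ 2) / 2)%:C)%C.
Proof. by move=> ab; rewrite /ci; congr Complex; [exact: RI_id|rewrite /= RI_cst// mul0r]. Qed.

End SegmentIntegral.

(** * Rectangles and Goursat's lemma *)

Section Bisection.
Variable R : realType.

(** The supremum of the left ends lies in every interval, because each left end is below each right
    end ([cross]). *)
Lemma nested_point (a : nat -> R) (w : R) : 0 < w ->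
  (forall n, a n.+1 = a n \/ a n.+1 = a n + w / 2 ^+ n.+1) ->
  exists x, forall n, a n <= x <= a n + w / 2 ^+ n.
Proof.
move=> w0 Ha.
have p2 n : (0 : R) < 2 ^+ n by rewrite exprn_gt0.
have up n : a n <= a n.+1.
  case: (Ha n) => -> //; rewrite lerDl divr_ge0// ltW//.
have dn n : a n.+1 + w / 2 ^+ n.+1 <= a n + w / 2 ^+ n.
  have -> : w / 2 ^+ n = 2 * (w / 2 ^+ n.+1) by rewrite exprS; field; rewrite gt_eqF.
  have : 0 < w / 2 ^+ n.+1 by rewrite divr_gt0.
  by case: (Ha n) => ->; lra.
have mono n k : a n <= a (n + k)%N.
  by elim: k => [|k IH]; rewrite ?addn0// addnS; apply: le_trans (up _).
have antim n k : a (n + k)%N + w / 2 ^+ (n + k) <= a n + w / 2 ^+ n.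
  by elim: k => [|k IH]; rewrite ?addn0// addnS; apply: le_trans IH.
have cross n k : a k <= a n + w / 2 ^+ n.
  have [kn|nk] := leqP k n.
    rewrite -(subnKC kn); apply: le_trans (mono _ (n - k)%N) _.
    by rewrite lerDl divr_ge0// ltW.
  rewrite -(subnKC (ltnW nk)); apply: le_trans (antim n (k - n)%N).
  by rewrite lerDl divr_ge0// ltW.
exists (sup (range a)) => n; apply/andP; split.
  by apply: ub_le_sup; [exists (a 0 + w / 2 ^+ 0) => _ [k _ <-]|exists n].
by apply: ge_sup; [exists (a 0), 0%N|move=> _ [k _ <-]].
Qed.

(** Compactness in the form of Goursat's argument: if [P] failed on the whole, it would fail on a
    quarter, then on a quarter of that one, and so on. The failing rectangles shrink to a point,
    where the local hypothesis contradicts them. *)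
Lemma bisection (P : R -> R -> R -> R -> Prop) (a c w h : R) : 0 < w -> 0 < h ->
  (forall a' c' w' h', 0 < w' -> 0 < h' -> a <= a' -> a' + w' <= a + w ->
     c <= c' -> c' + h' <= c + h ->
     P a' c' (w' / 2) (h' / 2) -> P (a' + w' / 2) c' (w' / 2) (h' / 2) ->
     P a' (c' + h' / 2) (w' / 2) (h' / 2) ->
     P (a' + w' / 2) (c' + h' / 2) (w' / 2) (h' / 2) -> P a' c' w' h') ->
  (forall x y, a <= x <= a + w -> c <= y <= c + h ->
     exists2 d : R, 0 < d & forall a' c' w' h', 0 < w' < d -> 0 < h' < d ->
       a <= a' -> a' + w' <= a + w -> c <= c' -> c' + h' <= c + h ->
       a' <= x <= a' + w' -> c' <= y <= c' + h' -> P a' c' w' h') ->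
  P a c w h.
Proof.
move=> w0 h0 glue loc; apply: contrapT => nP.
have p2 n : (0 : R) < 2 ^+ n by rewrite exprn_gt0.
pose W n := w / 2 ^+ n; pose H n := h / 2 ^+ n.
have W0 n : 0 < W n by rewrite divr_gt0.
have H0 n : 0 < H n by rewrite divr_gt0.
have WS n : W n / 2 = W n.+1 by rewrite /W exprS; field; rewrite gt_eqF.
have HS n : H n / 2 = H n.+1 by rewrite /H exprS; field; rewrite gt_eqF.
pose good n (p : R * R) := [/\ a <= p.1, p.1 + W n <= a + w, c <= p.2,
  p.2 + H n <= c + h & ~ P p.1 p.2 (W n) (H n)].
have step n p : exists p', good n p -> good n.+1 p' /\
    (p'.1 = p.1 \/ p'.1 = p.1 + W n.+1) /\ (p'.2 = p.2 \/ p'.2 = p.2 + H n.+1).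
  have [[ap pw cp ph nPp]|ng] := pselect (good n p); last by exists p.
  have Wn := W0 n.+1; have Hn := H0 n.+1; have := WS n; have := HS n => E1 E2.
  have : ~ [/\ P p.1 p.2 (W n.+1) (H n.+1), P (p.1 + W n.+1) p.2 (W n.+1) (H n.+1),
     P p.1 (p.2 + H n.+1) (W n.+1) (H n.+1) &
     P (p.1 + W n.+1) (p.2 + H n.+1) (W n.+1) (H n.+1)].
    by move=> [A B D E]; apply: nPp; apply: glue => //; rewrite !E1 !E2.
  have [A|nA] := pselect (P p.1 p.2 (W n.+1) (H n.+1)); last first.
    by move=> _; exists p => _; split; [split=> //=; lra|split; left].
  have [B|nB] := pselect (P (p.1 + W n.+1) p.2 (W n.+1) (H n.+1)); last first.
    by move=> _; exists (p.1 + W n.+1, p.2) => _; split; [split=> //=; lra|split; [right|left]].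
  have [D|nD] := pselect (P p.1 (p.2 + H n.+1) (W n.+1) (H n.+1)); last first.
    by move=> _; exists (p.1, p.2 + H n.+1) => _; split; [split=> //=; lra|split; [left|right]].
  move=> nE; exists (p.1 + W n.+1, p.2 + H n.+1) => _; split; last by split; right.
  by split=> /=; try lra; move=> E; apply: nE.
have [nxt Hn] : {nxt : nat -> R * R -> R * R & forall n p, good n p -> good n.+1 (nxt n p) /\
    ((nxt n p).1 = p.1 \/ (nxt n p).1 = p.1 + W n.+1) /\
    ((nxt n p).2 = p.2 \/ (nxt n p).2 = p.2 + H n.+1)}.
  exists (fun n p => sval (cid (step n p))) => n p.
  by case: (cid (step n p)).
pose s := fix s n := if n is k.+1 then nxt k (s k) else (a, c).
have sg n : good n (s n).
  elim: n => [|n IH]; first by rewrite /good /= /W /H !expr0 !divr1; split.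
  by have [] := Hn _ _ IH.
have [x Hx] := @nested_point (fun n => (s n).1) w w0 (fun n => (Hn _ _ (sg n)).2.1).
have [y Hy] := @nested_point (fun n => (s n).2) h h0 (fun n => (Hn _ _ (sg n)).2.2).
have [||d d0 Hd] := loc x y.
- by have := Hx 0%N; rewrite /= expr0 divr1.
- by have := Hy 0%N; rewrite /= expr0 divr1.
have [n [nw nh]] : exists n, W n < d /\ H n < d.
  have small (v : R) : 0 < v -> exists n0, forall n, (n0 <= n)%N -> v / 2 ^+ n < d.
    move=> v0; have [n0 Hn0] : exists n0 : nat, v / d < n0%:R.
      by exists (Num.truncn (v / d)).+1; rewrite truncnS_gt.
    exists n0 => n n0n; rewrite ltr_pdivrMr// -ltr_pdivrMl// mulrC.
    apply: lt_trans Hn0 _; rewrite -natrX ltr_nat.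
    by apply: leq_ltn_trans n0n _; rewrite ltn_expl.
  have [n1 H1] := small w w0; have [n2 H2] := small h h0.
  by exists (maxn n1 n2); split; [apply: H1; rewrite leq_maxl|apply: H2; rewrite leq_maxr].
have [g1 g2 g3 g4 g5] := sg n; apply: g5.
by apply: Hd; rewrite ?W0 ?H0.
Qed.

End Bisection.

(** * Contour integrals along rectangles *)

Section Rectangle.
Variable R : realType.
Local Notation C := R[i].
Implicit Types (f g : C -> C) (a b c d x y : R).

Definition pt x y : C := (x +i* y)%C.

Lemma ptE x y : pt x y = x%:C%C + 'i%C * y%:C%C.
Proof. by apply/eqP; rewrite eq_complex /=; apply/andP; split; apply/eqP; ring. Qed.

Lemma ptK (z : C) : pt (complex.Re z) (complex.Im z) = z. Proof. by case: z. Qed.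

Lemma cabs_ptB x y x' y' : cabs (pt x y - pt x' y') <= `|x - x'| + `|y - y'|.
Proof. exact: le_trans (cabs_le_ReIm _) _. Qed.

(** The counterclockwise integral of [f z dz] along the boundary: [dz] is [dx] on horizontal sides
    and ['i dy] on vertical ones. *)
Definition rI f a b c d : C :=
  ci (fun x => f (pt x c)) a b - ci (fun x => f (pt x d)) a b
  + 'i%C * (ci (fun y => f (pt b y)) c d - ci (fun y => f (pt a y)) c d).

Definition bcts f a b c d :=
  (forall x, a <= x <= b -> cts f (pt x c) /\ cts f (pt x d)) /\
  (forall y, c <= y <= d -> cts f (pt a y) /\ cts f (pt b y)).

Definition rcts f a b c d :=
  forall x y, a <= x <= b -> c <= y <= d -> cts f (pt x y).

Lemma rcts_bcts f a b c d : a <= b -> c <= d -> rcts f a b c d -> bcts f a b c d.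
Proof.
move=> ab cd H; split=> [x xab|y ycd]; split; apply: H => //; by rewrite ?lexx ?ab ?cd.
Qed.

Lemma scts_h f a b c : (forall x, a <= x <= b -> cts f (pt x c)) ->
  scts (fun x => f (pt x c)) a b.
Proof.
move=> H x xab e e0; have [d d0 Hd] := H x xab e e0.
exists d => // y yd; apply: Hd; apply: le_lt_trans (cabs_ptB _ _ _ _) _.
by rewrite subrr normr0 addr0.
Qed.

Lemma scts_v f a c d : (forall y, c <= y <= d -> cts f (pt a y)) ->
  scts (fun y => f (pt a y)) c d.
Proof.
move=> H x xab e e0; have [d' d0 Hd] := H x xab e e0.
exists d' => // y yd; apply: Hd; apply: le_lt_trans (cabs_ptB _ _ _ _) _.
by rewrite subrr normr0 add0r.
Qed.

Lemma bcts4 f a b c d : bcts f a b c d ->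
  [/\ scts (fun x => f (pt x c)) a b, scts (fun x => f (pt x d)) a b,
      scts (fun y => f (pt a y)) c d & scts (fun y => f (pt b y)) c d].
Proof.
move=> [H1 H2]; split.
- by apply: scts_h => x /H1[].
- by apply: scts_h => x /H1[].
- by apply: scts_v => y /H2[].
- by apply: scts_v => y /H2[].
Qed.

Lemma rI_D f g a b c d : bcts f a b c d -> bcts g a b c d ->
  rI (fun z => f z + g z) a b c d = rI f a b c d + rI g a b c d.
Proof.
by move=> /bcts4[? ? ? ?] /bcts4[? ? ? ?]; rewrite /rI !ciD//; ring.
Qed.

Lemma rI_Z k f a b c d : bcts f a b c d ->
  rI (fun z => k * f z) a b c d = k * rI f a b c d.
Proof. by move=> /bcts4[? ? ? ?]; rewrite /rI !ciZ//; ring. Qed.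

Lemma rI_ext f g a b c d :
  (forall x, a <= x <= b -> f (pt x c) = g (pt x c) /\ f (pt x d) = g (pt x d)) ->
  (forall y, c <= y <= d -> f (pt a y) = g (pt a y) /\ f (pt b y) = g (pt b y)) ->
  rI f a b c d = rI g a b c d.
Proof.
move=> H1 H2; rewrite /rI; congr (_ - _ + _ * (_ - _)); apply: ci_ext => x.
- by case/H1.
- by case/H1.
- by case/H2.
- by case/H2.
Qed.

Lemma rI_bound f a b c d (B : R) : a <= b -> c <= d -> bcts f a b c d ->
  (forall x, a <= x <= b -> cabs (f (pt x c)) <= B /\ cabs (f (pt x d)) <= B) ->
  (forall y, c <= y <= d -> cabs (f (pt a y)) <= B /\ cabs (f (pt b y)) <= B) ->
  cabs (rI f a b c d) <= 4 * B * ((b - a) + (d - c)).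
Proof.
move=> ab cd /bcts4[s1 s2 s3 s4] H1 H2.
have b1 := ci_bound ab s1 (fun x h => (H1 x h).1).
have b2 := ci_bound ab s2 (fun x h => (H1 x h).2).
have b3 := ci_bound cd s3 (fun x h => (H2 x h).1).
have b4 := ci_bound cd s4 (fun x h => (H2 x h).2).
have tri (u v : C) : cabs (u - v) <= cabs u + cabs v.
  by apply: le_trans (cabsD _ _) _; rewrite cabsN.
rewrite /rI; set u1 := ci _ a b; set u2 := ci _ a b; set u3 := ci _ c d; set u4 := ci _ c d.
apply: le_trans (cabsD _ _) _; rewrite cabsM cabs_i mul1r.
have t1 := tri u1 u2; have t2 := tri u3 u4.
move: b1 b2 b3 b4; rewrite -/u1 -/u2 -/u3 -/u4 => b1 b2 b3 b4.
by apply: le_trans (lerD t1 t2) _; nra.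
Qed.

Lemma rI_splitx f a m b c d : a <= m -> m <= b ->
  (forall x, a <= x <= b -> cts f (pt x c) /\ cts f (pt x d)) ->
  rI f a b c d = rI f a m c d + rI f m b c d.
Proof.
move=> am mb H; rewrite /rI.
have h1 : scts (fun x => f (pt x c)) a b by apply: scts_h => x /H [].
have h2 : scts (fun x => f (pt x d)) a b by apply: scts_h => x /H [].
by rewrite (ci_split am mb h1) (ci_split am mb h2); ring.
Qed.

Lemma rI_splity f a b c m d : c <= m -> m <= d ->
  (forall y, c <= y <= d -> cts f (pt a y) /\ cts f (pt b y)) ->
  rI f a b c d = rI f a b c m + rI f a b m d.
Proof.
move=> am mb H; rewrite /rI.
have h1 : scts (fun y => f (pt a y)) c d by apply: scts_v => x /H [].
have h2 : scts (fun y => f (pt b y)) c d by apply: scts_v => x /H [].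
by rewrite (ci_split am mb h1) (ci_split am mb h2); ring.
Qed.

(** The case that can be computed by hand; it lets [goursat] subtract a first-order expansion at no
    cost. *)
Lemma rI_affine (k l : C) a b c d : a <= b -> c <= d ->
  rI (fun z => k + l * z) a b c d = 0.
Proof.
move=> ab cd.
have sc a' b' (k' : C) : scts (fun=> k') a' b'.
  by move=> x _ e e0; exists 1 => // y _; rewrite subrr cabs0.
have si a' b' : scts (fun x => x%:C%C : C) a' b'.
  by move=> x _ e e0; exists e => // y ye; rewrite -rmorphB cabs_real.
have smul a' b' (k' : C) u : scts u a' b' -> scts (fun x => k' * u x) a' b'.
  move=> su x xab e e0.
  have [d' d'0 Hd] := su x xab (e / (cabs k' + 1)) ltac:(by rewrite divr_gt0// ltr_pwDr// cabs_ge0).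
  exists d' => // y /Hd; rewrite -mulrBr cabsM => H.
  have k0 := cabs_ge0 k'; have k1 : 0 < cabs k' + 1 by rewrite ltr_pwDr.
  move: H; rewrite ltr_pdivlMr// => H.
  by apply: le_lt_trans H; have := cabs_ge0 (u y - u x); nra.
rewrite /rI.
have E1 y : ci (fun x => k + l * pt x y) a b =
    (b - a)%:C%C * (k + l * 'i%C * y%:C%C) + l * (((b ^+ 2 - a ^+ 2) / 2)%:C)%C.
  rewrite -ci_cst// -ci_id// -ciZ; last exact: si.
  rewrite -ciD; [|exact: sc|exact/smul/si].
  by apply: ci_ext => x _; rewrite ptE; ring.
have E2 x : ci (fun y => k + l * pt x y) c d =
    (d - c)%:C%C * (k + l * x%:C%C) + (l * 'i%C) * (((d ^+ 2 - c ^+ 2) / 2)%:C)%C.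
  rewrite -ci_cst// -ci_id// -ciZ; last exact: si.
  rewrite -ciD; [|exact: sc|exact/smul/si].
  by apply: ci_ext => y _; rewrite ptE; ring.
rewrite !E1 !E2 !rmorphB /=.
have ii : 'i%C * 'i%C = -1 :> C by rewrite -expr2 sqr_i.
by ring: ii.
Qed.

End Rectangle.

(** * Goursat's lemma, also with one exceptional point *)

Section Goursat.
Variable R : realType.
Local Notation C := R[i].
Implicit Types (f g : C -> C) (a b c d x y : R).

Lemma rcts_sub f a b c d a' b' c' d' : a <= a' -> b' <= b -> c <= c' -> d' <= d ->
  rcts f a b c d -> rcts f a' b' c' d'.
Proof.
move=> aa bb cc dd H x y /andP[x1 x2] /andP[y1 y2]; apply: H; apply/andP; split; lra.
Qed.

Lemma cts_affine (k l z : C) : cts (fun w => k + l * w) z.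
Proof. by apply: ctsD; [exact: cts_cst|apply: ctsM; [exact: cts_cst|exact: cts_id]]. Qed.

Lemma goursat f a b c d : a < b -> c < d ->
  (forall x y, a <= x <= b -> c <= y <= d -> cdiff f (pt x y)) -> rI f a b c d = 0.
Proof.
move=> ab cd df.
have cf : rcts f a b c d by move=> x y hx hy; apply: cdiff_cts; apply: df.
suff key e : 0 < e -> cabs (rI f a b c d) <= e * ((b - a) + (d - c)) ^+ 2.
  apply/eqP; rewrite -cabs_eq0 eq_le cabs_ge0 andbT; apply/ler_addgt0Pr => e e0.
  have s0 : 0 < (b - a + (d - c)) ^+ 2 by rewrite exprn_gt0// addr_gt0 ?subr_gt0.
  apply: le_trans (key (e / (b - a + (d - c)) ^+ 2) (divr_gt0 e0 s0)) _.
  by rewrite divfK ?gt_eqF// add0r.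
move=> e0.
(* The bound is quadratic in the size: each quarter of a rectangle gets a quarter of it, so the four
   bounds add up exactly. *)
pose P a' c' w h := cabs (rI f a' (a' + w) c' (c' + h)) <= e * (w + h) ^+ 2.
have : P a c (b - a) (d - c).
  have ew : a + (b - a) = b by ring.
  have eh : c + (d - c) = d by ring.
  apply: (@bisection R P); rewrite ?subr_gt0// ?ew ?eh.
    move=> a' c' w h w0 h0 aa' aw cc' ch.
    rewrite /P.
    have -> : a' + w / 2 + w / 2 = a' + w by field.
    have -> : c' + h / 2 + h / 2 = c' + h by field.
    have ct : rcts f a' (a' + w) c' (c' + h) by apply: rcts_sub cf.
    have bx y1 : c' <= y1 <= c' + h -> forall x, a' <= x <= a' + w -> cts f (pt x y1).
      by move=> h1 x h2; exact: ct.
    rewrite (@rI_splitx _ f a' (a' + w / 2) (a' + w) c' (c' + h)); first last.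
    - by move=> x hx; split; apply: ct => //; lra.
    - by lra.
    - by lra.
    rewrite (@rI_splity _ f a' (a' + w / 2) c' (c' + h / 2) (c' + h)); first last.
    - by move=> y hy; split; apply: ct => //; lra.
    - by lra.
    - by lra.
    rewrite (@rI_splity _ f (a' + w / 2) (a' + w) c' (c' + h / 2) (c' + h)); first last.
    - by move=> y hy; split; apply: ct => //; lra.
    - by lra.
    - by lra.
    move=> h1 h2 h3 h4.
    set u1 := rI _ _ _ _ _ in h1 *; set u3 := rI _ _ _ _ _ in h3 *.
    set u2 := rI _ _ _ _ _ in h2 *; set u4 := rI _ _ _ _ _ in h4 *.
    apply: le_trans (cabsD _ _) _.
    apply: le_trans (lerD (cabsD _ _) (cabsD _ _)) _.
    have -> : e * (w + h) ^+ 2 = 4 * (e * (w / 2 + h / 2) ^+ 2) by field.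
    by lra.
  move=> x y hx hy; have [q [Hq cq]] := df x y hx hy.
  have [dl dl0 Hd] := cq (e / 4) ltac:(by rewrite divr_gt0).
  exists (dl / 2); first by rewrite divr_gt0.
  move=> a' c' w h /andP[w0 wd] /andP[h0 hd] aa' aw cc' ch hx' hy'; rewrite /P.
  set p := pt x y in Hq cq Hd.
  (* The remainder of the first-order expansion at [p]. It is at most [(w + h) * (e / 4)] on the
     rectangle, and the 4 in [rI_bound] turns this into the required bound. *)
  pose g z := f z - (f p - q p * p + q p * z).
  have ct : bcts f a' (a' + w) c' (c' + h).
    by apply: rcts_bcts; [lra|lra|apply: rcts_sub cf; lra].
  have cg : bcts g a' (a' + w) c' (c' + h).
    case: ct => c1 c2; split=> [u hu|u hu].
      by have [? ?] := c1 u hu; split; apply: ctsB => //; exact: cts_affine.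
    by have [? ?] := c2 u hu; split; apply: ctsB => //; exact: cts_affine.
  have -> : rI f a' (a' + w) c' (c' + h) = rI g a' (a' + w) c' (c' + h).
    have fE : f = (fun z => g z + (f p - q p * p + q p * z)).
      by apply/funext => z; rewrite /g subrK.
    transitivity (rI (fun z => g z + (f p - q p * p + q p * z)) a' (a' + w) c' (c' + h)).
      by rewrite -fE.
    rewrite rI_D//; last by split=> *; split; exact: cts_affine.
    by rewrite rI_affine ?addr0//; lra.
  have gb u v : a' <= u <= a' + w -> c' <= v <= c' + h ->
      cabs (g (pt u v)) <= (w + h) * (e / 4).
    move=> hu hv; have -> : g (pt u v) = (pt u v - p) * (q (pt u v) - q p).
      rewrite /g mulrBr -Hq; ring.
    have n1 : cabs (pt u v - p) <= w + h.
      apply: le_trans (cabs_ptB _ _ _ _) _; apply: lerD; rewrite ler_norml; lra.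
    rewrite cabsM; apply: ler_pM; rewrite ?cabs_ge0//.
    by apply/ltW/Hd; apply: le_lt_trans n1 _; lra.
  apply: le_trans (rI_bound (B := (w + h) * (e / 4)) _ _ cg _ _) _; try lra.
  - by move=> u hu; split; apply: gb => //; lra.
  - by move=> v hv; split; apply: gb => //; lra.
by rewrite /P !addrA !(addrC _ b) !(addrC _ d) !addrK.
Qed.

(** At the puncture only continuity is available. A small square around it is cut out: [goursat]
    covers the other pieces, and the integral along the square is small with its perimeter. *)
Lemma goursat_punctured f a b c d px py : a < px < b -> c < py < d ->
  rcts f a b c d ->
  (forall x y, a <= x <= b -> c <= y <= d -> pt x y != pt px py -> cdiff f (pt x y)) ->
  rI f a b c d = 0.
Proof.
move=> /andP[ap pb] /andP[cp pd] cf df; have cd := lt_trans cp pd.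
have ne x y : x != px \/ y != py -> pt x y != pt px py.
  by rewrite /pt => -[] h; apply/eqP => -[] h1 h2; move: h; rewrite ?h1 ?h2 eqxx.
have [dl dl0 Hd] := cf px py ltac:(by lra) ltac:(by lra) 1 ltr01.
set B := cabs (f (pt px py)) + 1.
have B0 : 0 < B by rewrite ltr_pwDr// cabs_ge0.
apply/eqP; rewrite -cabs_eq0 eq_le cabs_ge0 andbT; apply/ler_addgt0Pr => e e0.
(* [n] is half the side of the square. The choice [dl / 4] keeps the square where continuity bounds
   [f] by [B], and [16 * B * n] is what [rI_bound] yields there. *)
pose n := Num.min (Num.min (px - a) (b - px)) (Num.min (Num.min (py - c) (d - py))
            (Num.min (dl / 4) (e / (16 * B)))).
have n0 : 0 < n by rewrite !lt_min !subr_gt0 ap pb cp pd !divr_gt0// mulr_gt0.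
have [n1 n2 n3 n4 [n5 n6]] : [/\ n <= px - a, n <= b - px, n <= py - c, n <= d - py &
    n <= dl / 4 /\ n <= e / (16 * B)].
  by have := lexx n; rewrite {2}/n !le_min => /andP[/andP[-> ->] /andP[/andP[-> ->] /andP[-> ->]]].
rewrite (@rI_splitx _ f a (px - n) b); [|lra|lra|by move=> x hx; split; apply: cf; lra].
rewrite (@rI_splitx _ f (px - n) (px + n) b); [|lra|lra|by move=> x hx; split; apply: cf; lra].
(* The square may touch the outer boundary, since [n] can equal one of the distances; the strip is
   then degenerate and [flat] applies. *)
have z1 : rI f a (px - n) c d = 0 \/ a = px - n.
  have [h|h] := ltP a (px - n); [left|right; lra].
  by apply: goursat => // x y hx hy; apply: df; [lra|lra|apply: ne; left; apply/eqP; lra].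
have z2 : rI f (px + n) b c d = 0 \/ px + n = b.
  have [h|h] := ltP (px + n) b; [left|right; lra].
  by apply: goursat => // x y hx hy; apply: df; [lra|lra|apply: ne; left; apply/eqP; lra].
have flat a' c' d' g : rI g a' a' c' d' = 0.
  rewrite /rI.
  have E (u : R -> C) : ci u a' a' = 0.
    by rewrite /ci !set_itv1 !Rintegral_set1.
  by rewrite !E !subrr mulr0 addr0.
have {}z1 : rI f a (px - n) c d = 0 by case: z1 => // <-.
have {}z2 : rI f (px + n) b c d = 0 by case: z2 => // ->.
rewrite z1 z2 add0r addr0.
rewrite (@rI_splity _ f _ _ c (py - n) d); [|lra|lra|by move=> x hx; split; apply: cf; lra].
rewrite (@rI_splity _ f _ _ (py - n) (py + n) d); [|lra|lra|by move=> x hx; split; apply: cf; lra].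
have flat' a' b' c' g : rI g a' b' c' c' = 0.
  rewrite /rI.
  have E (u : R -> C) : ci u c' c' = 0.
    by rewrite /ci !set_itv1 !Rintegral_set1.
  by rewrite !E !subrr mulr0 addr0.
have z3 : rI f (px - n) (px + n) c (py - n) = 0.
  have [h|h] := ltP c (py - n); last by have -> : c = py - n by lra.
  by apply: goursat => [|//|x y hx hy]; [lra|apply: df; [lra|lra|apply: ne; right; apply/eqP; lra]].
have z4 : rI f (px - n) (px + n) (py + n) d = 0.
  have [h|h] := ltP (py + n) d; last by have -> : py + n = d by lra.
  by apply: goursat => [|//|x y hx hy]; [lra|apply: df; [lra|lra|apply: ne; right; apply/eqP; lra]].
rewrite z3 z4 !add0r addr0.
have fb x y : px - n <= x <= px + n -> py - n <= y <= py + n -> cabs (f (pt x y)) <= B.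
  move=> hx hy; have -> : f (pt x y) = (f (pt x y) - f (pt px py)) + f (pt px py) by ring.
  apply: le_trans (cabsD _ _) _; rewrite /B addrC lerD2l; apply/ltW/Hd.
  apply: le_lt_trans (cabs_ptB _ _ _ _) _.
  have := ler_norml (x - px) n; have := ler_norml (y - py) n.
  have -> : - n <= x - px <= n by lra.
  have -> : - n <= y - py <= n by lra.
  by move=> h1 h2; lra.
apply: le_trans (rI_bound (B := B) _ _ _ _ _) _; try lra.
- by apply: rcts_bcts; [lra|lra|apply: rcts_sub cf; lra].
- by move=> x hx; split; apply: fb => //; lra.
- by move=> x hx; split; apply: fb => //; lra.
- have : n * (16 * B) <= e by rewrite -ler_pdivlMr// mulr_gt0.
  by nra.
Qed.

End Goursat.

(** * Cauchy transforms and orders of vanishing *)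

Section CauchyTransform.
Variable R : realType.
Local Notation C := R[i].
Local Notation Re := (@complex.Re R).
Local Notation Im := (@complex.Im R).
Local Notation h := (2^-1 : R).
Implicit Types (f g phi : C -> C) (x y : R) (z w : C).

Definition onG w := Num.max `|Re w| `|Im w| = h.

(** A square contour of side 1 inside the unit disk, at distance at least [1 / 4] from every point
    [z] with [cabs z <= 1 / 4]. *)
Definition Gam f : C := rI f (- h) h (- h) h.

Definition gcts phi := forall w, onG w -> cts phi w.

Lemma h_gt0 : 0 < h. Proof. by rewrite invr_gt0. Qed.

Lemma sideG x : - h <= x <= h ->
  [/\ onG (pt x (- h)), onG (pt x h), onG (pt (- h) x) & onG (pt h x)].
Proof.
move=> hx; have xh : `|x| <= h by rewrite ler_norml.
have hh : `|h| = h by rewrite ger0_norm// ltW// h_gt0.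
by split; rewrite /onG /= ?normrN hh; (apply/max_idPr || apply/max_idPl).
Qed.

Lemma gcts_bcts phi : gcts phi -> bcts phi (- h) h (- h) h.
Proof. by move=> H; split=> x /sideG[? ? ? ?]; split; exact: H. Qed.

Lemma Gam_ext f g : (forall w, onG w -> f w = g w) -> Gam f = Gam g.
Proof. by move=> H; apply: rI_ext => x /sideG[? ? ? ?]; split; exact: H. Qed.

Lemma Gam_bound f (B : R) : gcts f -> (forall w, onG w -> cabs (f w) <= B) ->
  cabs (Gam f) <= 8 * B.
Proof.
move=> cf fB; have h0 := h_gt0.
apply: le_trans (rI_bound (B := B) _ _ (gcts_bcts cf) _ _) _; try lra.
- by move=> x /sideG[? ? ? ?]; split; exact: fB.
- by move=> x /sideG[? ? ? ?]; split; exact: fB.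
Qed.

Lemma Gam_D f g : gcts f -> gcts g -> Gam (fun z => f z + g z) = Gam f + Gam g.
Proof. by move=> /gcts_bcts ? /gcts_bcts ?; exact: rI_D. Qed.

Lemma Gam_Z k f : gcts f -> Gam (fun z => k * f z) = k * Gam f.
Proof. by move=> /gcts_bcts ?; exact: rI_Z. Qed.

Lemma onG_ge w : onG w -> h <= cabs w.
Proof. by rewrite /onG => <-; rewrite ge_max Re_le_cabs Im_le_cabs. Qed.

Lemma sqr_cabs w : cabs w ^+ 2 = Re w ^+ 2 + Im w ^+ 2.
Proof. by case: w => a b; rewrite /cabs /= sqr_sqrtr// addr_ge0// sqr_ge0. Qed.

Lemma box_disk x y : - h <= x <= h -> - h <= y <= h -> cabs (pt x y) < 1.
Proof.
move=> hx hy; rewrite -(@ltr_pXn2r _ 2)// ?nnegrE ?cabs_ge0//.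
rewrite expr1n sqr_cabs /=.
have : x ^+ 2 <= h ^+ 2 by nra.
have : y ^+ 2 <= h ^+ 2 by nra.
have : h ^+ 2 = 1 / 4 by field.
lra.
Qed.

Lemma onG_box w : onG w -> - h <= Re w <= h /\ - h <= Im w <= h.
Proof. by rewrite /onG => <-; rewrite -!ler_norml !le_max !lexx orbT. Qed.

Lemma onG_disk w : onG w -> cabs w < 1.
Proof. by move=> /onG_box[h1 h2]; rewrite -(ptK w); exact: box_disk. Qed.

Lemma onG_dist w z : onG w -> cabs z <= 1 / 4 -> 1 / 4 <= cabs (w - z).
Proof.
move=> /onG_ge hw hz; have := cabsD (w - z) z; rewrite subrK.
have : h = 1 / 2 by field.
by lra.
Qed.

Lemma onG_neq w z : onG w -> cabs z <= 1 / 4 -> w - z != 0.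
Proof. by move=> hw hz; rewrite -cabs_gt0; apply: lt_le_trans (onG_dist hw hz); lra. Qed.

Lemma onG_neq0 w : onG w -> w != 0.
Proof. by move=> /onG_ge; rewrite -cabs_gt0; apply: lt_le_trans; exact: h_gt0. Qed.

(** The Cauchy transform without the factor [1 / (2 pi i)]; the transform of the constant 1 takes
    over the role of [2 pi i]. *)
Definition cauchyK phi z := Gam (fun w => phi w / (w - z)).

Lemma gcts_kernel phi z : gcts phi -> cabs z <= 1 / 4 -> gcts (fun w => phi w / (w - z)).
Proof.
move=> cp hz w hw; apply: ctsM; first exact: cp.
apply: ctsV; first exact: onG_neq.
by apply: ctsB; [exact: cts_id|exact: cts_cst].
Qed.

Lemma gcts_div phi : gcts phi -> gcts (fun w => phi w / w).
Proof.
move=> cp w hw; apply: ctsM; first exact: cp.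
by apply: ctsV; [exact: onG_neq0|exact: cts_id].
Qed.

Lemma cabs0_le : cabs (0 : C) <= 1 / 4. Proof. by rewrite cabs0; lra. Qed.

(** One step of the geometric expansion, [1/(w - z) = 1/w + z/(w (w - z))]. Iterated, it produces
    the Taylor coefficients at 0. *)
Lemma cauchyK_rec phi z : gcts phi -> cabs z <= 1 / 4 ->
  cauchyK phi z = cauchyK phi 0 + z * cauchyK (fun w => phi w / w) z.
Proof.
move=> cp hz; rewrite /cauchyK -Gam_Z; last exact/gcts_kernel/hz/gcts_div.
rewrite -Gam_D; first last.
- move=> w hw; apply: ctsM; first exact: cts_cst.
  by apply: gcts_kernel => //; exact: gcts_div.
- by apply: gcts_kernel => //; exact: cabs0_le.
apply: Gam_ext => w hw; rewrite subr0.
by field; rewrite (onG_neq0 hw) (onG_neq hw hz).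
Qed.

Lemma cauchyK_bound phi z (B : R) : gcts phi -> cabs z <= 1 / 4 -> 0 <= B ->
  (forall w, onG w -> cabs (phi w) <= B) -> cabs (cauchyK phi z) <= 32 * B.
Proof.
move=> cp hz B0 pB.
apply: le_trans (Gam_bound (B := 4 * B) (gcts_kernel cp hz) _) _; last by lra.
move=> w hw; rewrite cabsM cabsV mulrC; apply: ler_pM; rewrite ?invr_ge0 ?cabs_ge0//; last exact: pB.
rewrite -[leRHS]invrK lef_pV2 ?posrE ?invr_gt0//; last first.
  by apply: lt_le_trans (onG_dist hw hz); lra.
by apply: le_trans (onG_dist hw hz); lra.
Qed.

Lemma gcts_bounded phi : gcts phi -> exists2 B : R, 0 <= B & forall w, onG w -> cabs (phi w) <= B.
Proof.
move=> /gcts_bcts/bcts4[s1 s2 s3 s4].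
have clip (z w : C) : `|cabs z - cabs w| <= cabs (z - w).
  rewrite ler_norml; have := cabsD (z - w) w; have := cabsD (w - z) z.
  by rewrite !subrK (cabsB w z); lra.
have hh : - h <= h by have := h_gt0; lra.
have bd u : scts u (- h) h -> exists B, forall x, - h <= x <= h -> cabs (u x) <= B.
  move=> su; have [c _ Hc] := EVT_max hh (scts_real clip su).
  by exists (cabs (u c)) => x hx; apply: Hc; rewrite in_itv.
have [B1 H1] := bd _ s1; have [B2 H2] := bd _ s2.
have [B3 H3] := bd _ s3; have [B4 H4] := bd _ s4.
have h0 : - h <= h <= h by rewrite lexx hh.
have p1 := le_trans (cabs_ge0 _) (H1 h h0); have p2 := le_trans (cabs_ge0 _) (H2 h h0).
have p3 := le_trans (cabs_ge0 _) (H3 h h0); have p4 := le_trans (cabs_ge0 _) (H4 h h0).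
exists (B1 + B2 + B3 + B4); first by rewrite !addr_ge0.
move=> w hw; have [b1 b2] := onG_box hw.
have cases : (Re w = h \/ Re w = - h) \/ (Im w = h \/ Im w = - h).
  move: hw; rewrite /onG; case: (leP `|Re w| `|Im w|) => _ H.
    by right; case: (ger0P (Im w)) H => _ H; [left|right; rewrite -H opprK].
  by left; case: (ger0P (Re w)) H => _ H; [left|right; rewrite -H opprK].
rewrite -(ptK w); case: cases => -[] ->.
- by have := H4 _ b2; lra.
- by have := H3 _ b2; lra.
- by have := H2 _ b1; lra.
- by have := H1 _ b1; lra.
Qed.

Lemma cauchyK_cts0 phi : gcts phi -> cts (cauchyK phi) 0.
Proof.
move=> cp; have cq := gcts_div cp; have [B B0 HB] := gcts_bounded cq.
move=> e e0; exists (Num.min (1 / 4) (e / (32 * B + 1))).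
  by rewrite lt_min !divr_gt0//; lra.
move=> w; rewrite subr0 lt_min => /andP[/ltW w1 w2].
rewrite (cauchyK_rec cp w1).
have -> : cauchyK phi 0 + w * cauchyK (fun w0 => phi w0 / w0) w - cauchyK phi 0 =
  w * cauchyK (fun w0 => phi w0 / w0) w by ring.
have bb := cauchyK_bound cq w1 B0 HB.
rewrite cabsM; move: w2; rewrite ltr_pdivlMr; last lra.
apply: le_lt_trans; apply: ler_wpM2l; rewrite ?cabs_ge0//; lra.
Qed.

(** By [cauchyK_rec] the difference quotient at 0 is itself a Cauchy transform, which is continuous
    at 0. *)
Lemma cauchyK_cdiff0 phi : gcts phi -> cdiff (cauchyK phi) 0.
Proof.
move=> cp.
apply: (@cdiff_near _ (fun w => cauchyK phi 0 + w * cauchyK (fun w => phi w / w) w) _ _ (1/4)).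
- by lra.
- by move=> w; rewrite subr0 => /ltW hw; rewrite -cauchyK_rec.
exists (cauchyK (fun w => phi w / w)); split; first by move=> w; ring.
by apply: cauchyK_cts0; exact: gcts_div.
Qed.

Lemma RI_ge (k : C -> R) (u : R -> C) (r : R) :
  (forall z w, `|k z - k w| <= cabs (z - w)) -> scts u (- h) h ->
  (forall x, - h <= x <= h -> r <= k (u x)) ->
  r <= \int[@lebesgue_measure R]_(x in `[- h, h]) (k \o u) x.
Proof.
move=> kl su H; have hh : - h <= h by have := h_gt0; lra.
have E : r = r * (h - - h) by field.
rewrite E -RI_cst//; apply: le_Rintegral => //.
- apply: continuous_compact_integrable; first exact: segment_compact.
  by move=> ?; exact: cvg_cst.
- exact: scts_int.
Qed.

(** The imaginary part collects one contribution from each side. Each is at least 1, because up to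
    sign the relevant component of [1 / w] is [h / (x ^+ 2 + h ^+ 2)], and [x ^+ 2 + h ^+ 2 <= h]
    for half-side [h = 1 / 2]. *)
Lemma cauchyK1_neq0 : cauchyK (fun=> 1) 0 != 0.
Proof.
have c1 : gcts (fun=> 1 : C) by move=> w _; exact: cts_cst.
have := gcts_kernel c1 cabs0_le => /gcts_bcts/bcts4[s1 s2 s3 s4].
have hE : h = 1 / 2 by field.
suff : 0 < Im (cauchyK (fun=> 1) 0) by apply: contraTneq => ->; rewrite /= ltxx.
have ImE : Im (cauchyK (fun=> 1) 0) =
    Im (ci (fun x => 1 / (pt x (- h) - 0)) (- h) h) - Im (ci (fun x => 1 / (pt x h - 0)) (- h) h)
    + (Re (ci (fun y => 1 / (pt h y - 0)) (- h) h) - Re (ci (fun y => 1 / (pt (- h) y - 0)) (- h) h)).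
  rewrite /cauchyK /Gam /rI.
  move: (ci _ _ _) (ci _ _ _) (ci _ _ _) (ci _ _ _) => [a1 a2] [b1 b2] [a3 a4] [b3 b4] /=; ring.
rewrite ImE /ci /=.
have inv (x y : R) : 1 / (pt x y - 0) = pt (x / (x ^+ 2 + y ^+ 2)) (- (y / (x ^+ 2 + y ^+ 2))).
  by rewrite div1r subr0.
have h2 : h ^+ 2 = 1 / 4 by rewrite hE; field.
have pos (x : R) : 0 < x ^+ 2 + h ^+ 2 by have := sqr_ge0 x; lra.
have up (x : R) : - h <= x <= h -> x ^+ 2 + h ^+ 2 <= h.
  by rewrite hE => hx; nra.
have one (x : R) : - h <= x <= h -> 1 <= h / (x ^+ 2 + h ^+ 2).
  by move=> hx; rewrite ler_pdivlMr// mul1r up.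
have NIm_lip (z w : C) : `|- Im z - - Im w| <= cabs (z - w).
  by rewrite -opprD normrN; exact: Im_lip.
have r1 := RI_ge (r := 1) (@Im_lip R) s1.
have r2 := RI_ge (r := 1) NIm_lip s2.
have r4 := RI_ge (r := 1) (@Re_lip R) s4.
have NRe_lip (z w : C) : `|- Re z - - Re w| <= cabs (z - w).
  by rewrite -opprD normrN; exact: Re_lip.
have r3 := RI_ge (r := 1) NRe_lip s3.
have {}r1 : 1 <= \int[@lebesgue_measure R]_(x in `[- h, h]) Im (1 / (pt x (- h) - 0)).
  by apply: r1 => x hx; rewrite inv /= sqrrN mulNr opprK one.
have {}r2 : 1 <= \int[@lebesgue_measure R]_(x in `[- h, h]) (- Im (1 / (pt x h - 0))).
  by apply: r2 => x hx; rewrite inv /= opprK one.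
have {}r3 : 1 <= \int[@lebesgue_measure R]_(x in `[- h, h]) (- Re (1 / (pt (- h) x - 0))).
  by apply: r3 => x hx; rewrite inv /= sqrrN mulNr opprK addrC one.
have {}r4 : 1 <= \int[@lebesgue_measure R]_(x in `[- h, h]) Re (1 / (pt h x - 0)).
  by apply: r4 => x hx; rewrite inv /= addrC one.
have RN (k : C -> R) u : (forall z w, `|k z - k w| <= cabs (z - w)) -> scts u (- h) h ->
    \int[@lebesgue_measure R]_(x in `[- h, h]) (- k (u x)) =
    - \int[@lebesgue_measure R]_(x in `[- h, h]) k (u x).
  move=> kl su; have /= E := fun mD => RintegralZl (-1) mD (scts_int kl su).
  apply: etrans _ (etrans (E _) (mulN1r _)) => //.
  by apply: eq_Rintegral => x _; rewrite /= mulN1r.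
move: r2 r3; rewrite (RN _ _ (@Im_lip R) s2) (RN _ _ (@Re_lip R) s3) => r2 r3.
set u1 := (X in X - _ + _); set u2 := (X in _ - X + _).
set u3 := (X in _ + (X - _)); set u4 := (X in _ + (_ - X)).
have a1 : 1 <= u1 by exact: r1.
have a2 : 1 <= - u2 by exact: r2.
have a3 : 1 <= u3 by exact: r4.
have a4 : 1 <= - u4 by exact: r3.
clearbody u1 u2 u3 u4; clear -a1 a2 a3 a4; lra.
Qed.

End CauchyTransform.

(** * Cauchy's formula, removable singularities, orders of vanishing *)

Section Holomorphic.
Variable R : realType.
Local Notation C := R[i].
Implicit Types (f g phi : C -> C) (z w : C).

Definition hol f := forall z, cabs z < 1 -> cdiff f z.

Lemma hol_gcts f : hol f -> gcts f.
Proof. by move=> hf w /onG_disk /hf /cdiff_cts. Qed.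

(** The difference quotient of [f] at [z] is differentiable away from [z] and continuous at [z], so
    its contour integral vanishes by [goursat_punctured]. *)
Lemma cauchy_formula f z : hol f -> cabs z < 1 / 4 ->
  f z * cauchyK (fun=> 1) z = cauchyK f z.
Proof.
move=> hf hz; have hz1 : cabs z <= 1 / 4 by exact: ltW.
have z1 : cabs z < 1 by apply: lt_trans hz _; lra.
have [q [Hq cq]] := hf z z1.
have dq w : cabs w < 1 -> w != z -> cdiff q w.
  move=> w1 wz; have d0 : 0 < cabs (w - z) by rewrite cabs_gt0 subr_eq0.
  apply: (@cdiff_near _ (fun u => (f u - f z) / (u - z)) _ _ _ d0).
    move=> u hu; have uz : u - z != 0.
      apply/eqP => uz; have uE : u = z by rewrite -(subrK z u) uz add0r.
      by move: hu; rewrite uE cabsB ltxx.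
    by rewrite Hq mulrC mulKf.
  apply: cdiffM; first by apply: cdiffB; [exact: hf|exact: cdiff_cst].
  by apply: cdiffV; [rewrite subr_eq0|apply: cdiffB; [exact: cdiff_id|exact: cdiff_cst]].
have hE : (2^-1 : R) = 1 / 2 by field.
have gq : rcts q (- 2^-1) 2^-1 (- 2^-1) 2^-1.
  move=> x y hx hy; have p1 := box_disk hx hy.
  have [->//|ne] := eqVneq (pt x y) z.
  by apply: cdiff_cts; exact: dq.
have zero : Gam q = 0.
  have r1 := Re_le_cabs z; have r2 := Im_le_cabs z.
  move: r1 r2; rewrite !ler_norml => r1 r2.
  apply: (@goursat_punctured _ q _ _ _ _ (complex.Re z) (complex.Im z)) => //; try lra.
  move=> x y hx hy; rewrite ptK => ne; apply: dq => //; exact: box_disk.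
have c1 : gcts (fun=> 1 : C) by move=> w _; exact: cts_cst.
have g1 := gcts_kernel c1 hz1; have gf := gcts_kernel (hol_gcts hf) hz1.
have : Gam (fun w => f w / (w - z) + (- f z) * (1 / (w - z))) = 0.
  rewrite -zero; apply: Gam_ext => w hw; have wz := onG_neq hw hz1.
  have -> : q w = (f w - f z) / (w - z) by rewrite Hq mulrC mulKf.
  by field.
rewrite Gam_D//; last by move=> w hw; apply: ctsM; [exact: cts_cst|exact: g1].
by rewrite Gam_Z// -/(cauchyK f z) -/(cauchyK _ z) mulNr => /eqP; rewrite subr_eq0 => /eqP.
Qed.

Lemma cts_eq0 f g (d : R) : 0 < d -> cts f 0 -> cts g 0 ->
  (forall w, w != 0 -> cabs w < d -> f w = g w) -> f 0 = g 0.
Proof.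
move=> d0 cf cg fg; apply/eqP; rewrite -subr_eq0 -cabs_eq0 eq_le cabs_ge0 andbT.
apply/ler_addgt0Pr => e e0; rewrite add0r.
have [d1 d10 H] := ctsB cf cg e0.
pose r := Num.min d d1 / 2.
have r0 : 0 < r by rewrite divr_gt0// lt_min d0.
have rd : r < d /\ r < d1.
  have : Num.min d d1 <= d by rewrite ge_min lexx.
  have : Num.min d d1 <= d1 by rewrite ge_min lexx orbT.
  by rewrite /r in r0 *; lra.
have cr : cabs (r%:C%C : C) = r by rewrite cabs_real gtr0_norm.
have := H r%:C%C; rewrite subr0 cr fg ?cr//; last 2 first.
- by rewrite -cabs_gt0 cr.
- by case: rd.
rewrite subrr sub0r cabsN => /(_ (proj2 rd)) /ltW; exact.
Qed.

(** Removable singularity: near 0 the quotient equals [K1 / c], where both Cauchy transforms are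
    differentiable at 0 and [c 0] is nonzero. *)
Lemma hol_div f : hol f -> f 0 = 0 ->
  exists2 g, hol g & forall z, f z = z * g z.
Proof.
move=> hf f0.
have [q [Hq cq]] := hf 0 ltac:(by rewrite cabs0 ltr01).
have fE z : f z = z * q z by have := Hq z; rewrite f0 !subr0.
exists q => // z z1.
have [->|z0] := eqVneq z 0; last first.
  apply: (@cdiff_near _ (fun w => f w / w) _ _ (cabs z)).
  - by rewrite cabs_gt0.
  - move=> w hw; have w0 : w != 0 by apply: contraTneq hw => ->; rewrite sub0r cabsN ltxx.
    by rewrite fE mulrC mulKf.
  by apply: cdiffM; [exact: hf|apply: cdiffV => //; exact: cdiff_id].
have gf := hol_gcts hf; have gd := gcts_div gf.
have c1 : gcts (fun=> 1 : C) by move=> w _; exact: cts_cst.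
pose K1 := cauchyK (fun w => f w / w); pose c := cauchyK (fun=> 1 : C).
have qc w : w != 0 -> cabs w < 1 / 4 -> q w * c w = K1 w.
  move=> w0 hw; have := cauchy_formula hf hw.
  rewrite (cauchyK_rec gf (ltW hw)).
  have <- := @cauchy_formula f 0 hf ltac:(by rewrite cabs0; lra).
  by rewrite f0 mul0r add0r fE -mulrA => /(mulfI w0).
have cc : cdiff c 0 by exact: cauchyK_cdiff0.
have cK : cdiff K1 0 by exact: cauchyK_cdiff0.
have qc0 : q 0 * c 0 = K1 0.
  have q4 : (0 : R) < 1 / 4 by lra.
  apply: (@cts_eq0 (fun w => q w * c w) K1 _ q4) => //.
    by apply: ctsM => //; exact: cdiff_cts.
  exact: cdiff_cts.
have c0 : c 0 != 0 := cauchyK1_neq0 R.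
have [d d0 Hd] := cdiff_cts cc (e := cabs (c 0)) ltac:(by rewrite cabs_gt0).
apply: (@cdiff_near _ (fun w => K1 w / c w) _ _ (Num.min d (1 / 4))).
- by rewrite lt_min d0; lra.
- move=> w; rewrite lt_min => /andP[/Hd h1]; rewrite subr0 => h2.
  have cw : c w != 0 by apply: contraTneq h1 => ->; rewrite sub0r cabsN ltxx.
  have <- : q w * c w = K1 w by have [->|?] := eqVneq w 0; [exact: qc0|exact: qc].
  by rewrite mulfK.
by apply: cdiffM => //; exact: cdiffV.
Qed.

(** [eta] depends only on the transform of 1, hence not on [f]. All Taylor coefficients vanish, so
    for every [k] the transform of [f] at [z] is [z ^+ k] times that of [f w / w ^+ k]. With
    [cabs z < 1 / 4], and [cabs w >= 1 / 2] on the contour, this is of order [2 ^- k]. *)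
Lemma hol_flat : exists2 eta : R, 0 < eta & forall f, hol f ->
  (forall k : nat, exists2 g, hol g & forall z, f z = z ^+ k * g z) ->
  forall z, cabs z < eta -> f z = 0.
Proof.
have c1 : gcts (fun=> 1 : C) by move=> w _; exact: cts_cst.
pose c := cauchyK (fun=> 1 : C).
have cc : cts c 0 by exact: cauchyK_cts0.
have c0 : c 0 != 0 := cauchyK1_neq0 R.
have [d d0 Hd] := cc (cabs (c 0)) ltac:(by rewrite cabs_gt0).
exists (Num.min d (1 / 4)); first by rewrite lt_min d0; lra.
move=> f hf flat z; rewrite lt_min => /andP[zd z4].
have cz : c z != 0.
  have := Hd z; rewrite subr0 => /(_ zd); apply: contraTneq => ->.
  by rewrite sub0r cabsN ltxx.
suff Kf : cauchyK f z = 0.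
  by move: (cauchy_formula hf z4); rewrite Kf => /eqP; rewrite mulf_eq0 (negPf cz) orbF => /eqP.
have gk k : gcts (fun w => f w / w ^+ k).
  move=> w hw; apply: ctsM; first by apply: hol_gcts.
  by apply: ctsV; [rewrite expf_neq0// onG_neq0|apply: ctsX; exact: cts_id].
have step k u : cabs u < 1 / 4 -> cauchyK f u = u ^+ k * cauchyK (fun w => f w / w ^+ k) u.
  elim: k u => [u _|k IH u hu].
    by rewrite expr0 mul1r; apply: Gam_ext => w _; rewrite expr0 divr1.
  rewrite IH// (cauchyK_rec (gk k) (ltW hu)).
  (* This is the Taylor coefficient of degree [k]. Off 0 the transform equals [w * g w * c w], since
     [f] is divisible by [z ^+ k.+1]; both sides are continuous at 0. *)
  have -> : cauchyK (fun w => f w / w ^+ k) 0 = 0.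
    have [g hg fg] := flat k.+1.
    transitivity ((fun w => w * g w * c w) 0); last by rewrite /= !mul0r.
    have q4 : (0 : R) < 1 / 4 by lra.
    apply: (@cts_eq0 (cauchyK (fun w => f w / w ^+ k)) (fun w => w * g w * c w) _ q4).
    - exact: cauchyK_cts0.
    - apply: ctsM => //; apply: ctsM; first exact: cts_id.
      by apply: cdiff_cts; apply: hg; rewrite cabs0.
    move=> w w0 hw; have := cauchy_formula hf hw; rewrite IH// fg exprSr -!mulrA.
    by move=> /(mulfI (expf_neq0 _ w0)) <-; rewrite !mulrA.
  rewrite add0r exprSr -mulrA; congr (_ * (_ * _)).
  apply: Gam_ext => w hw; have w0 := onG_neq0 hw.
  by congr (_ / _); rewrite exprSr invfM mulrA.
have [B B0 HB] := gcts_bounded (hol_gcts hf).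
(* Of the gain [4 ^+ k] from [cabs z < 1 / 4], one factor [2 ^+ k] pays for [1 / cabs w ^+ k]; the
   other one appears on the left. *)
have bd k : cabs (cauchyK f z) * 2 ^+ k <= 32 * B.
  rewrite (step k) // cabsM cabsX.
  have b1 : cabs (cauchyK (fun w => f w / w ^+ k) z) <= 32 * (B * 2 ^+ k).
    apply: cauchyK_bound; [exact: gk|exact: ltW|by rewrite mulr_ge0|].
    move=> w hw; rewrite cabsM cabsV cabsX; apply: ler_pM; rewrite ?invr_ge0 ?exprn_ge0 ?cabs_ge0 ?HB//.
    have w2 := onG_ge hw.
    have w0 : 0 < cabs w by apply: lt_le_trans w2; rewrite invr_gt0.
    by rewrite -exprVn lerXn2r ?nnegrE ?invr_ge0 ?cabs_ge0// -[2]invrK lef_pV2// posrE invr_gt0.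
  have e1 : cabs z ^+ k * (2 ^+ k * 2 ^+ k) <= 1.
    rewrite -!exprMn; apply: exprn_ile1; first by rewrite !mulr_ge0// cabs_ge0.
    by have := cabs_ge0 z; lra.
  have zk : 0 <= cabs z ^+ k by rewrite exprn_ge0// cabs_ge0.
  have p2 : 0 <= (2 : R) ^+ k by rewrite exprn_ge0.
  apply: le_trans (_ : cabs z ^+ k * (32 * (B * 2 ^+ k)) * 2 ^+ k <= _).
    by apply: ler_wpM2r => //; apply: ler_wpM2l.
  have -> : cabs z ^+ k * (32 * (B * 2 ^+ k)) * 2 ^+ k =
    32 * B * (cabs z ^+ k * (2 ^+ k * 2 ^+ k)) by ring.
  by apply: ler_piMr => //; rewrite mulr_ge0.
apply/eqP; rewrite -cabs_eq0; apply: contraT => Kn0.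
have K0 : 0 < cabs (cauchyK f z) by rewrite lt_def Kn0 cabs_ge0.
have := bd (Num.truncn (32 * B / cabs (cauchyK f z))).+1.
rewrite mulrC -ler_pdivlMr// => H.
have := truncnS_gt (32 * B / cabs (cauchyK f z)); set n := (Num.truncn _).+1 in H *.
move=> /(le_lt_trans H); rewrite -natrX ltr_nat => /ltnW; rewrite leqNgt ltn_expl//.
Qed.

(** The common radius matters: [comm_cases] applies this to the determinants of all pairs of group
    elements at once. *)
Lemma hol_order : exists2 eta : R, 0 < eta & forall f, hol f ->
  (forall z, cabs z < eta -> f z = 0) \/
  exists k g, [/\ hol g, g 0 != 0 & forall z, f z = z ^+ k * g z].
Proof.
have [eta eta0 H] := hol_flat; exists eta => // f hf.
have [|] := pselect (forall k : nat, exists2 g, hol g & forall z, f z = z ^+ k * g z).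
  by move=> /(H f hf); left.
move=> /existsNP[k nk]; right.
(* Descent to the largest exponent that divides [f]: if the quotient vanished at 0, [hol_div] would
   split off one more factor. *)
elim: k nk => [|k IH] nk.
  by exfalso; apply: nk; exists f => // z; rewrite expr0 mul1r.
have [[g hg fg]|//] := pselect (exists2 g, hol g & forall z, f z = z ^+ k * g z); last first.
exists k, g; split => //; apply: contra_notN nk => /eqP g0.
have [u hu gu] := hol_div hg g0.
by exists u => // z; rewrite fg gu exprSr mulrA.
Qed.

End Holomorphic.

(** * Real sums over discrete types *)

Section RealSums.
Variables (R : realType) (T : choiceType).
Implicit Types (f g a b : T -> R) (s : seq T).

Definition summ f := (\esum_(x in [set: T]) (`|f x|)%:E < +oo)%E.

(** [fine] sends an infinite sum to 0, so the value is meaningful only together with [summ]. *)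
Definition nsum f : R := fine (\esum_(x in [set: T]) (f x)%:E)%E.

Definition rsum f : R := nsum (fun x => Num.max (f x) 0) - nsum (fun x => Num.max (- f x) 0).

Lemma esum_EFin f : (forall x, 0 <= f x) -> summ f ->
  (\esum_(x in [set: T]) (f x)%:E)%E = (nsum f)%:E.
Proof.
move=> f0 sf; rewrite fineK// ge0_fin_numE; last first.
  by apply: esum_ge0 => x _; rewrite lee_fin.
by move: sf; rewrite /summ; under eq_esum do rewrite ger0_norm//.
Qed.

Lemma summ_le f g : (forall x, `|f x| <= g x) -> summ g -> summ f.
Proof.
move=> fg; apply: le_lt_trans; apply: le_esum => x _; rewrite lee_fin.
by apply: le_trans (fg x) _; exact: ler_norm.
Qed.

Lemma summD f g : summ f -> summ g -> summ (fun x => f x + g x).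
Proof.
move=> sf sg; apply: (@summ_le _ (fun x => `|f x| + `|g x|)).
  by move=> x; exact: ler_normD.
rewrite /summ; under eq_esum do rewrite ger0_norm ?addr_ge0// EFinD.
by rewrite esumD//; exact: lte_add_pinfty.
Qed.

Lemma nsum_ge0 f : (forall x, 0 <= f x) -> 0 <= nsum f.
Proof. by move=> f0; apply: fine_ge0; apply: esum_ge0 => x _; rewrite lee_fin. Qed.

Lemma nsumD f g : (forall x, 0 <= f x) -> (forall x, 0 <= g x) -> summ f -> summ g ->
  nsum (fun x => f x + g x) = nsum f + nsum g.
Proof.
move=> f0 g0 sf sg; rewrite {1}/nsum.
under eq_esum do rewrite EFinD.
by rewrite esumD ?esum_EFin// => x _; rewrite lee_fin.
Qed.

Lemma summN f : summ f -> summ (fun x => - f x).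
Proof. by move=> sf; rewrite /summ; under eq_esum do rewrite normrN. Qed.

(** Independence of the decomposition into a difference: with [p] and [q] the positive and negative
    parts, [p + b = q + a] holds pointwise. Additivity of [rsum] rests on it. *)
Lemma rsumE a b : (forall x, 0 <= a x) -> (forall x, 0 <= b x) -> summ a -> summ b ->
  rsum (fun x => a x - b x) = nsum a - nsum b.
Proof.
move=> a0 b0 sa sb.
pose p x := Num.max (a x - b x) 0; pose q x := Num.max (- (a x - b x)) 0.
have p0 x : 0 <= p x by rewrite le_max lexx orbT.
have q0 x : 0 <= q x by rewrite le_max lexx orbT.
have pa x : p x <= a x by rewrite ge_max a0 andbT; have := b0 x; lra.
have qb x : q x <= b x by rewrite ge_max b0 andbT; have := a0 x; lra.
have sp : summ p by apply: summ_le sa => x; rewrite ger0_norm.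
have sq : summ q by apply: summ_le sb => x; rewrite ger0_norm.
have pq x : p x + b x = q x + a x.
  by rewrite /p /q; case: (leP (a x - b x) 0) => h1; case: (leP (- (a x - b x)) 0) => h2; lra.
rewrite /rsum -/p -/q.
have : nsum (fun x => p x + b x) = nsum (fun x => q x + a x).
  by congr nsum; apply/funext.
by rewrite !nsumD//; lra.
Qed.

Lemma rsum_ge0E f : (forall x, 0 <= f x) -> summ f -> rsum f = nsum f.
Proof.
move=> f0 sf.
have s0 : summ (fun=> 0).
  by rewrite /summ esum1// => x _; rewrite normr0.
have n0 : nsum (fun=> 0) = 0 by rewrite /nsum esum1.
rewrite -[RHS]subr0 -n0 -rsumE//; congr rsum.
by apply/funext => x; rewrite subr0.
Qed.

Lemma summ_pos f : summ f -> summ (fun x => Num.max (f x) 0).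
Proof.
move=> sf; apply: (@summ_le _ (fun x => `|f x|)).
  move=> x; rewrite ger0_norm ?le_max ?lexx ?orbT// ge_max normr_ge0 andbT; exact: ler_norm.
by rewrite /summ; under eq_esum do rewrite normr_id.
Qed.

Lemma summ_abs f : summ f -> summ (fun x => `|f x|).
Proof. by move=> sf; rewrite /summ; under eq_esum do rewrite normr_id. Qed.

Lemma pos_part (x : R) : x = Num.max x 0 - Num.max (- x) 0.
Proof. by case: (leP x 0) => h1; case: (leP (- x) 0) => h2; lra. Qed.

Lemma pos_ge0 (x : R) : 0 <= Num.max x 0. Proof. by rewrite le_max lexx orbT. Qed.

Lemma rsumD f g : summ f -> summ g -> rsum (fun x => f x + g x) = rsum f + rsum g.
Proof.
move=> sf sg.
have s1 := summ_pos sf; have s2 := summ_pos (summN sf).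
have s3 := summ_pos sg; have s4 := summ_pos (summN sg).
have -> : (fun x => f x + g x) = (fun x => (Num.max (f x) 0 + Num.max (g x) 0) -
   (Num.max (- f x) 0 + Num.max (- g x) 0)).
  by apply/funext => x; rewrite {1}(pos_part (f x)) {1}(pos_part (g x)); ring.
rewrite rsumE; first last.
- exact: summD.
- exact: summD.
- by move=> x; rewrite addr_ge0// pos_ge0.
- by move=> x; rewrite addr_ge0// pos_ge0.
rewrite !nsumD//; try by move=> x; exact: pos_ge0.
by rewrite /rsum; ring.
Qed.

Lemma rsumN f : rsum (fun x => - f x) = - rsum f.
Proof.
rewrite /rsum opprB; congr (_ - _).
by congr nsum; apply/funext => x; rewrite opprK.
Qed.

Lemma rsumB f g : summ f -> summ g -> rsum (fun x => f x - g x) = rsum f - rsum g.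
Proof. by move=> sf sg; rewrite rsumD// ?rsumN//; exact: summN. Qed.

Lemma rsum_ge0 f : (forall x, 0 <= f x) -> summ f -> 0 <= rsum f.
Proof. by move=> f0 sf; rewrite rsum_ge0E//; exact: nsum_ge0. Qed.

Lemma rsum_le f g : summ f -> summ g -> (forall x, f x <= g x) -> rsum f <= rsum g.
Proof.
move=> sf sg fg; rewrite -subr_ge0 -rsumB//; apply: rsum_ge0.
  by move=> x; rewrite subr_ge0.
by apply: summD => //; exact: summN.
Qed.

Lemma sum_seq_le_rsum f s : uniq s -> (forall x, 0 <= f x) -> summ f ->
  \sum_(x <- s) f x <= rsum f.
Proof.
move=> us f0 sf; rewrite rsum_ge0E// -lee_fin -esum_EFin//.
rewrite -sumEFin.
apply: ereal_sup_ubound; exists [set` s].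
  by split => //; exact: finite_seq.
by rewrite -fsbig_seq.
Qed.

Lemma rsum_approx f (e : R) : 0 < e -> (forall x, 0 <= f x) -> summ f ->
  exists2 s : seq T, uniq s & rsum f <= \sum_(x <- s) f x + e.
Proof.
move=> e0 f0 sf; rewrite rsum_ge0E//.
have fin : ereal_sup [set (\sum_(x \in A) (f x)%:E)%E | A in fsets [set: T]] \is a fin_num.
  by rewrite -/(esum _ _) esum_EFin.
have [_ [A [finA _] <-] H] := ub_ereal_sup_adherent e0 fin.
exists (finmap.enum_fset (fset_set A)); first exact: finmap.fset_uniq.
move: H; rewrite fsbig_finite// -/(esum _ _) esum_EFin//= sumEFin -EFinB lte_fin => H.
by rewrite -lerBlDr ltW.
Qed.

(** Tested on finite subfamilies. A second application, with the inverse scalar, gives the equality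
    in [rsumZ]. *)
Lemma rsum_seqZ_le f (c : R) : 0 <= c -> (forall x, 0 <= f x) -> summ f ->
  summ (fun x => c * f x) /\ rsum (fun x => c * f x) <= c * rsum f.
Proof.
move=> c0 f0 sf.
have b : (\esum_(x in [set: T]) (c * f x)%:E <= (c * rsum f)%:E)%E.
  apply: ge_ereal_sup => _ [A [finA _] <-].
  rewrite fsbig_finite//= sumEFin lee_fin -mulr_sumr; apply: ler_wpM2l => //.
  by apply: sum_seq_le_rsum => //; exact: finmap.fset_uniq.
have sc : summ (fun x => c * f x).
  rewrite /summ; under eq_esum do rewrite ger0_norm ?mulr_ge0//.
  by apply: le_lt_trans b _; exact: ltry.
split=> //; rewrite rsum_ge0E//; last by move=> x; rewrite mulr_ge0.
by rewrite -lee_fin -esum_EFin// => x; rewrite mulr_ge0.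
Qed.

Lemma summZ (c : R) f : summ f -> summ (fun x => c * f x).
Proof.
move=> sf; have [H _] := rsum_seqZ_le (normr_ge0 c) (fun x => normr_ge0 (f x)) (summ_abs sf).
by apply: summ_le H => x; rewrite normrM.
Qed.

Lemma rsumZ (c : R) f : summ f -> rsum (fun x => c * f x) = c * rsum f.
Proof.
have pos f' c' : (forall x, 0 <= f' x) -> summ f' -> 0 <= c' ->
    rsum (fun x => c' * f' x) = c' * rsum f'.
  move=> f0 sf; rewrite le_eqVlt => /orP[/eqP <-|c0].
    rewrite mul0r; transitivity (rsum (fun=> 0)); first by congr rsum; apply/funext => x; rewrite mul0r.
    have sz : summ (fun=> 0) by rewrite /summ esum1// => x _; rewrite normr0.
    by rewrite rsum_ge0E// /nsum esum1.
  have [sc h1] := rsum_seqZ_le (ltW c0) f0 sf.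
  have p0 x : 0 <= c' * f' x by rewrite mulr_ge0// ltW.
  have iv : 0 <= c'^-1 by rewrite invr_ge0 ltW.
  have [_ h2] := rsum_seqZ_le iv p0 sc.
  apply/eqP; rewrite eq_le h1 /=.
  move: h2; rewrite mulrC ler_pdivlMr// mulrC.
  by under eq_fun do rewrite mulKf ?gt_eqF//.
move=> sf.
have s1 := summ_pos sf; have s2 := summ_pos (summN sf).
have half c' : 0 <= c' -> rsum (fun x => c' * f x) = c' * rsum f.
  move=> c0.
  have -> : (fun x => c' * f x) = (fun x => c' * Num.max (f x) 0 - c' * Num.max (- f x) 0).
    by apply/funext => x; rewrite {1}(pos_part (f x)) mulrBr.
  rewrite rsumB; [|exact: summZ|exact: summZ].
  rewrite !pos//; try by move=> x; exact: pos_ge0.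
  rewrite (rsum_ge0E (f := fun x => Num.max (f x) 0))//; last by move=> x; exact: pos_ge0.
  rewrite (rsum_ge0E (f := fun x => Num.max (- f x) 0))//; last by move=> x; exact: pos_ge0.
  by rewrite -mulrBr.
have [c0|c0] := leP 0 c; first exact: half.
have := half (- c) ltac:(by lra).
have -> : (fun x => - c * f x) = (fun x => - (c * f x)) by apply/funext => x; rewrite mulNr.
by rewrite rsumN mulNr => /oppr_inj.
Qed.

End RealSums.

(** * Expectations along a random walk *)

(* [wt] is a submultiplicative weight dominating all functions that get integrated. *)
Record walk (R : realType) (G : groupType) := Walk {
  step : G -> R;
  wt : G -> R;
  step_ge0 : forall g, 0 <= step g;
  step_sum : (\esum_(g in [set: G]) (step g)%:E = 1)%E;
  wt_ge1 : forall g, 1 <= wt g;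
  wt_mul : forall g h, wt (monoid.mul g h) <= wt g * wt h;
  wt_summ : summ (fun g => step g * wt g) }.

Section Walk.
Variables (R : realType) (G : groupType) (W : walk R G).
Local Notation "x ** y" := (@monoid.mul G x y) (at level 40, left associativity).
Local Notation e1 := (@monoid.one G).
Local Notation m := (step W).
Local Notation w := (wt W).
Let m0 : forall g, 0 <= m g := step_ge0 W.
Let msum := step_sum W.
Let w1 : forall g, 1 <= w g := wt_ge1 W.
Let wM : forall g h, w (g ** h) <= w g * w h := @wt_mul _ _ W.
Let sw := wt_summ W.
Implicit Types (f : G -> R) (g h x : G).

Definition E1 f := rsum (fun g => m g * f g).

(** The expectation of [f] at the product [g_n ... g_1] of independent steps: the outer [E1]
    integrates the rightmost factor, which is the first step. *)
Fixpoint En n f := if n is n'.+1 then E1 (fun h => En n' (fun g => f (g ** h))) else f e1.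

Definition dom (C : R) f := forall g, `|f g| <= C * w g.
Definition adm f := exists2 C, 0 <= C & dom C f.
(** Functions of two independent walks. The product weight accommodates [f (g ** h)] as well as
    functions of one variable. *)
Definition adm2 (F : G -> G -> R) :=
  exists2 C, 0 <= C & forall g h, `|F g h| <= C * (w g * w h).

Lemma w0 g : 0 < w g. Proof. exact: lt_le_trans (w1 g). Qed.
Lemma w_ge0 g : 0 <= w g. Proof. exact: ltW (w0 g). Qed.

Lemma domW C f : dom C f -> 0 <= C.
Proof.
by move=> /(_ e1) /(le_trans (normr_ge0 _)); rewrite pmulr_lge0// w0.
Qed.

Lemma dom_adm C f : dom C f -> adm f.
Proof. by move=> H; exists C => //; exact: domW H. Qed.

Lemma adm_summ f : adm f -> summ (fun g => m g * f g).
Proof.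
move=> [C C0 H]; apply: (@summ_le _ _ _ (fun g => C * (m g * w g))); last by apply: summZ; exact: sw.
move=> g; rewrite normrM ger0_norm// mulrCA; exact: ler_wpM2l.
Qed.

Lemma dom_cst (c : R) : dom `|c| (fun=> c).
Proof. by move=> g; rewrite ler_peMr. Qed.
Lemma adm_cst (c : R) : adm (fun=> c). Proof. exact: dom_adm (dom_cst c). Qed.
Lemma adm_le f k : (forall g, `|f g| <= k g) -> adm k -> adm f.
Proof.
move=> fk [C C0 H]; exists C => // g; apply: le_trans (fk g) (le_trans (ler_norm _) (H g)).
Qed.
Lemma admD f k : adm f -> adm k -> adm (fun g => f g + k g).
Proof.
move=> [C C0 H] [D D0 K]; exists (C + D); first exact: addr_ge0.
by move=> g; rewrite mulrDl; apply: le_trans (ler_normD _ _) (lerD _ _).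
Qed.
Lemma admZ c f : adm f -> adm (fun g => c * f g).
Proof.
move=> [C C0 H]; exists (`|c| * C); first by rewrite mulr_ge0.
by move=> g; rewrite normrM -mulrA ler_wpM2l.
Qed.
Lemma admN f : adm f -> adm (fun g => - f g).
Proof. by move=> [C C0 H]; exists C => // g; rewrite normrN. Qed.
Lemma admB f k : adm f -> adm k -> adm (fun g => f g - k g).
Proof. by move=> af ak; apply: admD => //; exact: admN. Qed.
Lemma adm_abs f : adm f -> adm (fun g => `|f g|).
Proof. by move=> [C C0 H]; exists C => // g; rewrite normr_id. Qed.
Lemma adm_w : adm w.
Proof. by exists 1 => // g; rewrite mul1r ger0_norm// w_ge0. Qed.
Lemma adm_bool (b : G -> bool) : adm (fun g => (b g)%:R).
Proof. by apply: (@adm_le _ (fun=> 1)); [move=> g; case: (b g); rewrite ?normr1 ?normr0|exact: adm_cst]. Qed.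

Lemma dom_tr C f h : dom C f -> dom (C * w h) (fun g => f (g ** h)).
Proof.
move=> H g; apply: le_trans (H _) _; rewrite -mulrA ler_wpM2l ?(domW H)//.
by rewrite [w h * _]mulrC wM.
Qed.
Lemma adm_tr f h : adm f -> adm (fun g => f (g ** h)).
Proof. by move=> [C C0 /dom_tr] /(_ h) /dom_adm. Qed.
Lemma E1D f k : adm f -> adm k -> E1 (fun g => f g + k g) = E1 f + E1 k.
Proof.
move=> af ak; rewrite /E1 -rsumD; [|exact: adm_summ|exact: adm_summ].
by congr rsum; apply/funext => g; rewrite mulrDr.
Qed.
Lemma E1Z c f : adm f -> E1 (fun g => c * f g) = c * E1 f.
Proof.
move=> af; rewrite /E1 -rsumZ; last exact: adm_summ.
by congr rsum; apply/funext => g; rewrite mulrCA.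
Qed.
Lemma E1_le f k : adm f -> adm k -> (forall g, f g <= k g) -> E1 f <= E1 k.
Proof.
move=> af ak fk; apply: rsum_le; [exact: adm_summ|exact: adm_summ|].
by move=> g; rewrite ler_wpM2l.
Qed.
Lemma E1_cst c : E1 (fun=> c) = c.
Proof.
have s1 : summ m by rewrite /summ; under eq_esum do rewrite ger0_norm//; rewrite msum ltry.
have : rsum m = 1 by rewrite rsum_ge0E// /nsum msum.
move=> r1; transitivity (rsum (fun g => c * m g)); last by rewrite rsumZ// r1 mulr1.
by congr rsum; apply/funext => g; rewrite mulrC.
Qed.

Lemma E1_point f s : adm f -> (forall g, 0 <= f g) -> m s * f s <= E1 f.
Proof.
move=> af f0; have := @sum_seq_le_rsum _ _ (fun g => m g * f g) [:: s] isT.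
rewrite big_seq1; apply; last exact: adm_summ.
by move=> g; rewrite mulr_ge0.
Qed.

Definition Lam := E1 w.

Lemma Lam_ge1 : 1 <= Lam.
Proof. by rewrite -[1]E1_cst; apply: E1_le => //; [exact: adm_cst|exact: adm_w]. Qed.

Lemma E1_norm f : adm f -> `|E1 f| <= E1 (fun g => `|f g|).
Proof.
move=> af; have aa := adm_abs af; rewrite ler_norml; apply/andP; split.
  rewrite -mulN1r -E1Z//; apply: E1_le => //; first exact: admZ.
  by move=> g; rewrite mulN1r lerNl -normrN ler_norm.
by apply: E1_le => // g; exact: ler_norm.
Qed.

(** Each step costs a factor [Lam], by submultiplicativity of the weight. The exponential growth is
    harmless, since limits in [t] are taken at fixed [n]. *)
Lemma En_dom n C f : dom C f -> `|En n f| <= C * w e1 * Lam ^+ n.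
Proof.
elim: n C f => [|n IH] C f H.
  by rewrite expr0 mulr1; exact: H.
have C0 := domW H.
have D : dom (C * w e1 * Lam ^+ n) (fun h => En n (fun g => f (g ** h))).
  move=> h; apply: le_trans (IH _ _ (dom_tr h H)) _.
  by rewrite -!mulrA [w h * _]mulrC !mulrA.
rewrite /= ; apply: le_trans (E1_norm (dom_adm D)) _.
rewrite exprSr mulrA -E1Z; last exact: adm_w.
by apply: E1_le => //; [exact/adm_abs/(dom_adm D)|exact/admZ/adm_w].
Qed.

Lemma dom_En n C f : dom C f ->
  dom (C * w e1 * Lam ^+ n) (fun h => En n (fun g => f (g ** h))).
Proof.
move=> H h; apply: le_trans (En_dom _ (dom_tr h H)) _.
by rewrite -!mulrA [w h * _]mulrC !mulrA.
Qed.

Lemma adm_En n f : adm f -> adm (fun h => En n (fun g => f (g ** h))).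
Proof. by move=> [C _ /dom_En H]; exact: dom_adm (H n). Qed.

Lemma adm2_l F h : adm2 F -> adm (fun g => F g h).
Proof.
move=> [C C0 H]; exists (C * w h); first by rewrite mulr_ge0// w_ge0.
by move=> g; rewrite -mulrA [w h * _]mulrC.
Qed.

Lemma adm2_En n F : adm2 F -> adm (fun h => En n (fun g => F g h)).
Proof.
move=> [C C0 H]; exists (C * w e1 * Lam ^+ n).
  by rewrite !mulr_ge0 ?w_ge0// exprn_ge0// (le_trans ler01 Lam_ge1).
move=> h; have D : dom (C * w h) (fun g => F g h) by move=> g; rewrite -mulrA [w h * _]mulrC.
apply: le_trans (En_dom n D) _.
by rewrite -!mulrA [w h * _]mulrC !mulrA.
Qed.

Lemma adm2_mul f : adm f -> adm2 (fun g h => f (g ** h)).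
Proof.
move=> [C C0 H]; exists C => // g h; apply: le_trans (H _) _.
by rewrite ler_wpM2l.
Qed.
Lemma adm2_fst f : adm f -> adm2 (fun g h => f g).
Proof.
move=> [C C0 H]; exists C => // g h; apply: le_trans (H _) _.
by rewrite ler_wpM2l// ler_peMr// w_ge0.
Qed.
Lemma adm2_snd f : adm f -> adm2 (fun g h => f h).
Proof.
move=> [C C0 H]; exists C => // g h; apply: le_trans (H _) _.
by rewrite ler_wpM2l// ler_peMl// w_ge0.
Qed.
Lemma adm2_le F K : (forall g h, `|F g h| <= K g h) -> adm2 K -> adm2 F.
Proof.
move=> fk [C C0 H]; exists C => // g h.
exact: le_trans (fk g h) (le_trans (ler_norm _) (H g h)).
Qed.
Lemma adm2D F K : adm2 F -> adm2 K -> adm2 (fun g h => F g h + K g h).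
Proof.
move=> [C C0 H] [D D0 K']; exists (C + D); first exact: addr_ge0.
by move=> g h; rewrite mulrDl; apply: le_trans (ler_normD _ _) (lerD _ _).
Qed.
Lemma adm2Z c F : adm2 F -> adm2 (fun g h => c * F g h).
Proof.
move=> [C C0 H]; exists (`|c| * C); first by rewrite mulr_ge0.
by move=> g h; rewrite normrM -mulrA ler_wpM2l.
Qed.
Lemma adm2_cst c : adm2 (fun _ _ => c). Proof. exact: adm2_fst (adm_cst c). Qed.
Lemma adm2_bool (b : G -> G -> bool) : adm2 (fun g h => (b g h)%:R).
Proof.
by apply: (@adm2_le _ (fun _ _ => 1)); [move=> g h; case: (b g h); rewrite ?normr1 ?normr0|exact: adm2_cst].
Qed.

Lemma eq_En n (f k : G -> R) : f =1 k -> En n f = En n k.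
Proof. by move=> /funext ->. Qed.
Lemma EnD n f k : adm f -> adm k -> En n (fun g => f g + k g) = En n f + En n k.
Proof.
elim: n f k => [//|n IH] f k af ak /=.
rewrite -E1D; [|exact: adm_En|exact: adm_En].
by congr E1; apply/funext => h; rewrite IH//; exact: adm_tr.
Qed.
Lemma EnZ n c f : adm f -> En n (fun g => c * f g) = c * En n f.
Proof.
elim: n f => [//|n IH] f af /=.
rewrite -E1Z; last exact: adm_En.
by congr E1; apply/funext => h; rewrite IH//; exact: adm_tr.
Qed.
Lemma En_le n f k : adm f -> adm k -> (forall g, f g <= k g) -> En n f <= En n k.
Proof.
elim: n f k => [|n IH] f k af ak fk /=; first exact: fk.
apply: E1_le; [exact: adm_En|exact: adm_En|].
by move=> h; apply: IH => //; exact: adm_tr.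
Qed.
Lemma En_cst n c : En n (fun=> c) = c.
Proof.
elim: n => [//|n IH] /=; rewrite -[RHS]E1_cst.
by congr E1; apply/funext => h; rewrite IH.
Qed.
Lemma EnN n f : adm f -> En n (fun g => - f g) = - En n f.
Proof.
move=> af; rewrite -mulN1r -EnZ//; congr En; apply/funext => g.
by rewrite mulN1r.
Qed.
Lemma EnB n f k : adm f -> adm k -> En n (fun g => f g - k g) = En n f - En n k.
Proof. by move=> af ak; rewrite EnD// ?EnN//; exact: admN. Qed.
Lemma En_ge0 n f : adm f -> (forall g, 0 <= f g) -> 0 <= En n f.
Proof. by move=> af f0; rewrite -[leLHS](En_cst n); apply: En_le => //; exact: adm_cst. Qed.
Lemma En_norm n f : adm f -> `|En n f| <= En n (fun g => `|f g|).
Proof.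
move=> af; have aa := adm_abs af; rewrite ler_norml; apply/andP; split.
  rewrite -EnN//; apply: En_le => //; first exact: admN.
  by move=> g; rewrite lerNl -normrN ler_norm.
by apply: En_le => // g; exact: ler_norm.
Qed.

Lemma En_add n (k : nat) f : En (n + k) f = En k (fun h => En n (fun g => f (g ** h))).
Proof.
elim: k f => [|k IH] f; first by rewrite addn0 /=; congr En; apply/funext => g; rewrite mulg1.
rewrite addnS /=; congr E1; apply/funext => h; rewrite IH; congr En.
by apply/funext => h'; congr En; apply/funext => g; rewrite mulgA.
Qed.

Lemma En1 f : En 1 f = E1 f.
Proof. by rewrite /=; congr E1; apply/funext => g; rewrite mul1g. Qed.

(** Dominated convergence along an arbitrary filter, so that it applies to [t] tending to 0. A
    finite set carries the weighted mass up to [e / (2 * D)]; on it convergence is termwise. *)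
Lemma E1_dct (I : Type) (F : set_system I) (FF : Filter F) (C : R) (f : I -> G -> R) :
  (\forall i \near F, dom C (f i)) -> (forall g, f i g @[i --> F] --> (0 : R)) ->
  E1 (f i) @[i --> F] --> (0 : R).
Proof.
move=> fd f0; apply/cvgrPdist_le => /= e e0.
pose D := `|C| + 1; have D0 : 0 < D by rewrite ltr_pwDr.
have [s us Hs] := rsum_approx (divr_gt0 e0 (mulr_gt0 (ltr0Sn _ 1) D0)) (fun g => mulr_ge0 (m0 g) (w_ge0 g)) sw.
have cs : (\sum_(g <- s) m g * `|f i g|) @[i --> F] --> (0 : R).
  elim: s {us Hs} => [|g s IH].
    by under eq_fun do rewrite big_nil; exact: cvg_cst.
  under eq_fun do rewrite big_cons.
  have c0 : m g * `|f i g| @[i --> F] --> m g * `|0 : R|.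
    by apply: cvgM; [exact: cvg_cst|apply: cvg_norm; exact: f0].
  by have H := cvgD c0 IH; rewrite normr0 mulr0 addr0 in H; exact: H.
have near_s : \forall i \near F, \sum_(g <- s) m g * `|f i g| <= e / 2.
  have /cvgrPdist_le/(_ (e / 2) (divr_gt0 e0 (ltr0Sn _ 1))) := cs.
  apply: filterS => i; rewrite sub0r normrN; apply: le_trans; exact: ler_norm.
near=> i.
have di : dom C (f i) by near: i.
have si : \sum_(g <- s) m g * `|f i g| <= e / 2 by near: i.
rewrite sub0r normrN; apply: le_trans (E1_norm (dom_adm di)) _.
have ai := adm_abs (dom_adm di); have si' := adm_summ ai.
have dD g : `|f i g| <= D * w g.
  by apply: le_trans (di g) _; apply: ler_wpM2r; [exact: w_ge0|rewrite /D; have := ler_norm C; lra].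
have sD := summZ D sw.
have := @sum_seq_le_rsum _ _ (fun g => D * (m g * w g) - m g * `|f i g|) s us.
have p0 g : 0 <= D * (m g * w g) - m g * `|f i g| by rewrite subr_ge0 mulrCA ler_wpM2l.
move=> /(_ p0 (summD sD (summN si'))).
rewrite rsumB// rsumZ// big_split /= sumrN -mulr_sumr => H.
rewrite /E1.
have : D * rsum (fun g => m g * w g) <= D * \sum_(x <- s) m x * w x + e / 2.
  have -> : e / 2 = D * (e / (2 * D)) by field; rewrite gt_eqF.
  by rewrite -mulrDr ler_pM2l.
by lra.
Unshelve. all: by end_near. Qed.

Lemma En_dct n (I : Type) (F : set_system I) (FF : Filter F) (C : R) (f : I -> G -> R) :
  (\forall i \near F, dom C (f i)) -> (forall g, f i g @[i --> F] --> (0 : R)) ->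
  En n (f i) @[i --> F] --> (0 : R).
Proof.
elim: n C f => [|n IH] C f fd f0; first exact: f0.
apply: (@E1_dct _ F FF (C * w e1 * Lam ^+ n) (fun i h => En n (fun g => f i (g ** h)))).
  by apply: filterS fd => i /dom_En.
move=> h; apply: (IH (C * w h) (fun i g => f i (g ** h))); last by move=> g; exact: f0.
by apply: filterS fd => i /dom_tr.
Qed.

Lemma En_tail n (d : R) : 0 < d ->
  exists2 K : R, 0 < K & En n (fun g => w g * (K < w g)%R%:R) <= d.
Proof.
move=> d0.
have : En n (fun g => w g * (k.+1%:R < w g)%R%:R) @[k --> \oo] --> (0 : R).
  apply: (@En_dct _ _ \oo _ 1 (fun k g => w g * (k.+1%:R < w g)%R%:R)).
    near=> k => g; rewrite mul1r normrM ger0_norm ?w_ge0//.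
    by rewrite ler_piMr ?w_ge0//; case: (_ < _); rewrite ?normr1 ?normr0.
  move=> g; apply/cvgrPdist_le => /= e e0.
  near=> k; have -> : (k.+1%:R < w g) = false.
    apply/negbTE; rewrite -leNgt; apply: le_trans (ltW (truncnS_gt _)) _.
    rewrite ler_nat; near: k; exact: nbhs_infty_ge.
  by rewrite mulr0 subr0 normr0 ltW.
move=> /cvgrPdist_le/(_ d d0)[k _ /(_ k (leqnn k))]; rewrite sub0r normrN => H.
by exists k.+1%:R; rewrite ?ltr0n//; apply: le_trans (ler_norm _) H.
Unshelve. all: by end_near. Qed.

(** A second-moment argument by blocks of [n] steps: [c1] accumulates the bounded centred parts [Y],
    [c2] the parts [Z] that are small in mean. It starts from [x <= x^2 / (2 B) + B / 2]; as [Y] has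
    mean 0, the cross term disappears and each block adds only [b ^+ 2] to the square. Subadditivity
    controls upper deviations, hence the positive part. *)
Lemma walk_lln_step n f (a b d B : R) (Y Z : G -> R) : 0 < B -> adm f ->
  (forall g h, f (g ** h) <= f g + f h) -> f e1 <= 0 ->
  adm Y -> adm Z -> (forall g, f g = a + Y g + Z g) -> (forall g, `|Y g| <= b) ->
  En n Y = 0 -> En n (fun g => `|Z g|) <= d ->
  forall j c1 c2, En (j * n) (fun g => Num.max (f g - j%:R * a + c1 + c2) 0) <=
    (c1 ^+ 2 + j%:R * b ^+ 2) / (2 * B) + B / 2 + `|c2| + j%:R * d.
Proof.
move=> B0 af sub f1 aY aZ fE Yb EY EZ.
have b0 : 0 <= b by exact: le_trans (normr_ge0 _) (Yb e1).
have amax (x y z : R) : adm (fun g => Num.max (f g - x + y + z) 0).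
  apply: (@adm_le _ (fun g => `|f g - x + y + z|)).
    by move=> g; case: (leP (f g - x + y + z) 0); rewrite ?normr0.
  by apply/adm_abs/admD; [apply: admD; [apply: admB => //; exact: adm_cst|exact: adm_cst]|exact: adm_cst].
elim=> [|j IH] c1 c2.
  rewrite mul0n /= !mul0r !subr0 !addr0.
  have h1 : `|c1| <= c1 ^+ 2 / (2 * B) + B / 2.
    rewrite -subr_ge0.
    have -> : c1 ^+ 2 / (2 * B) + B / 2 - `|c1| = (`|c1| - B) ^+ 2 / (2 * B).
      by rewrite -(real_normK (num_real c1)); field; rewrite gt_eqF.
    by rewrite divr_ge0 ?sqr_ge0// mulr_ge0// ltW.
  apply: le_trans (lerD h1 (lexx `|c2|)).
  rewrite ge_max addr_ge0// andbT.
  by have := ler_norm c1; have := ler_norm c2; lra.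
rewrite mulSn addnC En_add.
pose K := (c1 ^+ 2 + j.+1%:R * b ^+ 2) / (2 * B) + B / 2 + `|c2| + j%:R * d.
have aRHS : adm (fun h => K + c1 / B * Y h + `|Z h|).
  by apply: admD; [apply: admD; [exact: adm_cst|exact: admZ]|exact: adm_abs].
have step h : En (j * n) (fun g => Num.max (f (g ** h) - j.+1%:R * a + c1 + c2) 0) <=
    K + c1 / B * Y h + `|Z h|.
  apply: le_trans (_ : En (j * n) (fun g => Num.max (f g - j%:R * a + (c1 + Y h) + (c2 + Z h)) 0) <= _).
    apply: En_le; [exact: adm_tr (amax _ _ _)|exact: amax|].
    move=> g; rewrite ge_max !le_max lexx orbT andbT.
    by apply/orP; left; have := sub g h; rewrite (fE h) -natr1; lra.
  apply: le_trans (IH _ _) _.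
  have h2 : (c1 + Y h) ^+ 2 <= c1 ^+ 2 + 2 * c1 * Y h + b ^+ 2.
    by have := Yb h; rewrite ler_norml => /andP[y1 y2]; nra.
  have h3 := ler_normD c2 (Z h).
  have h4 : ((c1 + Y h) ^+ 2 + j%:R * b ^+ 2) / (2 * B) <=
      (c1 ^+ 2 + j.+1%:R * b ^+ 2) / (2 * B) + c1 / B * Y h.
    have -> : (c1 ^+ 2 + j.+1%:R * b ^+ 2) / (2 * B) + c1 / B * Y h =
       (c1 ^+ 2 + 2 * c1 * Y h + j.+1%:R * b ^+ 2) / (2 * B) by field; rewrite gt_eqF.
    rewrite ler_pM2r ?invr_gt0 ?mulr_gt0// -natr1; lra.
  by rewrite /K; lra.
apply: le_trans (En_le n (adm_En (j * n) (amax _ _ _)) aRHS step) _.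
rewrite EnD; [|by apply: admD; [exact: adm_cst|exact: admZ]|exact: adm_abs].
rewrite EnD; [|exact: adm_cst|exact: admZ].
rewrite En_cst EnZ// EY mulr0 addr0 /K -natr1 mulrDl [X in _ <= _ + X]mulrDl mul1r.
by rewrite -!addrA !lerD2l.
Qed.

(** [j0] depends on [f] only through [C]; this serves the homomorphisms of the reducible case, which
    vary with [t]. Truncating where the weight exceeds [K] provides the bounded and the small part
    for [walk_lln_step]. *)
Lemma walk_lln (C : R) n (d : R) : 0 < d -> exists j0 : nat, forall j f, (j0 <= j)%N ->
  dom C f -> (forall g h, f (g ** h) <= f g + f h) -> f e1 <= 0 ->
  En (j * n) (fun g => Num.max (f g - j%:R * En n f) 0) <= d * j%:R.
Proof.
move=> d0; have [C0|C0] := ltP C 0.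
  by exists 0%N => j f _ /domW; rewrite leNgt C0.
pose d1 := d / (8 * (C + 1)).
have d10 : 0 < d1 by rewrite divr_gt0// mulr_gt0// ltr_pwDr.
have [K K0 HK] := En_tail n d10.
pose b := 2 * (C * K) + 1.
have b0 : 0 < b by rewrite ltr_pwDr// !mulr_ge0// ltW.
exists (Num.truncn (2 * b ^+ 2 / (d ^+ 2))).+1 => j f jj df sub f1.
have af := dom_adm df.
have j0 : 0 < j%:R :> R by rewrite ltr0n; apply: leq_trans jj.
pose T g := f g * (w g <= K)%R%:R; pose U g := f g * (K < w g)%R%:R.
have aT : adm T.
  apply: (@adm_le _ (fun g => `|f g|)); last exact: adm_abs.
  by move=> g; rewrite normrM ler_piMr//; case: (w g <= K); rewrite ?normr1 ?normr0.
have aU : adm U.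
  apply: (@adm_le _ (fun g => `|f g|)); last exact: adm_abs.
  by move=> g; rewrite normrM ler_piMr//; case: (_ < _); rewrite ?normr1 ?normr0.
have fTU g : f g = T g + U g.
  by rewrite /T /U -mulrDr; case: leP => _; rewrite ?addr0 ?add0r mulr1.
have ET : En n f = En n T + En n U by rewrite -EnD//; congr En; apply/funext.
have Tb g : `|T g| <= C * K.
  rewrite /T normrM; case: (leP (w g) K) => h /=; rewrite ?normr1 ?mulr1 ?normr0 ?mulr0.
    by apply: le_trans (df g) _; rewrite ler_wpM2l.
  by rewrite mulr_ge0// ltW.
have ETb : `|En n T| <= C * K.
  apply: le_trans (En_norm n aT) _; rewrite -[leRHS](En_cst n).
  by apply: En_le => //; [exact: adm_abs|exact: adm_cst].
have Ub : En n (fun g => `|U g|) <= C * d1.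
  apply: le_trans (_ : C * En n (fun g => w g * (K < w g)%R%:R) <= _); last exact: ler_wpM2l.
  have aw : adm (fun g => w g * (K < w g)%R%:R).
    apply: (adm_le _ adm_w) => g; rewrite normrM ger0_norm ?w_ge0// ler_piMr ?w_ge0//.
    by case: (_ < _); rewrite ?normr1 ?normr0.
  rewrite -EnZ//; apply: En_le; [exact: adm_abs|exact: admZ|].
  move=> g; rewrite /U normrM mulrA; case: (_ < _); rewrite ?normr1 ?normr0 ?mulr0// !mulr1.
  exact: df.
have EUb : `|En n U| <= C * d1 by exact: le_trans (En_norm n aU) Ub.
pose Y g := T g - En n T; pose Z g := U g - En n U.
have aY : adm Y by apply: admB => //; exact: adm_cst.
have aZ : adm Z by apply: admB => //; exact: adm_cst.
(* With this choice [B / 2] is half of the target; the square term and the truncation error take a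
   quarter each. *)
pose B := d * j%:R.
have B0 : 0 < B by rewrite mulr_gt0.
have fE g : f g = En n f + Y g + Z g by rewrite ET {1}fTU /Y /Z; ring.
have Yb g : `|Y g| <= b.
  apply: le_trans (ler_normB _ _) _; have := Tb g; rewrite /b; move: ETb; lra.
have EY : En n Y = 0 by rewrite EnB ?En_cst ?subrr//; exact: adm_cst.
have EZ : En n (fun g => `|Z g|) <= 2 * (C * d1).
  apply: le_trans (_ : En n (fun g => `|U g| + `|En n U|) <= _).
    apply: En_le; [exact: adm_abs|by apply: admD; [exact: adm_abs|exact: adm_cst]|].
    by move=> g; exact: ler_normB.
  by rewrite EnD ?En_cst; [lra|exact: adm_abs|exact: adm_cst].
have := walk_lln_step B0 af sub f1 aY aZ fE Yb EY EZ j 0 0.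
rewrite normr0 expr0n /= add0r addr0.
have -> : (fun g => Num.max (f g - j%:R * En n f + 0 + 0) 0) =
  (fun g => Num.max (f g - j%:R * En n f) 0) by apply/funext => g; rewrite !addr0.
move=> H; apply: le_trans H _.
have h1 : j%:R * b ^+ 2 / (2 * B) <= d * j%:R / 4.
  have : 2 * b ^+ 2 / d ^+ 2 <= j%:R.
    by apply: le_trans (ltW (truncnS_gt _)) _; rewrite ler_nat.
  rewrite ler_pdivrMr ?exprn_gt0// => h.
  rewrite ler_pdivrMr ?mulr_gt0// /B.
  have -> : d * j%:R / 4 * (2 * (d * j%:R)) = j%:R * (j%:R * d ^+ 2 / 2) by field.
  by rewrite ler_pM2l//; lra.
have h2 : C * d1 <= d / 8.
  rewrite /d1 mulrA ler_pdivrMr ?mulr_gt0 ?ltr_pwDr//.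
  have -> : d / 8 * (8 * (C + 1)) = d * (C + 1) by field.
  by nra.
have h3 : j%:R * (2 * (C * d1)) <= j%:R * (d / 4) by rewrite ler_pM2l//; lra.
by move: h1; set q := _ / (2 * B); rewrite /B => h1; lra.
Qed.

End Walk.

(** * Fekete's lemma *)

Section Fekete.
Variable R : realType.

Lemma fekete (u : nat -> R) : (forall n, 0 <= u n) ->
  (forall n k, u (n + k)%N <= u n + u k) ->
  exists l : R, [/\ 0 <= l, n%:R^-1 * u n @[n --> \oo] --> l & forall n, n%:R * l <= u n].
Proof.
move=> u0 sub; pose A := [set x | exists2 n : nat, (0 < n)%N & x = n%:R^-1 * u n].
have A0 : A !=set0 by exists (1%:R^-1 * u 1%N), 1%N.
have lbA : lbound A 0.
  by move=> _ [n n0 ->]; rewrite mulr_ge0// invr_ge0.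
have hA : has_inf A by split => //; exists 0.
exists (inf A); split; first by apply: lb_le_inf.
- apply/cvgrPdist_le => /= e e0.
  have [x [k k0 ->] Hk] := inf_adherent (divr_gt0 e0 (ltr0Sn _ 1)) hA.
  have mult q : u (q * k)%N <= q%:R * u k + u 0%N.
    elim: q => [|q IH]; first by rewrite mul0n mul0r add0r.
    by rewrite mulSn; apply: le_trans (sub _ _) _; rewrite -natr1 mulrDl mul1r; lra.
  pose D := \sum_(r < k) u r + u 0%N.
  have rem r : (r < k)%N -> u r + u 0%N <= D.
    move=> rk; rewrite /D lerD2r (bigD1 (Ordinal rk))//= lerDl sumr_ge0//.
  have D0 : 0 <= D by rewrite addr_ge0// sumr_ge0.
  near=> n.
  have n0 : (0 < n)%N by near: n; exact: nbhs_infty_gt.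
  have nR : 0 < n%:R :> R by rewrite ltr0n.
  have kR : 0 < k%:R :> R by rewrite ltr0n.
  have nD : 2 * D / e <= n%:R.
    apply: le_trans (ltW (truncnS_gt _)) _; rewrite ler_nat; near: n; exact: nbhs_infty_ge.
  have low : inf A <= n%:R^-1 * u n.
    by apply: ge_inf; [exists 0|exists n].
  rewrite ler0_norm ?subr_le0// opprB lerBlDr.
  have un : u n <= (n %/ k)%:R * u k + D.
    rewrite {1}(divn_eq n k); apply: le_trans (sub _ _) _.
    have := mult (n %/ k)%N; have := rem _ (ltn_pmod n k0); lra.
  have q1 : (n %/ k)%:R * u k <= n%:R * (k%:R^-1 * u k).
    rewrite mulrA; apply: ler_wpM2r => //.
    by rewrite ler_pdivlMr// -natrM ler_nat leq_divM.
  rewrite mulrC ler_pdivrMr//.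
  move: nD; rewrite ler_pdivrMr// => nD.
  by nra.
- move=> n; have [->|n0] := posnP n; first by rewrite mul0r.
  rewrite mulrC -ler_pdivlMr ?ltr0n// mulrC; apply: ge_inf; [by exists 0|by exists n].
Unshelve. all: by end_near. Qed.

End Fekete.

(** * Integrals over tuples, drift and concentration *)

Section WalkMore.
Variables (R : realType) (G : groupType) (W : walk R G).
Local Notation "x ** y" := (@monoid.mul G x y) (at level 40, left associativity).
Local Notation e1 := (@monoid.one G).
Implicit Types (f : G -> R) (g h x : G).
Local Notation m := (step W).
Let m0 : forall g, 0 <= m g := step_ge0 W.
Local Notation En := (En W).
Local Notation adm := (adm W).

Lemma gprod_rcons (s : seq G) h : gprod (rcons s h) = gprod s ** h.
Proof.
elim: s => [|a s IH] /=; first by rewrite mul1g mulg1.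
by rewrite /gprod /= -/(gprod _) IH mulgA.
Qed.

(** Links the integrals of the statement to the recursion. The head of a tuple is the first step,
    and [rev] puts it at the right end of the product. *)
Lemma int_conv_En n f : adm f -> (forall g, 0 <= f g) -> int_conv m n f = (En n f)%:E.
Proof.
elim: n f => [|n IH] f af f0.
  rewrite /int_conv (_ : [set: 0.-tuple G] = [set [tuple]]); last first.
    by apply/seteqP; split=> x //= _; rewrite tuple0.
  by rewrite esum_set1 /= ?big_ord0 mul1r ?lee_fin//; exact: f0.
pose a h (s : n.-tuple G) := (\prod_(i < n) m (tnth s i)) * f (gprod (rev s) ** h).
have a0 h s : 0 <= a h s by rewrite mulr_ge0// prodr_ge0.
have Ea h : (\esum_(s in [set: n.-tuple G]) (a h s)%:E)%E = (En n (fun g => f (g ** h)))%:E.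
  by rewrite -IH//; exact: adm_tr.
have sa h : summ (a h).
  by rewrite /summ; under eq_esum do rewrite ger0_norm//; rewrite Ea ltry.
transitivity (\esum_(h in [set: G]) \esum_(s in [set: n.-tuple G]) (m h * a h s)%:E)%E; last first.
  transitivity (\esum_(h in [set: G]) (m h * En n (fun g => f (g ** h)))%:E)%E.
    apply: eq_esum => h _; have [sc _] := rsum_seqZ_le (m0 h) (a0 h) (sa h).
    rewrite esum_EFin//; last by move=> s; rewrite mulr_ge0.
    rewrite -rsum_ge0E//; last by move=> s; rewrite mulr_ge0.
    by rewrite rsumZ// rsum_ge0E// /nsum Ea.
  have aE := adm_En n af.
  have E0 h : 0 <= En n (fun g => f (g ** h)).
    by apply: (En_ge0) => //; exact: adm_tr.
  rewrite esum_EFin; [|by move=> h; rewrite mulr_ge0|exact: adm_summ aE].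
  by rewrite -rsum_ge0E//; [move=> h; rewrite mulr_ge0|exact: adm_summ aE].
rewrite esum_esum; last by move=> h s _ _; rewrite lee_fin mulr_ge0.
rewrite /int_conv (@reindex_esum _ _ _ ([set: G] `*`` (fun=> [set: n.-tuple G])) _
   (fun p => [tuple of p.1 :: p.2])); last first.
  split=> //.
    by move=> [h s] [h' s'] _ _ /= /(congr1 val) /= [-> /val_inj ->].
  move=> t _; exists (thead t, [tuple of behead t]) => //=.
  by rewrite [in RHS](tuple_eta t); apply: val_inj.
apply: eq_esum => -[h s] _ /=; congr EFin.
rewrite big_ord_recl tnth0 -mulrA; congr (_ * (_ * _)).
  by apply: eq_bigr => i _; rewrite tnthS.
by rewrite rev_cons gprod_rcons.
Qed.

Lemma walk_drift f : adm f -> (forall g, 0 <= f g) -> (forall g h, f (g ** h) <= f g + f h) ->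
  exists l : R, [/\ 0 <= l, n%:R^-1 * En n f @[n --> \oo] --> l & forall n, n%:R * l <= En n f].
Proof.
move=> af f0 sub; apply: fekete => [n|n k]; first exact: (En_ge0).
rewrite En_add ; apply: le_trans (_ : En k (fun h => En n f + f h) <= _).
  apply: (En_le).
  - exact: (adm_En).
  - by apply: admD => //; exact: adm_cst.
  move=> h; rewrite -[X in _ + X](En_cst W n) -(EnD)//; last exact: adm_cst.
  apply: (En_le) => //; first exact: adm_tr.
  by apply: admD => //; exact: adm_cst.
by rewrite (EnD)// ?(En_cst)//; exact: adm_cst.
Qed.

(** Upper deviations are small by [walk_lln], with a block length [n1] whose mean is nearly
    [n1 * l]. Since the mean is never below [n * l], lower deviations cannot outweigh them. [n1] is
    a power of two, so it divides all later times. *)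
Lemma walk_concentration f (l d : R) : 0 < d -> adm f -> (forall g, 0 <= f g) ->
  (forall g h, f (g ** h) <= f g + f h) -> f e1 <= 0 ->
  n%:R^-1 * En n f @[n --> \oo] --> l -> (forall n, n%:R * l <= En n f) ->
  exists i0 : nat, forall i, (i0 <= i)%N ->
    En (2 ^ i) (fun g => `|f g - (2 ^ i)%:R * l|) <= d * (2 ^ i)%:R.
Proof.
move=> d0 af f0 sub f1 cl ll.
have [i1 Hi1] : exists i1 : nat, En (2 ^ i1) f <= (2 ^ i1)%:R * (l + d / 4).
  move/cvgrPdist_le: cl => /(_ (d / 4) (divr_gt0 d0 (ltr0Sn _ 3)))[N _ HN].
  exists N; have := HN (2 ^ N)%N (ltnW (ltn_expl _ (ltnSn 1))).
  rewrite distrC ler_norml => /andP[_ h]; rewrite -ler_pdivrMl ?ltr0n ?expn_gt0//; lra.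
set n1 := (2 ^ i1)%N in Hi1.
have n10 : 0 < n1%:R :> R by rewrite ltr0n expn_gt0.
have [C C0 dC] := af.
have [j0 Hj] := walk_lln W C n1 (divr_gt0 d0 (ltr0Sn _ 3)).
exists (i1 + j0)%N => i hi.
pose j := (2 ^ (i - i1))%N.
have nE : (2 ^ i = j * n1)%N by rewrite /j /n1 -expnD subnK// (leq_trans _ hi)// leq_addr.
have jj : (j0 <= j)%N.
  rewrite /j; apply: leq_trans (ltnW (ltn_expl _ (ltnSn 1))); by rewrite leq_subRL ?(leq_trans _ hi) ?leq_addr.
have n1ge1 : (1 : R) <= n1%:R by rewrite ler1n expn_gt0.
have := Hj j f jj dC sub f1; rewrite -nE; set n := (2 ^ i)%N in nE * => H.
set a := En n1 f in H Hi1.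
have nR : n%:R = j%:R * n1%:R :> R by rewrite nE natrM.
have aP (c : R) : adm (fun g => Num.max (f g - c) 0).
  apply: (@adm_le _ _ _ _ (fun g => `|f g - c|)); last by apply/adm_abs/admB => //; exact: adm_cst.
  by move=> g; case: (leP (f g - c) 0); rewrite ?normr0.
have j0' : 0 <= j%:R :> R by [].
have ja : j%:R * a - n%:R * l <= n%:R * (d / 4).
  by rewrite nR; have := ler_wpM2l j0' Hi1; lra.
have pos : En n (fun g => Num.max (f g - n%:R * l) 0) <= d / 4 * j%:R + n%:R * (d / 4).
  apply: le_trans (_ : En n (fun g => Num.max (f g - j%:R * a) 0 + n%:R * (d / 4)) <= _).
    apply: (En_le) => //; first by apply: admD => //; exact: adm_cst.
    move=> g; rewrite ge_max; apply/andP; split.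
      have : f g - j%:R * a <= Num.max (f g - j%:R * a) 0 by rewrite le_max lexx.
      by lra.
    by rewrite addr_ge0 ?le_max ?lexx ?orbT// mulr_ge0// divr_ge0// ltW.
  rewrite (EnD)// ?(En_cst)//; last exact: adm_cst.
  by rewrite lerD2r.
(* The absolute value of [x] is twice its positive part minus [x], and the mean of [x] is
   non-negative by [ll]. *)
have -> : (fun g => `|f g - n%:R * l|) =
    (fun g => 2 * Num.max (f g - n%:R * l) 0 - (f g - n%:R * l)).
  by apply/funext => g; case: (leP (f g - n%:R * l) 0) => h; [rewrite ler0_norm//|rewrite gtr0_norm//]; lra.
have afc : adm (fun g => f g - n%:R * l) by apply: admB => //; exact: adm_cst.
rewrite (EnB)//; last exact: admZ.
rewrite (EnZ)// (EnB)// ?(En_cst)//; last exact: adm_cst.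
have := ll n.
have : d * j%:R <= d * n%:R by rewrite ler_pM2l// nR ler_peMr.
by lra.
Qed.

End WalkMore.

(** * Random walks with drift for a tree-like length *)

Section Tree.
Variables (R : realType) (G : groupType) (W : walk R G) (N : G -> R).
Local Notation "x ** y" := (@monoid.mul G x y) (at level 40, left associativity).
Local Notation e1 := (@monoid.one G).
Local Notation "x ^v" := (@monoid.inv G x) (at level 3, format "x ^v").
Local Notation En := (En W).
Local Notation adm := (adm W).
Local Notation adm2 := (adm2 W).
Implicit Types (f : G -> R) (g h x s : G).

Hypothesis N0 : forall g, 0 <= N g.
Hypothesis NV : forall g, N (g^v) = N g.
Hypothesis NM : forall g h, N (g ** h) <= N g + N h.
Hypothesis N1 : N e1 <= 0.
Hypothesis N4 : forall g h k,
  N (g ** k^v) + N h <= Num.max (N (g ** h^v) + N k) (N g + N (h ** k^v)).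
Hypothesis aN : adm N.
Variable l : R.
Hypothesis l0 : 0 < l.
Hypothesis cl : n%:R^-1 * En n N @[n --> \oo] --> l.
Hypothesis ll : forall n, n%:R * l <= En n N.

(** If [N g] is read as the distance from a base point [o] to [g o], this is twice the Gromov
    product of [g^v o] and [h^v o]. *)
Definition Qp g h := N g + N h - N (g ** h^v).

Lemma Qp_sym g h : Qp g h = Qp h g.
Proof. by rewrite /Qp -(NV (g ** h^v)) invgM invgK [N g + _]addrC. Qed.

(** The four-point inequality [N4] rewritten: Gromov products in a tree are ultrametric, so sharing
    a direction to depth [r] is transitive. *)
Lemma Qp_ultra g h k (r : R) : r <= Qp g h -> r <= Qp h k -> r <= Qp g k.
Proof.
rewrite /Qp => h1 h2; have := N4 g h k; rewrite le_max => /orP[] h3; lra.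
Qed.

Lemma NMr g s : N g - N s <= N (g ** s).
Proof. by have := NM (g ** s) (s^v); rewrite mulgK NV; lra. Qed.

Lemma NMl g s : N g - N s <= N (s ** g).
Proof. by have := NM (s^v) (s ** g); rewrite mulKg NV; lra. Qed.

Lemma Qp_tr g h s : Qp g h - 2 * N s <= Qp (g ** s) (h ** s).
Proof.
rewrite /Qp invgM mulgA mulgK; have := NMr g s; have := NMr h s; lra.
Qed.

Lemma Qp_l g h s : Qp (s ** g) h - 2 * N s <= Qp g h.
Proof.
rewrite /Qp -mulgA; have := NMl (g ** h^v) s; have := NM s g.
have := NM (s^v) (s ** (g ** h^v)); rewrite mulKg NV; lra.
Qed.

(** Small when [g], [h] and [g ** h] all have their expected lengths, in which case [g] and [h]
    hardly cancel. *)
Definition err (n : nat) g h : R :=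
  `|N g - n%:R * l| + `|N h - n%:R * l| + `|N (g ** h) - (2 * n%:R) * l|.

Lemma adm2_err n : adm2 (err n).
Proof.
have a1 (c : R) : adm (fun g => `|N g - c|) by apply/adm_abs/admB => //; exact: adm_cst.
by apply: adm2D; [apply: adm2D; [exact: adm2_fst (a1 _)|exact: adm2_snd (a1 _)]|exact: adm2_mul (a1 _)].
Qed.

Lemma err_ge0 n g h : 0 <= err n g h. Proof. by rewrite !addr_ge0. Qed.

(** The product of two walks of [2 ^ i] steps is a walk of [2 ^ i.+1] steps, so concentration at two
    consecutive dyadic times suffices. *)
Lemma err_small (d : R) : 0 < d -> exists i0 : nat, forall i, (i0 <= i)%N ->
  En (2 ^ i) (fun h => En (2 ^ i) (fun g => err (2 ^ i) g h)) <= d * (2 ^ i)%:R.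
Proof.
move=> d0; have d40 : 0 < d / 4 by rewrite divr_gt0.
have [i0 H] := walk_concentration d40 aN N0 NM N1 cl ll.
exists i0 => i hi; have h1 := H i hi; have h2 := H i.+1 (leqW hi).
have eN : (2 ^ i.+1 = 2 ^ i + 2 ^ i)%N by rewrite expnS mul2n addnn.
rewrite {1}eN En_add in h2.
set n := (2 ^ i)%N in h1 h2 *.
have nE : (2 ^ i.+1)%:R = 2 * n%:R :> R by rewrite eN natrD; ring.
rewrite nE in h2.
have a1 (c : R) : adm (fun g => `|N g - c|) by apply/adm_abs/admB => //; exact: adm_cst.
have step h : En n (fun g => err n g h) = En n (fun g => `|N g - n%:R * l|) +
    `|N h - n%:R * l| + En n (fun g => `|N (g ** h) - (2 * n%:R) * l|).
  rewrite /err EnD; [|by apply: admD => //; exact: adm_cst|exact: (adm_tr h (a1 _))].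
  by rewrite EnD// ?En_cst//; exact: adm_cst.
under eq_fun do rewrite step.
rewrite EnD; [|by apply: admD => //; exact: adm_cst|exact: (adm_En n (a1 _))].
by rewrite EnD// ?En_cst//; [lra|exact: adm_cst].
Qed.

Definition mass n (r : R) x := En n (fun g => (r <= Qp x g)%R%:R).
(** The concentration function of the direction: the largest probability that the walk follows one
    direction to depth [r]. *)
Definition maxmass n (r : R) := sup [set mass n r x | x in [set: G]].

Lemma mass_le1 n r x : mass n r x <= 1.
Proof.
rewrite -[leRHS](En_cst W n); apply: En_le; [exact: adm_bool|exact: adm_cst|].
by move=> g; case: (_ <= Qp _ _).
Qed.
Lemma mass_ge0 n r x : 0 <= mass n r x.
Proof. by apply: En_ge0; [exact: adm_bool|]. Qed.
Lemma has_sup_mass n r : has_sup [set mass n r x | x in [set: G]].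
Proof. by split; [exists (mass n r e1), e1|exists 1 => _ [x _ <-]; exact: mass_le1]. Qed.
Lemma mass_max n r x : mass n r x <= maxmass n r.
Proof. by apply: ub_le_sup; [case: (has_sup_mass n r)|exists x]. Qed.
Lemma maxmass_le n r (c : R) : (forall x, mass n r x <= c) -> maxmass n r <= c.
Proof.
by move=> H; apply: ge_sup; [case: (has_sup_mass n r)|move=> _ [x _ <-]].
Qed.
Lemma maxmass_ge0 n r : 0 <= maxmass n r.
Proof. exact: le_trans (mass_ge0 n r e1) (mass_max n r e1). Qed.
Lemma maxmass_le1 n r : maxmass n r <= 1.
Proof. by apply: maxmass_le => x; exact: mass_le1. Qed.
Lemma mass_mono n r r' x : r' <= r -> mass n r x <= mass n r' x.
Proof.
move=> rr; apply: En_le; [exact: adm_bool|exact: adm_bool|].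
by move=> g; case: (leP r (Qp x g)) => // h; rewrite (le_trans rr h).
Qed.
Lemma maxmass_adh n r (e : R) : 0 < e -> exists x, maxmass n r - e <= mass n r x.
Proof.
by move=> e0; have [_ [x _ <-] /ltW H] := sup_adherent e0 (has_sup_mass n r); exists x.
Qed.

Lemma errP n g h (c : R) : err n g h <= c ->
  [/\ n%:R * l - c <= N g <= n%:R * l + c, n%:R * l - c <= N h <= n%:R * l + c,
      2 * n%:R * l - c <= N (g ** h) + N h - N g &
      N g + N h - N (g ** h) <= c].
Proof.
rewrite /err => H.
have a1 := ler_norm (N g - n%:R * l); have a2 := ler_norm (N h - n%:R * l).
have a3 := ler_norm (N (g ** h) - (2 * n%:R) * l).
have b1 := ler_norm (- (N g - n%:R * l)); have b2 := ler_norm (- (N h - n%:R * l)).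
have b3 := ler_norm (- (N (g ** h) - (2 * n%:R) * l)).
rewrite !normrN in b1 b2 b3.
have c1 := normr_ge0 (N g - n%:R * l); have c2 := normr_ge0 (N h - n%:R * l).
have c3 := normr_ge0 (N (g ** h) - (2 * n%:R) * l).
by split; try (apply/andP; split); lra.
Qed.

(** With [n = 2 ^ i], [g ** h] and [h] share their direction to depth [2 n l - err]. Unless [err]
    reaches [l n / 2], this exceeds [r], so the event for [g ** h] implies that for [h]. Markov's
    inequality bounds the exception by [2 * d / l]. *)
Lemma maxmass_double i (d r : R) :
  En (2 ^ i) (fun h => En (2 ^ i) (fun g => err (2 ^ i) g h)) <= d * (2 ^ i)%:R ->
  r <= 3 / 2 * l * (2 ^ i)%:R ->
  maxmass (2 ^ i.+1) r <= maxmass (2 ^ i) r + 2 * d / l.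
Proof.
move=> He hr; apply: maxmass_le => x.
rewrite /mass (_ : (2 ^ i.+1 = 2 ^ i + 2 ^ i)%N); last by rewrite expnS mul2n addnn.
rewrite En_add; set n := (2 ^ i)%N in He hr *.
have nR : 0 < n%:R :> R by rewrite ltr0n expn_gt0.
have ln : 0 < l * n%:R by rewrite mulr_gt0.
pose c := 2 / (l * n%:R); have c0 : 0 < c by rewrite divr_gt0.
pose K g h := (r <= Qp x h)%R%:R + c * err n g h.
have aK : adm2 K.
  by apply: adm2D; [exact: adm2_snd (adm_bool W _)|apply: adm2Z; exact: adm2_err].
have pw g h : (r <= Qp x (g ** h))%R%:R <= K g h.
  have e0 := err_ge0 n g h.
  rewrite /K; case: (leP r (Qp x (g ** h))) => [h1|_]; last first.
    by rewrite addr_ge0// mulr_ge0// ltW.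
  case: (leP r (Qp x h)) => [_|h2]; first by rewrite lerDl mulr_ge0// ltW.
  rewrite add0r /c mulrAC ler_pdivlMr// mul1r.
  rewrite leNgt; apply/negP => h3.
  suff : r <= Qp x h by rewrite leNgt h2.
  apply: (Qp_ultra h1); rewrite /Qp mulgK.
  have /errP[_ _ h4 _] := lexx (err n g h).
  by lra.
apply: le_trans (_ : En n (fun h => En n (fun g => K g h)) <= _).
  apply: En_le; [exact: adm_En (adm_bool W (fun g => r <= Qp x g))|exact: adm2_En|].
  move=> h; apply: En_le; [exact: adm_tr (adm_bool W (fun g => r <= Qp x g))|exact: adm2_l|].
  by move=> g; exact: pw.
have ae h : adm (fun g => err n g h) by exact: adm2_l (adm2_err n).
have step h : En n (fun g => K g h) = (r <= Qp x h)%R%:R + c * En n (fun g => err n g h).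
  by rewrite /K EnD ?En_cst ?EnZ//; [exact: adm_cst|exact: admZ].
under eq_fun do rewrite step.
have aee : adm (fun h => En n (fun g => err n g h)) by exact: adm2_En (adm2_err n).
rewrite EnD ?EnZ//; [|exact: adm_bool|exact: admZ].
apply: lerD; first exact: mass_max.
apply: le_trans (ler_wpM2l (ltW c0) He) _.
rewrite /c; have -> : 2 / (l * n%:R) * (d * n%:R) = 2 * d / l by field; rewrite !gt_eqF.
exact: lexx.
Qed.

(** The depth stays fixed while time is doubled [k] times, so relative to time it becomes as small
    as desired. *)
Lemma maxmass_iter i k (d : R) : 0 <= d ->
  (forall j, (i <= j)%N ->
    En (2 ^ j) (fun h => En (2 ^ j) (fun g => err (2 ^ j) g h)) <= d * (2 ^ j)%:R) ->
  maxmass (2 ^ (i + k)) (3 / 2 * l * (2 ^ i)%:R) <=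
  maxmass (2 ^ i) (3 / 2 * l * (2 ^ i)%:R) + k%:R * (2 * d / l).
Proof.
move=> d0 H; elim: k => [|k IH]; first by rewrite addn0 mul0r addr0.
rewrite addnS; apply: le_trans (maxmass_double (H (i + k)%N (leq_addr _ _)) _) _.
  by rewrite ler_pM2l ?mulr_gt0// ler_nat leq_exp2l// leq_addr.
have E (X : R) : k.+1%:R * X = k%:R * X + X by rewrite -natr1 mulrDl mul1r.
by rewrite E addrA lerD2r.
Qed.

(* If [Qp x h] were small, [h^-1] would point towards [x h^-1], hence towards [g],
   whereas independent steps rarely cancel. *)
Lemma mass_concentration i (d e : R) x : 0 <= d ->
  En (2 ^ i) (fun h => En (2 ^ i) (fun g => err (2 ^ i) g h)) <= d * (2 ^ i)%:R ->
  maxmass (2 ^ i.+1) (3 * l * (2 ^ i)%:R) - e <= mass (2 ^ i.+1) (3 * l * (2 ^ i)%:R) x ->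
  maxmass (2 ^ i.+1) (3 * l * (2 ^ i)%:R) - e <=
  mass (2 ^ i) (l * (2 ^ i)%:R) x * maxmass (2 ^ i) (3 / 4 * l * (2 ^ i)%:R) + 8 * d / l.
Proof.
move=> d0 He H; apply: le_trans H _.
rewrite {1}/mass (_ : (2 ^ i.+1 = 2 ^ i + 2 ^ i)%N); last by rewrite expnS mul2n addnn.
rewrite En_add; set n := (2 ^ i)%N in He *.
have nR : 0 < n%:R :> R by rewrite ltr0n expn_gt0.
have ln : 0 < l * n%:R by rewrite mulr_gt0.
pose c := 8 / (l * n%:R); have c0 : 0 < c by rewrite divr_gt0.
(* [r] is the depth [3/2 l] per step at time [2 n]. Translation by [h^v] costs [2 * N h], about
   [2 l n], which leaves about [l n]; an [err] below [l n / 8] lowers it to at least [r']. *)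
pose r := 3 * l * n%:R; pose r' := 3 / 4 * l * n%:R.
pose K g h := (l * n%:R <= Qp x h)%R%:R * (r' <= Qp (x ** h^v) g)%R%:R + c * err n g h.
have aK : adm2 K.
  apply: adm2D; last by apply: adm2Z; exact: adm2_err.
  have := adm2_bool W (fun g h => (l * n%:R <= Qp x h) && (r' <= Qp (x ** h^v) g)).
  by apply: adm2_le => g h; rewrite -natrM mulnb ger0_norm.
have pw g h : (r <= Qp x (g ** h))%R%:R <= K g h.
  have e0 := err_ge0 n g h.
  have ce : 0 <= c * err n g h by rewrite mulr_ge0// ltW.
  have [h1|h1] := leP r (Qp x (g ** h)); last first.
    by rewrite /K addr_ge0// -natrM ler0n.
  have [h2|h2] := leP (l * n%:R) (8 * err n g h).
    apply: le_trans (_ : c * err n g h <= _); last by rewrite /K lerDr -natrM ler0n.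
    by rewrite /c mulrAC ler_pdivlMr// mul1r.
  have /errP[/andP[g1 g2] /andP[k1 k2] q1 q2] := lexx (err n g h).
  have h3 : r' <= Qp (x ** h^v) g.
    have := Qp_tr x (g ** h) (h^v); rewrite mulgK NV /r'; move: h1; rewrite /r; lra.
  have [h4|h4] := leP (l * n%:R) (Qp x h).
    by rewrite /K h4 h3 mulr1 lerDl.
  have h5 : Qp (h^v) (x ** h^v) = 2 * N h - Qp x h.
    by rewrite /Qp invgM invgK mulgA mulVg mul1g !NV; lra.
  have h6 : r' <= Qp (h^v) (x ** h^v) by rewrite h5 /r'; lra.
  have := Qp_ultra h6 h3; rewrite Qp_sym /Qp invgK NV /r'; lra.
apply: le_trans (_ : En n (fun h => En n (fun g => K g h)) <= _).
  apply: En_le; [exact: adm_En (adm_bool W (fun g => r <= Qp x g))|exact: adm2_En|].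
  move=> h; apply: En_le; [exact: adm_tr (adm_bool W (fun g => r <= Qp x g))|exact: adm2_l|].
  by move=> g; exact: pw.
have ae h : adm (fun g => err n g h) by exact: adm2_l (adm2_err n).
have aee : adm (fun h => En n (fun g => err n g h)) by exact: adm2_En (adm2_err n).
have step h : En n (fun g => K g h) <=
    maxmass n r' * (l * n%:R <= Qp x h)%R%:R + c * En n (fun g => err n g h).
  rewrite /K EnD ?EnZ//; [|exact: adm_bool|by apply: admZ; exact: adm_bool|exact: admZ].
  rewrite lerD2r [leRHS]mulrC; apply: ler_wpM2l; first by [].
  exact: mass_max.
apply: le_trans (En_le n _ _ step) _; first exact: adm2_En.
  by apply: admD; [apply: admZ; exact: adm_bool|exact: admZ].
rewrite EnD ?EnZ//; [|exact: adm_bool|by apply: admZ; exact: adm_bool|exact: admZ].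
rewrite [maxmass _ _ * _]mulrC lerD2l.
apply: le_trans (ler_wpM2l (ltW c0) He) _.
rewrite /c; have -> : 8 / (l * n%:R) * (d * n%:R) = 8 * d / l by field; rewrite !gt_eqF.
exact: lexx.
Qed.

Definition spread := forall e eta : R, 0 < e -> 0 < eta -> forall i0 : nat,
  exists2 i, (i0 <= i)%N &
    En (2 ^ i) (fun g => En (2 ^ i) (fun h => (e * (2 ^ i)%:R <= Qp g h)%R%:R)) <= eta.

Definition aligned := forall eta : R, 0 < eta -> forall i0 : nat,
  exists i x, (i0 <= i)%N /\ 1 - eta <= mass (2 ^ i) (l * (2 ^ i)%:R) x.

(** If [b] takes arbitrarily small values at late scales, [maxmass_iter] yields [spread]. Otherwise
    [b] stays above some [c]; being bounded, it cannot drop by [e] at every second scale. At a scale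
    without such a drop, [mass_concentration] says that [b i] is at most about [p * b i], where [p]
    is the mass of one direction, so [p] is close to 1. *)
Lemma spread_or_aligned : spread \/ aligned.
Proof.
pose b i := maxmass (2 ^ i) (3 / 2 * l * (2 ^ i)%:R).
have [small|] := pselect (forall c : R, 0 < c -> forall i0, exists2 i, (i0 <= i)%N & b i < c).
  left=> e eta e0 eta0 i0.
  have [k Hk] : exists k : nat, 3 / 2 * l <= e * (2 ^ k)%:R.
    exists (Num.truncn (3 / 2 * l / e)).+1; rewrite [leRHS]mulrC -ler_pdivrMr//.
    by apply: le_trans (ltW (truncnS_gt _)) _; rewrite ler_nat; exact: ltnW (ltn_expl _ (ltnSn 1)).
  pose d := eta * l / (4 * k.+1%:R).
  have d0 : 0 < d by rewrite divr_gt0 ?mulr_gt0.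
  have [i1 H1] := err_small d0.
  have [i hi bi] := small (eta / 2) ltac:(by rewrite divr_gt0) (maxn i0 i1).
  have [hi0 hi1] : (i0 <= i)%N /\ (i1 <= i)%N.
    by split; apply: leq_trans hi; rewrite ?leq_maxl ?leq_maxr.
  exists (i + k)%N; first exact: leq_trans (leq_addr _ _).
  have M := maxmass_iter k (ltW d0) (fun j hj => H1 j (leq_trans hi1 hj)).
  set n := (2 ^ (i + k))%N in M *.
  rewrite -[leRHS](En_cst W n); apply: En_le; [|exact: adm_cst|].
    apply: adm2_En; exact: (adm2_bool W (fun h g => e * n%:R <= Qp g h)).
  move=> g; apply: le_trans (_ : maxmass n (3 / 2 * l * (2 ^ i)%:R) <= _).
    apply: le_trans (mass_max n _ g); apply: mass_mono.
    have -> : e * n%:R = e * (2 ^ k)%:R * (2 ^ i)%:R by rewrite /n expnD natrM; ring.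
    by rewrite ler_pM2r// ltr0n expn_gt0.
  apply: le_trans M _.
  have kd : k%:R * (2 * d / l) <= eta / 2.
    have -> : k%:R * (2 * d / l) = eta / 2 * (k%:R / k.+1%:R).
      by rewrite /d; field; rewrite !gt_eqF.
    by rewrite ger_pMr ?divr_gt0// ler_pdivrMr// mul1r ler_nat.
  by rewrite -/(b i); lra.
move=> /existsNP[c /not_implyP[c0 /existsNP[i1 Hc]]].
have bc i : (i1 <= i)%N -> c <= b i.
  by move=> hi; rewrite leNgt; apply/negP => bi; apply: Hc; exists i.
right=> eta eta0 i0.
(* Chosen so that [2 * e] and [10 * (d / l)] are each at most [c * eta / 4], which leaves
   [1 - p <= eta / 2]. *)
pose d := Num.min 1 (c * eta * l / 40); pose e := c * eta / 8.
have e0 : 0 < e by rewrite divr_gt0 ?mulr_gt0.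
have d0 : 0 < d by rewrite lt_min ltr01 divr_gt0 ?mulr_gt0.
have dl : d / l <= c * eta / 40.
  by rewrite ler_pdivrMr// mulrAC ge_min lexx orbT.
have [i2 H2] := err_small d0.
pose I := (i0 + i1 + i2)%N.
have [i hi bi] : exists2 i, (I <= i)%N & b i - e <= b i.+2.
  apply: contrapT => nH.
  have dec i : (I <= i)%N -> b i.+2 <= b i - e.
    by move=> hi; rewrite leNgt; apply/negP => bi; apply: nH; exists i => //; exact: ltW.
  have dk k : b (I + k.*2)%N <= b I - k%:R * e.
    elim: k => [|k IH]; first by rewrite addn0 mul0r subr0.
    rewrite doubleS !addnS; apply: le_trans (dec _ (leq_addr _ _)) _.
    by rewrite -natr1 mulrDl mul1r; lra.
  have := dk (Num.truncn e^-1).+1; have := maxmass_le1 (2 ^ I) (3 / 2 * l * (2 ^ I)%:R).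
  have := maxmass_ge0 (2 ^ (I + (Num.truncn e^-1).+1.*2)) (3 / 2 * l * (2 ^ (I + (Num.truncn e^-1).+1.*2))%:R).
  rewrite -/(b _) -/(b I) => t1 t2 t3.
  have : 1 < (Num.truncn e^-1).+1%:R * e by rewrite -ltr_pdivrMr// div1r truncnS_gt.
  by lra.
have [h1 h2 h3] : [/\ (i0 <= i.+1)%N, (i1 <= i)%N & (i2 <= i)%N].
  by move: hi; rewrite /I => hi; split; lia.
have E1 : 3 / 2 * l * (2 ^ i.+2)%:R = 3 * l * (2 ^ i.+1)%:R.
  by rewrite [(2 ^ i.+2)%N]expnS natrM; field.
have E2 : 3 / 4 * l * (2 ^ i.+1)%:R = 3 / 2 * l * (2 ^ i)%:R.
  by rewrite [(2 ^ i.+1)%N]expnS natrM; field.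
have [x Hx] := maxmass_adh (2 ^ i.+2) (3 * l * (2 ^ i.+1)%:R) e0.
exists i.+1, x; split=> //.
have := mass_concentration (ltW d0) (H2 _ (leqW h3)) Hx.
rewrite -E1 -/(b i.+2) E2.
have := maxmass_double (r := 3 / 2 * l * (2 ^ i)%:R) (H2 _ h3) (lexx _).
rewrite -/(b i).
set M := maxmass _ _; set p := mass _ _ _ => t1 t2.
have p0 : 0 <= p by exact: mass_ge0.
have p1 : p <= 1 by exact: mass_le1.
have cb := bc i h2.
have t3 : p * M <= p * b i + 2 * d / l.
  apply: le_trans (ler_wpM2l p0 t1) _; rewrite mulrDr lerD2l ler_piMl//.
  by rewrite divr_ge0 ?mulr_ge0 ?ltW.
have s1 : (1 - p) * b i <= 2 * e + 10 * (d / l) by lra.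
have s2 : (1 - p) * c <= (1 - p) * b i by rewrite ler_wpM2l// subr_ge0.
suff : 1 - p <= eta / 2 by lra.
by rewrite -(ler_pM2r c0); rewrite /e in s1; lra.
Qed.

(** By a union bound some [h] is such that [s0 ** h], and [h ** s] for finitely many steps [s], all
    follow [x] deeply. Removing [s0] costs little, so [h] and [h ** s] agree deeply. For words in
    such letters the ultrametric inequality gives the same, up to a loss bounded by their
    lengths. *)
Lemma aligned_fix : supp_generates (step W) -> aligned -> forall (vs : seq G) (D : R),
  exists h, forall v, v \in vs -> D <= Qp (h ** v) h.
Proof.
move=> gen al vs D.
have [wd Hwd] : {wd : G -> seq G & forall g,
    all (fun x => (0 < step W x) || (0 < step W (x^v))) (wd g) /\ g = gprod (wd g)}.
  by exists (fun g => sval (cid (gen g))) => g; case: (cid (gen g)).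
have [s0 ms0] : exists s0, 0 < step W s0.
  apply: contrapT => nH; have := step_sum W; rewrite esum1; first by move/eqP; rewrite eqe eq_sym oner_eq0.
  move=> g _; congr EFin; apply/eqP; rewrite eq_le step_ge0 andbT leNgt.
  by apply/negP => mg; apply: nH; exists g.
pose letters := flatten [seq wd v | v <- vs].
(* A letter is a step of positive probability or the inverse of one; [F] keeps the members of each
   such pair that can occur as steps. *)
pose F := [seq s <- letters ++ [seq s^v | s <- letters] | 0 < step W s].
have FP s : s \in F -> 0 < step W s by rewrite mem_filter => /andP[].
(* Conditioning on a step [s] multiplies the bad mass [eta] by at most the inverse of its
   probability. [T] adds these factors, and [eta * T < 1] makes the union bound work. *)
pose T := \sum_(s <- F) (step W s)^-1 + (step W s0)^-1.
have T0 : 0 <= T.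
  by rewrite addr_ge0 ?invr_ge0 ?step_ge0// sumr_ge0// => s _; rewrite invr_ge0 step_ge0.
pose K := 2 * \sum_(y <- letters) N y + 2 * N s0.
pose eta := (T + 1)^-1 / 2.
have T1 : 0 < T + 1 by rewrite ltr_pwDr.
have eta0 : 0 < eta by rewrite divr_gt0 ?invr_gt0.
have [i [x [hi Hx]]] := al eta eta0 (Num.truncn ((D + K) / l)).+1.
have ln : D + K <= l * (2 ^ i)%:R.
  rewrite [leRHS]mulrC -ler_pdivrMr//; apply: le_trans (ltW (truncnS_gt _)) _; rewrite ler_nat.
  exact: leq_trans hi (ltnW (ltn_expl _ (ltnSn 1))).
move: Hx ln; rewrite /mass; set n := (2 ^ i)%N; set r := l * n%:R => Hx ln.
have bad : En n (fun h => (Qp x h < r)%R%:R) <= eta.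
  have : En n (fun h => (r <= Qp x h)%R%:R) + En n (fun h => (Qp x h < r)%R%:R) = 1.
    rewrite -EnD; [|exact: adm_bool|exact: adm_bool].
    rewrite -[RHS](En_cst W n); apply: eq_En => h.
    by case: leP => _; rewrite ?addr0 ?add0r.
  by lra.
have [n' nE] : exists n', n = n'.+1 by exists n.-1; rewrite prednK// expn_gt0.
have badr s : s \in F -> En n' (fun h => (Qp x (h ** s) < r)%R%:R) <= eta * (step W s)^-1.
  move=> /FP ms; rewrite ler_pdivlMr// mulrC; apply: le_trans bad.
  rewrite nE /=; apply: E1_point; first exact: adm_En (adm_bool W (fun h => Qp x h < r)).
  by move=> g; apply: En_ge0 => //; exact: adm_bool.
have badl : En n' (fun h => (Qp x (s0 ** h) < r)%R%:R) <= eta * (step W s0)^-1.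
  rewrite ler_pdivlMr// mulrC; apply: le_trans bad.
  rewrite nE -add1n En_add -EnZ; last exact: adm_bool.
  apply: En_le; [by apply: admZ; exact: adm_bool|exact: adm_En (adm_bool W (fun h => Qp x h < r))|].
  move=> h; rewrite En1; apply: (@E1_point _ _ W (fun g => (Qp x (g ** h) < r)%R%:R)) => //.
  exact: adm_bool.
have [h hl hr] : exists2 h, r <= Qp x (s0 ** h) & forall s, s \in F -> r <= Qp x (h ** s).
  apply: contrapT => nH.
  pose Z (L : seq G) h : R := \sum_(s <- L) (Qp x (h ** s) < r)%R%:R.
  have aZ L : adm (Z L).
    elim: L => [|s L IH]; rewrite /Z; first by under eq_fun do rewrite big_nil; exact: adm_cst.
    by under eq_fun do rewrite big_cons; apply: admD => //; exact: adm_bool.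
  have EZ L : {subset L <= F} -> En n' (Z L) <= eta * \sum_(s <- L) (step W s)^-1.
    elim: L => [|s L IH] LF; rewrite /Z.
      by under eq_fun do rewrite big_nil; rewrite big_nil mulr0 En_cst.
    under eq_fun do rewrite big_cons.
    rewrite big_cons mulrDr EnD; [|exact: adm_bool|exact: aZ].
    by apply: lerD; [apply: badr; apply: LF; rewrite mem_head|apply: IH => u uL; apply: LF; rewrite in_cons uL orbT].
  have : 1 <= En n' (fun h => Z F h + (Qp x (s0 ** h) < r)%R%:R).
    rewrite -[leLHS](En_cst W n'); apply: En_le; [exact: adm_cst|by apply: admD => //; exact: adm_bool|].
    move=> h; have Z0 L : 0 <= Z L h by apply: sumr_ge0.
    have [h1|h1] := leP r (Qp x (s0 ** h)); last by rewrite lerDr.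
    have [s sF h2] : exists2 s, s \in F & Qp x (h ** s) < r.
      apply: contrapT => nH'; apply: nH; exists h => // s sF.
      by rewrite leNgt; apply/negP => h2; apply: nH'; exists s.
    rewrite addr0 /Z (big_rem s)//= h2 lerDl; exact: sumr_ge0.
  rewrite EnD; [|exact: aZ|exact: adm_bool].
  have := EZ F (fun _ => id); have : eta * T < 1.
    rewrite /eta mulrAC ltr_pdivrMr// mul1r mulrC ltr_pdivrMr//; lra.
  by rewrite /T mulrDr; lra.
pose d0 := r - 2 * N s0.
have hx : d0 <= Qp x h.
  by have := Qp_l h x s0; rewrite Qp_sym [Qp h x]Qp_sym /d0; lra.
have fix_letter s : s \in F -> d0 <= Qp h (h ** s).
  move=> sF; apply: (@Qp_ultra _ x); first by rewrite Qp_sym.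
  by have := hr s sF; rewrite /d0; have := N0 s0; lra.
have fix_y y : y \in letters -> (0 < step W y) || (0 < step W (y^v)) ->
    d0 - 2 * N y <= Qp (h ** y) h.
  move=> yl /orP[my|my].
    have yF : y \in F by rewrite mem_filter my mem_cat yl.
    by have := fix_letter _ yF; rewrite Qp_sym; have := N0 y; lra.
  have yF : y^v \in F by rewrite mem_filter my mem_cat map_f ?orbT.
  have := fix_letter _ yF; have := Qp_tr h (h ** y^v) y; rewrite mulgVK; lra.
exists h => v vvs; have [wl ->] := Hwd v.
have sub : {subset wd v <= letters} by move=> y yv; apply/flatten_mapP; exists v.
have NW L : N (gprod L) <= \sum_(y <- L) N y.
  elim: L => [|y L IH]; first by rewrite big_nil.
  by rewrite big_cons; apply: le_trans (NM _ _) _; rewrite lerD2l.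
have word L : {subset L <= letters} -> all (fun x => (0 < step W x) || (0 < step W (x^v))) L ->
    d0 - 2 * \sum_(y <- L) N y <= Qp (h ** gprod L) h.
  elim: L => [|y L IH] Ls /=.
    move=> _; rewrite big_nil mulr0 subr0 /gprod /= mulg1.
    apply: (@Qp_ultra _ x) => //; first by rewrite Qp_sym.
  move=> /andP[yy LL]; rewrite big_cons.
  have IH' := IH (fun u uL => Ls u ltac:(by rewrite in_cons uL orbT)) LL.
  have yl := Ls y (mem_head _ _).
  apply: (@Qp_ultra _ (h ** gprod L)).
    rewrite /gprod /= -/(gprod L) mulgA.
    by have := Qp_tr (h ** y) h (gprod L); have := fix_y y yl yy; have := NW L; lra.
  by have := N0 y; lra.
apply: le_trans (word _ sub wl).
have : \sum_(y <- wd v) N y <= \sum_(y <- letters) N y.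
  rewrite /letters [leRHS]big_flatten /= big_map [leRHS](big_rem v)//= lerDl.
  by apply: sumr_ge0 => u _; apply: sumr_ge0.
by move: ln; rewrite /K /d0; lra.
Qed.

End Tree.

(** * Two-by-two matrices *)

Section TwoByTwo.
Variable R : realType.
Local Notation C := R[i].
Local Notation i0 := (ord0 : 'I_2).
Local Notation i1 := (ord_max : 'I_2).
Implicit Types (A B K : 'M[C]_2) (p q : C).

Lemma ord2P (i : 'I_2) : i = i0 \/ i = i1.
Proof. by case: i => [[|[|]]] //= H; [left|right]; apply: val_inj. Qed.

Lemma sum2 (V : zmodType) (F : 'I_2 -> V) : \sum_(i < 2) F i = F i0 + F i1.
Proof.
by rewrite big_ord_recl big_ord1; congr (_ + F _); apply: val_inj.
Qed.

Lemma mulmx2 A B i j : (A *m B) i j = A i i0 * B i0 j + A i i1 * B i1 j.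
Proof. by rewrite mxE sum2. Qed.

Lemma det2 A : \det A = A i0 i0 * A i1 i1 - A i0 i1 * A i1 i0.
Proof.
rewrite (expand_det_row _ i0) sum2 /cofactor !det_mx11 !mxE /=.
rewrite !addn0 expr0 add0n expr1 mul1r mulN1r mulrN.
by congr (_ * A _ _ - _ * A _ _); apply: val_inj.
Qed.

Lemma opnormE A : opnorm A = Num.max (cabs (A i0 i0) + cabs (A i0 i1))
                                     (cabs (A i1 i0) + cabs (A i1 i1)).
Proof.
rewrite /opnorm; under eq_bigr do rewrite sum2.
rewrite 2!big_ord_recl big_ord0.
have -> : lift ord0 ord0 = i1 by apply: val_inj.
by rewrite [X in Num.max _ X]max_l// addr_ge0// cabs_ge0.
Qed.

Lemma opn_row A i : cabs (A i i0) + cabs (A i i1) <= opnorm A.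
Proof. by rewrite opnormE le_max; case: (ord2P i) => ->; rewrite lexx ?orbT. Qed.

Lemma opn_entry A i j : cabs (A i j) <= opnorm A.
Proof.
apply: le_trans (opn_row A i); case: (ord2P j) => ->; by rewrite ?lerDl ?lerDr cabs_ge0.
Qed.

Lemma opn_ge0 A : 0 <= opnorm A.
Proof. exact: le_trans (cabs_ge0 _) (opn_entry A i0 i0). Qed.

Lemma opn_le A (c : R) : (forall i j, cabs (A i j) <= c) -> opnorm A <= 2 * c.
Proof.
move=> H; rewrite opnormE ge_max.
by have := H i0 i0; have := H i0 i1; have := H i1 i0; have := H i1 i1; lra.
Qed.

Lemma opn_ex A : exists i j, opnorm A <= 2 * cabs (A i j).
Proof.
suff [i Hi] : exists i, opnorm A <= cabs (A i i0) + cabs (A i i1).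
  have [h|h] := leP (cabs (A i i0)) (cabs (A i i1)); [exists i, i1|exists i, i0]; lra.
rewrite opnormE; case: (leP (cabs (A i0 i0) + _)) => _; [by exists i1|by exists i0].
Qed.

Lemma opnM A B : opnorm (A *m B) <= opnorm A * opnorm B.
Proof.
suff H i : cabs ((A *m B) i i0) + cabs ((A *m B) i i1) <= opnorm A * opnorm B.
  by rewrite {1}opnormE ge_max !H.
rewrite !mulmx2; have t j := cabsD (A i i0 * B i0 j) (A i i1 * B i1 j).
have := t i0; have := t i1; rewrite !cabsM => t1 t0.
have r := opn_row A i; have r0 := opn_row B i0; have r1 := opn_row B i1.
have a0 := cabs_ge0 (A i i0); have a1 := cabs_ge0 (A i i1); have b0 := opn_ge0 B.
apply: le_trans (ler_wpM2r b0 r).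
have := ler_wpM2l a0 r0; have := ler_wpM2l a1 r1; lra.
Qed.

Lemma opn_ge1 A : \det A = 1 -> 1 <= opnorm A.
Proof.
rewrite det2 => dA.
have : cabs (A i0 i0 * A i1 i1 - A i0 i1 * A i1 i0) <= opnorm A * opnorm A.
  apply: le_trans (cabsD _ _) _; rewrite cabsN !cabsM.
  have r0 := opn_row A i0; have r1 := opn_row A i1.
  have c1 := cabs_ge0 (A i0 i0); have c2 := cabs_ge0 (A i0 i1).
  have c3 := cabs_ge0 (A i1 i0); have c4 := cabs_ge0 (A i1 i1).
  apply: le_trans (ler_pM _ _ r0 r1); rewrite ?addr_ge0//; nra.
by rewrite dA cabs1 => h; have := opn_ge0 A; nra.
Qed.

Lemma opn1 : opnorm (1%:M : 'M[C]_2) = 1.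
Proof.
by rewrite opnormE !mxE /= expr1n expr0n /= !addr0 sqrtr1 sqrtr0 addr0 add0r maxxx.
Qed.

(** The adjugate, which is the inverse when the determinant is 1. Its entries are those of [A] up to
    sign, so inversion costs only a constant in norm. *)
Definition adj2 A : 'M[C]_2 := \matrix_(i, j)
  (if i == i0 then (if j == i0 then A i1 i1 else - A i0 i1)
   else (if j == i0 then - A i1 i0 else A i0 i0)).

Lemma adj2E A : [/\ adj2 A i0 i0 = A i1 i1, adj2 A i0 i1 = - A i0 i1,
  adj2 A i1 i0 = - A i1 i0 & adj2 A i1 i1 = A i0 i0].
Proof. by split; rewrite mxE. Qed.

Lemma mul_adj2 A : \det A = 1 -> adj2 A *m A = 1%:M.
Proof.
rewrite det2 => dA; apply/matrixP => i j; rewrite mulmx2.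
have [e1 e2 e3 e4] := adj2E A.
case: (ord2P i) => ->; case: (ord2P j) => ->; rewrite ?e1 ?e2 ?e3 ?e4 mxE /= ?mulr1n ?mulr0n -?dA; ring.
Qed.

Lemma opn_adj2 A : opnorm (adj2 A) <= 2 * opnorm A.
Proof.
have [e1 e2 e3 e4] := adj2E A.
apply: opn_le => i j; case: (ord2P i) => ->; case: (ord2P j) => ->;
  by rewrite ?e1 ?e2 ?e3 ?e4 ?cabsN opn_entry.
Qed.

Definition wdg (x y x' y' : C) := x * y' - y * x'.

(** Up to sign, the entries of [A *m adj2 B] are the wedges of a row of [A] with a row of [B]. *)
Lemma wdg_le A B i j : cabs (wdg (A i i0) (A i i1) (B j i0) (B j i1)) <= opnorm (A *m adj2 B).
Proof.
have [e1 e2 e3 e4] := adj2E B.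
case: (ord2P j) => ->.
  apply: le_trans (opn_entry _ i i1); rewrite mulmx2 e2 e4 -cabsN.
  by rewrite (_ : - wdg _ _ _ _ = A i i0 * - B i0 i1 + A i i1 * B i0 i0)// /wdg; ring.
apply: le_trans (opn_entry _ i i0); rewrite mulmx2 e1 e3.
by rewrite (_ : wdg _ _ _ _ = A i i0 * B i1 i1 + A i i1 * - B i1 i0)// /wdg; ring.
Qed.

Lemma opn_wdg A B : exists i j,
  opnorm (A *m adj2 B) <= 2 * cabs (wdg (A i i0) (A i i1) (B j i0) (B j i1)).
Proof.
have [e1 e2 e3 e4] := adj2E B.
have [i [j H]] := opn_ex (A *m adj2 B).
case: (ord2P j) H => -> H.
  exists i, i1; move: H; rewrite mulmx2 e1 e3.
  by rewrite (_ : wdg _ _ _ _ = A i i0 * B i1 i1 + A i i1 * - B i1 i0)// /wdg; ring.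
exists i, i0; move: H; rewrite mulmx2 e2 e4 -[cabs (wdg _ _ _ _)]cabsN.
by rewrite (_ : - wdg _ _ _ _ = A i i0 * - B i0 i1 + A i i1 * B i0 i0)// /wdg; ring.
Qed.

(** Three vectors in the plane satisfy [(u ^ w) v = (u ^ v) w + (v ^ w) u]; here they are rows of
    the three matrices. The 4 comes from passing twice from a norm to a large entry. Logarithms turn
    this into the four-point inequality. *)
Lemma pluecker A B K : opnorm (A *m adj2 K) * opnorm B <=
  4 * (opnorm (A *m adj2 B) * opnorm K + opnorm A * opnorm (B *m adj2 K)).
Proof.
have [i [j H1]] := opn_wdg A K; have [k [n H2]] := opn_ex B.
have key : cabs (wdg (A i i0) (A i i1) (K j i0) (K j i1)) * cabs (B k n) <=
    opnorm (A *m adj2 B) * opnorm K + opnorm A * opnorm (B *m adj2 K).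
  rewrite -cabsM.
  have -> : wdg (A i i0) (A i i1) (K j i0) (K j i1) * B k n =
    wdg (A i i0) (A i i1) (B k i0) (B k i1) * K j n +
    A i n * wdg (B k i0) (B k i1) (K j i0) (K j i1).
    by case: (ord2P n) => ->; rewrite /wdg; ring.
  apply: le_trans (cabsD _ _) _; rewrite !cabsM; apply: lerD; apply: ler_pM;
    by rewrite ?cabs_ge0 ?wdg_le ?opn_entry.
apply: le_trans (ler_pM (opn_ge0 _) (opn_ge0 _) H1 H2) _.
move: key; set X := cabs (wdg _ _ _ _); set Y := cabs (B k n) => key.
have -> : 2 * X * (2 * Y) = 4 * (X * Y) by ring.
by rewrite ler_pM2l.
Qed.

Definition vn p q : R := Num.max (cabs p) (cabs q).

Lemma vn_ge0 p q : 0 <= vn p q. Proof. by rewrite le_max cabs_ge0. Qed.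

Lemma vn_mul A p q :
  vn (A i0 i0 * p + A i0 i1 * q) (A i1 i0 * p + A i1 i1 * q) <= opnorm A * vn p q.
Proof.
have H i : cabs (A i i0 * p + A i i1 * q) <= opnorm A * vn p q.
  apply: le_trans (cabsD _ _) _; rewrite !cabsM.
  have pv : cabs p <= vn p q by rewrite le_max lexx.
  have qv : cabs q <= vn p q by rewrite le_max lexx orbT.
  apply: le_trans (ler_wpM2r (vn_ge0 p q) (opn_row A i)).
  by rewrite mulrDl; apply: lerD; rewrite ler_wpM2l// cabs_ge0.
by rewrite {1}/vn ge_max !H.
Qed.

Definition app1 A p q := A i0 i0 * p + A i0 i1 * q.
Definition app2 A p q := A i1 i0 * p + A i1 i1 * q.
Definition vnA A p q := vn (app1 A p q) (app2 A p q).

Lemma vnA_ge A i p q : cabs (A i i0 * p + A i i1 * q) <= vnA A p q.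
Proof. by rewrite /vnA /vn le_max; case: (ord2P i) => ->; rewrite lexx ?orbT. Qed.

(* Two matrices that both contract [(p, q)] have aligned rows. *)
Lemma contract_pair A B p q :
  vn p q * opnorm (A *m adj2 B) <= 2 * (vnA A p q * opnorm B + vnA B p q * opnorm A).
Proof.
have [i [j H]] := opn_wdg A B.
have key : vn p q * cabs (wdg (A i i0) (A i i1) (B j i0) (B j i1)) <=
    vnA A p q * opnorm B + vnA B p q * opnorm A.
  have tr (x y : C) : cabs (x - y) <= cabs x + cabs y.
    by apply: le_trans (cabsD _ _) _; rewrite cabsN.
  have v0 B' : 0 <= vnA B' p q by exact: vn_ge0.
  rewrite /vn; case: (leP (cabs p) (cabs q)) => _; rewrite -cabsM.
    have -> : q * wdg (A i i0) (A i i1) (B j i0) (B j i1) =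
      (B j i0 * p + B j i1 * q) * A i i0 - (A i i0 * p + A i i1 * q) * B j i0.
      by rewrite /wdg; ring.
    apply: le_trans (tr _ _) _; rewrite !cabsM addrC.
    by apply: lerD; apply: ler_pM; rewrite ?cabs_ge0 ?vnA_ge ?opn_entry.
  have -> : p * wdg (A i i0) (A i i1) (B j i0) (B j i1) =
      (A i i0 * p + A i i1 * q) * B j i1 - (B j i0 * p + B j i1 * q) * A i i1.
    by rewrite /wdg; ring.
  apply: le_trans (tr _ _) _; rewrite !cabsM.
  by apply: lerD; apply: ler_pM; rewrite ?cabs_ge0 ?vnA_ge ?opn_entry.
apply: le_trans (ler_wpM2l (vn_ge0 p q) H) _.
by rewrite mulrCA ler_pM2l.
Qed.

End TwoByTwo.

(** * Commutators and common eigenlines *)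

Section Commutator.
Variable R : realType.
Local Notation C := R[i].
Local Notation i0 := (ord0 : 'I_2).
Local Notation i1 := (ord_max : 'I_2).
Implicit Types (A B V H : 'M[C]_2) (p q : C).

(** For two-by-two complex matrices this vanishes exactly when they have a common eigenvector. *)
Definition detcomm V H := \det (V *m H - H *m V).

Definition dc4 (v1 v2 v3 v4 h1 h2 h3 h4 : C) :=
  - (v2 * h3 - v3 * h2) ^+ 2 -
  (v1 * h2 + v2 * h4 - h1 * v2 - h2 * v4) * (v3 * h1 + v4 * h3 - h3 * v1 - h4 * v3).

Lemma detcommE V H : detcomm V H =
  dc4 (V i0 i0) (V i0 i1) (V i1 i0) (V i1 i1) (H i0 i0) (H i0 i1) (H i1 i0) (H i1 i1).
Proof.
rewrite /detcomm det2.
have E i j : (V *m H - H *m V) i j =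
  V i i0 * H i0 j + V i i1 * H i1 j - (H i i0 * V i0 j + H i i1 * V i1 j).
  by rewrite mxE mulmx2; congr (_ + _); rewrite mxE mulmx2.
by rewrite !E /dc4; ring.
Qed.

Lemma dc4_swap v1 v2 v3 v4 h1 h2 h3 h4 :
  dc4 v4 v3 v2 v1 h4 h3 h2 h1 = dc4 v1 v2 v3 v4 h1 h2 h3 h4.
Proof. by rewrite /dc4; ring. Qed.

(* The row [(p, q)] moved by the matrix, wedged with itself. *)
Definition al (v1 v2 v3 v4 p q : C) := (p * v1 + q * v3) * q - (p * v2 + q * v4) * p.

(** If the row [(p, q)] is an eigenvector of both matrices, both [al] vanish, and so does [dc4]. The
    identity [id] quantifies this by writing [p ^+ 3 * dc4] as a combination of the two [al]. The
    constant is [14 = 2 + 12], from its two products. *)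
Lemma dc4_bound v1 v2 v3 v4 h1 h2 h3 h4 p q (v h : R) :
  cabs q <= cabs p ->
  [/\ cabs v1 <= v, cabs v2 <= v, cabs v3 <= v & cabs v4 <= v] ->
  [/\ cabs h1 <= h, cabs h2 <= h, cabs h3 <= h & cabs h4 <= h] ->
  cabs p ^+ 2 * cabs (dc4 v1 v2 v3 v4 h1 h2 h3 h4) <=
  14 * (v * h) * (h * cabs (al v1 v2 v3 v4 p q) + v * cabs (al h1 h2 h3 h4 p q)).
Proof.
move=> qp [V1 V2 V3 V4] [H1 H2 H3 H4].
set a := al v1 v2 v3 v4 p q; set b := al h1 h2 h3 h4 p q.
have v0 : 0 <= v := le_trans (cabs_ge0 _) V1.
have h0 : 0 <= h := le_trans (cabs_ge0 _) H1.
have a0 := cabs_ge0 a; have b0 := cabs_ge0 b; have p0 := cabs_ge0 p.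
have [p00|pn0] := eqVneq p 0.
  rewrite p00 cabs0 expr0n /= mul0r.
  by rewrite !mulr_ge0// addr_ge0// mulr_ge0.
have pp : 0 < cabs p by rewrite cabs_gt0.
rewrite -(ler_pM2l pp).
pose x := v2 * h3 - v3 * h2.
pose z := v3 * h1 + v4 * h3 - h3 * v1 - h4 * v3.
have id : p * (p ^+ 2 * dc4 v1 v2 v3 v4 h1 h2 h3 h4) =
   p * (a * h3 - b * v3) * x +
   ((p * v1 + q * v3) * b + p * a * h4 - (p * h1 + q * h3) * a - p * b * v4) * z.
  by rewrite /a /b /al /x /z /dc4; ring.
have m2 (s t : C) (S T : R) : cabs s <= S -> cabs t <= T -> cabs (s * t) <= S * T.
  by move=> ? ?; rewrite cabsM ler_pM// cabs_ge0.
have d2 (s t : C) (S T : R) : cabs s <= S -> cabs t <= T -> cabs (s + t) <= S + T.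
  by move=> ? ?; apply: le_trans (cabsD _ _) (lerD _ _).
have s2 (s t : C) (S T : R) : cabs s <= S -> cabs t <= T -> cabs (s - t) <= S + T.
  by move=> ? ?; apply: d2 => //; rewrite cabsN.
have lp : cabs p <= cabs p by []. have la : cabs a <= cabs a by []. have lb : cabs b <= cabs b by [].
have Ex : cabs x <= v * h + v * h by apply: s2; exact: m2.
have Ez : cabs z <= v * h + v * h + h * v + h * v.
  by apply: (s2); [apply: (s2); [apply: (d2)|]|]; exact: (m2).
have E1 := m2 _ _ _ _ (m2 _ _ _ _ lp (s2 _ _ _ _ (m2 _ _ _ _ la H3) (m2 _ _ _ _ lb V3))) Ex.
have E2a := m2 _ _ _ _ (d2 _ _ _ _ (m2 _ _ _ _ lp V1) (m2 _ _ _ _ qp V3)) lb.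
have E2b := m2 _ _ _ _ (m2 _ _ _ _ lp la) H4.
have E2c := m2 _ _ _ _ (d2 _ _ _ _ (m2 _ _ _ _ lp H1) (m2 _ _ _ _ qp H3)) la.
have E2d := m2 _ _ _ _ (m2 _ _ _ _ lp lb) V4.
have E2 := m2 _ _ _ _ (s2 _ _ _ _ (s2 _ _ _ _ (d2 _ _ _ _ E2a E2b) E2c) E2d) Ez.
rewrite -cabsX -!cabsM id; apply: le_trans (d2 _ _ _ _ E1 E2) _.
rewrite le_eqVlt; apply/orP; left; apply/eqP; ring.
Qed.

(** Take for [(p, q)] a row of [A] with an entry of modulus at least [opnorm A / 2]. The quantity
    [al] for [V] is a wedge of rows of [A *m V] and [A], hence bounded by the norm of the conjugate.
    The comparison of [opnorm A ^+ 2] with the entry gives [56 = 4 * 14]. *)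
Lemma commutator_bound A V H :
  opnorm A ^+ 2 * cabs (detcomm V H) <= 56 * (opnorm V * opnorm H) *
  (opnorm H * opnorm (A *m V *m adj2 A) + opnorm V * opnorm (A *m H *m adj2 A)).
Proof.
have [i [j Hj]] := opn_ex A.
pose p : C := A i i0; pose q : C := A i i1.
have alE (X : 'M[C]_2) : cabs (al (X i0 i0) (X i0 i1) (X i1 i0) (X i1 i1) p q) <= opnorm (A *m X *m adj2 A).
  have := wdg_le (A *m X) A i i; rewrite !mulmx2 -/p -/q; apply: le_trans.
  by rewrite /wdg /al.
have al_sw v1 v2 v3 v4 : cabs (al v4 v3 v2 v1 q p) = cabs (al v1 v2 v3 v4 p q).
  by rewrite -cabsN; congr cabs; rewrite /al; ring.
have oe (X : 'M[C]_2) : [/\ cabs (X i0 i0) <= opnorm X, cabs (X i0 i1) <= opnorm X,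
  cabs (X i1 i0) <= opnorm X & cabs (X i1 i1) <= opnorm X] by split; exact: opn_entry.
have oe' (X : 'M[C]_2) : [/\ cabs (X i1 i1) <= opnorm X, cabs (X i1 i0) <= opnorm X,
  cabs (X i0 i1) <= opnorm X & cabs (X i0 i0) <= opnorm X] by split; exact: opn_entry.
have V0 := opn_ge0 V; have H0 := opn_ge0 H.
pose RH := 14 * (opnorm V * opnorm H) *
  (opnorm H * opnorm (A *m V *m adj2 A) + opnorm V * opnorm (A *m H *m adj2 A)).
have key r : (r = p \/ r = q) -> vn p q = cabs r -> cabs r ^+ 2 * cabs (detcomm V H) <= RH.
  have fin (x y : R) : x <= opnorm (A *m V *m adj2 A) -> y <= opnorm (A *m H *m adj2 A) ->
      14 * (opnorm V * opnorm H) * (opnorm H * x + opnorm V * y) <= RH.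
    move=> hx hy; apply: ler_wpM2l; first by rewrite !mulr_ge0.
    by apply: lerD; rewrite ler_wpM2l.
  move=> [->|->] vE; rewrite detcommE.
    have qp : cabs q <= cabs p by rewrite -vE le_max lexx orbT.
    apply: le_trans (dc4_bound qp (oe V) (oe H)) (fin _ _ (alE V) (alE H)).
  have qp : cabs p <= cabs q by rewrite -vE le_max lexx.
  rewrite -dc4_swap; apply: le_trans (dc4_bound qp (oe' V) (oe' H)) _.
  by rewrite !al_sw; apply: fin.
have [r rE vr] : exists2 r, (r = p \/ r = q) & vn p q = cabs r.
  by rewrite /vn; case: (leP (cabs p) (cabs q)) => _; [exists q; [right|]|exists p; [left|]].
have := key r rE vr.
have Ar : opnorm A <= 2 * cabs r.
  apply: le_trans Hj _; rewrite ler_pM2l// -vr le_max.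
  by case: (ord2P j) => ->; rewrite lexx ?orbT.
have A2 : opnorm A ^+ 2 <= 4 * cabs r ^+ 2.
  have -> : 4 * cabs r ^+ 2 = (2 * cabs r) ^+ 2 by ring.
  by rewrite lerXn2r// ?nnegrE ?opn_ge0// mulr_ge0// cabs_ge0.
move=> K; apply: le_trans (ler_wpM2r (cabs_ge0 _) A2) _.
have -> : 56 * (opnorm V * opnorm H) * (opnorm H * opnorm (A *m V *m adj2 A) +
    opnorm V * opnorm (A *m H *m adj2 A)) = 4 * RH by rewrite /RH; ring.
by rewrite -mulrA ler_pM2l.
Qed.

(** A non-scalar [A] has at most two eigenlines, [v1] and [v2], possibly equal. Up to a nonzero
    factor, [detcomm A B] is the product of the two expressions that test whether [B] preserves
    them. *)
Lemma common_line A : ~ (A i0 i1 = 0 /\ A i1 i0 = 0 /\ A i0 i0 = A i1 i1) ->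
  exists v1 v2 : C * C, [/\ v1 != (0, 0), v2 != (0, 0) &
    forall B, detcomm A B = 0 ->
      app1 B v1.1 v1.2 * v1.2 = app2 B v1.1 v1.2 * v1.1 \/
      app1 B v2.1 v2.2 * v2.2 = app2 B v2.1 v2.2 * v2.1].
Proof.
set a := A i0 i0; set b := A i0 i1; set c := A i1 i0; set d := A i1 i1 => nsc.
pose s := sqrtC ((a - d) ^+ 2 + 4 * b * c).
have s2 : s ^+ 2 = (a - d) ^+ 2 + 4 * b * c by rewrite sqrtCK.
have n10 : (1 : C) != 0 by rewrite oner_eq0.
have [c0|cn0] := eqVneq c 0; last first.
  exists ((a - d + s) / (2 * c), 1), ((a - d - s) / (2 * c), 1).
  split; rewrite ?xpair_eqE ?(negPf n10) ?andbF// => B /=.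
  set e := B i0 i0; set f := B i0 i1; set g := B i1 i0; set h := B i1 i1.
  rewrite detcommE -/a -/b -/c -/d -/e -/f -/g -/h => D0.
  pose u x := app1 B x 1 * 1 - app2 B x 1 * x.
  have : u ((a - d + s) / (2 * c)) * u ((a - d - s) / (2 * c)) = 0.
    have -> : u ((a - d + s) / (2 * c)) * u ((a - d - s) / (2 * c)) =
      - dc4 a b c d e f g h / c ^+ 2.
      rewrite /u /app1 /app2 /dc4 -/e -/f -/g -/h; field: s2; rewrite cn0//.
    by rewrite D0 oppr0 mul0r.
  by move/eqP; rewrite mulf_eq0 => /orP[] /eqP/eqP; rewrite subr_eq0 => /eqP; [left|right].
have [b0|bn0] := eqVneq b 0.
  exists (1, 0), (0, 1); split; rewrite ?xpair_eqE ?(negPf n10) ?andbF// => B /=.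
  rewrite detcommE -/a -/b -/c -/d b0 c0.
  have ad : a - d != 0 by apply/eqP => /eqP; rewrite subr_eq0 => /eqP ad; apply: nsc.
  have -> : dc4 a 0 0 d (B i0 i0) (B i0 i1) (B i1 i0) (B i1 i1) =
    (a - d) ^+ 2 * (B i0 i1 * B i1 i0) by rewrite /dc4; ring.
  move/eqP; rewrite mulf_eq0 expf_eq0 (negPf ad) andbF /= mulf_eq0 => /orP[] /eqP h.
    by right; rewrite /app1 /app2 h; ring.
  by left; rewrite /app1 /app2 h; ring.
exists (1, 0), (b, d - a); split; rewrite ?xpair_eqE ?(negPf n10) ?(negPf bn0) ?andbF// => B /=.
rewrite detcommE -/a -/b -/c -/d c0.
have -> : dc4 a b 0 d (B i0 i0) (B i0 i1) (B i1 i0) (B i1 i1) =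
   B i1 i0 * (app1 B b (d - a) * (d - a) - app2 B b (d - a) * b).
  by rewrite /dc4 /app1 /app2; ring.
move/eqP; rewrite mulf_eq0 => /orP[] /eqP h.
  by left; rewrite /app1 /app2 h; ring.
by right; apply/eqP; rewrite -subr_eq0 h.
Qed.

(** In the basis [(p, q)], [(0, 1)] both matrices are upper triangular, the primed one with diagonal
    [mu], [1 / mu]. The second column of the product is thus [la] times an entry of the second
    matrix plus an entry of the first over [mu]; the eigenvector equation then yields the first
    column. The condition [cabs q <= cabs p] makes the constants independent of the line. *)
Lemma triangular_bound a b c d a' b' c' d' p q (la mu : C) (n n' : R) :
  cabs q <= cabs p -> p != 0 -> mu != 0 ->
  a * p + b * q = la * p -> c * p + d * q = la * q ->
  a' * p + b' * q = mu * p -> c' * p + d' * q = mu * q ->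
  a' * d' - b' * c' = 1 ->
  [/\ cabs a <= n, cabs b <= n, cabs c <= n & cabs d <= n] ->
  [/\ cabs a' <= n', cabs b' <= n', cabs c' <= n' & cabs d' <= n'] ->
  cabs mu <= n' ->
  let X := 2 * (cabs la * n') + n / cabs mu in
  [/\ cabs (a * a' + b * c') <= X, cabs (a * b' + b * d') <= X,
      cabs (c * a' + d * c') <= X & cabs (c * b' + d * d') <= X].
Proof.
move=> qp p0 mu0 e1 e2 e3 e4 dt [A1 A2 A3 A4] [B1 B2 B3 B4] mn X.
have pp : 0 < cabs p by rewrite cabs_gt0.
have mp : 0 < cabs mu by rewrite cabs_gt0.
have l0 := cabs_ge0 la; have n0 : 0 <= n := le_trans (cabs_ge0 _) A1.
have n'0 : 0 <= n' := le_trans (cabs_ge0 _) B1.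
(* This identifies [(p * d' - q * b') / p] as the second eigenvalue [1 / mu], through the
   determinant. *)
have k1 : (p * d' - q * b') * mu = p.
  have -> : (p * d' - q * b') * mu = d' * (mu * p) - b' * (mu * q) by ring.
  rewrite -e3 -e4.
  have -> : d' * (a' * p + b' * q) - b' * (c' * p + d' * q) = (a' * d' - b' * c') * p by ring.
  by rewrite dt mul1r.
have kk : cabs (p * d' - q * b') = cabs p / cabs mu.
  by rewrite -{2}k1 cabsM mulfK// gt_eqF.
pose X0 := cabs la * n' + n / cabs mu.
have gen (x y z : C) : cabs y <= cabs p -> cabs z <= n ->
    p * x = b' * (la * y) + (p * d' - q * b') * z -> cabs x <= X0.
  move=> yp zn E; rewrite -(ler_pM2l pp) -cabsM E.
  apply: le_trans (cabsD _ _) _; rewrite !cabsM kk /X0 mulrDr; apply: lerD.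
    rewrite mulrCA [leRHS]mulrCA; apply: ler_wpM2l => //.
    by rewrite [leRHS]mulrC; apply: ler_pM; rewrite ?cabs_ge0.
  rewrite -mulrA; apply: ler_wpM2l; first exact: ltW.
  by rewrite mulrC ler_wpM2r// invr_ge0 ltW.
have F2 : cabs (a * b' + b * d') <= X0.
  apply: (gen _ p b) => //; rewrite -e1; ring.
have F4 : cabs (c * b' + d * d') <= X0.
  apply: (gen _ q d) => //; rewrite -e2; ring.
have lm : cabs la * cabs mu <= cabs la * n' by rewrite ler_wpM2l.
have gen2 (x y z : C) : cabs z <= cabs p -> cabs y <= X0 -> x * p + y * q = la * mu * z -> cabs x <= X.
  move=> zp yX E; rewrite -(ler_pM2r pp) -cabsM.
  have -> : x * p = la * mu * z - y * q by rewrite -E; ring.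
  apply: le_trans (cabsD _ _) _; rewrite cabsN !cabsM.
  apply: le_trans (lerD (ler_wpM2l (mulr_ge0 l0 (cabs_ge0 mu)) zp)
     (ler_pM (cabs_ge0 _) (cabs_ge0 _) yX qp)) _.
  by rewrite -mulrDl ler_pM2r// /X /X0; lra.
have X0X : X0 <= X by rewrite /X /X0; have := mulr_ge0 l0 n'0; lra.
split; [|exact: le_trans F2 X0X| |exact: le_trans F4 X0X].
- apply: (gen2 _ _ p) F2 _ => //.
  have -> : (a * a' + b * c') * p + (a * b' + b * d') * q =
    a * (a' * p + b' * q) + b * (c' * p + d' * q) by ring.
  rewrite e3 e4; have -> : a * (mu * p) + b * (mu * q) = mu * (a * p + b * q) by ring.
  by rewrite e1; ring.
- apply: (gen2 _ _ q) F4 _ => //.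
  have -> : (c * a' + d * c') * p + (c * b' + d * d') * q =
    c * (a' * p + b' * q) + d * (c' * p + d' * q) by ring.
  rewrite e3 e4; have -> : c * (mu * p) + d * (mu * q) = mu * (c * p + d * q) by ring.
  by rewrite e2; ring.
Qed.

Lemma triangular_product A B p q (la mu : C) : (p, q) != (0, 0) -> \det B = 1 ->
  app1 A p q = la * p -> app2 A p q = la * q ->
  app1 B p q = mu * p -> app2 B p q = mu * q -> mu != 0 ->
  cabs mu <= opnorm B ->
  opnorm (A *m B) <= 4 * (cabs la * opnorm B) + 2 * (opnorm A / cabs mu).
Proof.
move=> pq dB e1 e2 e3 e4 mu0 mn; rewrite det2 in dB.
pose X := 2 * (cabs la * opnorm B) + opnorm A / cabs mu.
suff H i j : cabs ((A *m B) i j) <= X.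
  by apply: le_trans (opn_le H) _; rewrite /X; lra.
have [qp|pq'] := leP (cabs q) (cabs p).
  have p0 : p != 0.
    apply: contraNneq pq => p0; rewrite xpair_eqE p0 eqxx /= -cabs_eq0 eq_le cabs_ge0 andbT.
    by move: qp; rewrite p0 cabs0.
  have [] := @triangular_bound _ _ _ _ _ _ _ _ _ _ _ _ (opnorm A) (opnorm B)
     qp p0 mu0 e1 e2 e3 e4 dB _ _ mn; try by split; exact: opn_entry.
  by move=> t1 t2 t3 t4; case: (ord2P i) => ->; case: (ord2P j) => ->; rewrite mulmx2.
have q0 : q != 0 by rewrite -cabs_gt0; apply: le_lt_trans pq'; exact: cabs_ge0.
have sw (x y z t : C) : x * y + z * t = z * t + x * y by rewrite addrC.
move: e1 e2 e3 e4; rewrite /app1 /app2 => e1 e2 e3 e4.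
rewrite addrC in e1; rewrite addrC in e2; rewrite addrC in e3; rewrite addrC in e4.
have dB' : B i1 i1 * B i0 i0 - B i1 i0 * B i0 i1 = 1 by rewrite -dB; ring.
have [] := @triangular_bound _ _ _ _ _ _ _ _ _ _ _ _ (opnorm A) (opnorm B)
     (ltW pq') q0 mu0 e2 e1 e4 e3 dB' _ _ mn; try by split; exact: opn_entry.
by move=> t1 t2 t3 t4; case: (ord2P i) => ->; case: (ord2P j) => ->; rewrite mulmx2 addrC.
Qed.

End Commutator.

(** * Degeneration of the representation *)

Section NearZero.
Variable R : realType.
Local Notation C := R[i].

Lemma dnbhs0P (P : C -> Prop) : (\forall t \near dnbhs (0 : C), P t) <->
  exists2 d : R, 0 < d & forall t, t != 0 -> cabs t < d -> P t.
Proof.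
split.
  move=> /nbhs_cabsP[d d0 H]; exists d => // t t0 td; apply: H => //.
  by rewrite subr0.
move=> [d d0 H]; apply/nbhs_cabsP; exists d => // t; rewrite subr0 => td t0; exact: H.
Qed.

Definition Lt (t : C) : R := ln (cabs t)^-1.

Lemma Lt_gt0 t : t != 0 -> cabs t < 1 -> 0 < Lt t.
Proof. by move=> t0 t1; apply: ln_gt0; rewrite invf_gt1// cabs_gt0. Qed.

Lemma near_Lt (B : R) : \forall t \near dnbhs (0 : C), B <= Lt t.
Proof.
apply/dnbhs0P; exists (expR (- B)); first exact: expR_gt0.
move=> t t0 td; rewrite /Lt -ler_expR lnK ?posrE ?invr_gt0 ?cabs_gt0//.
by rewrite -[expR B]invrK -expRN lef_pV2 ?posrE ?expR_gt0 ?cabs_gt0// ltW.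
Qed.

Lemma near_pdisk : \forall t \near dnbhs (0 : C), cpdisk t.
Proof. by apply/dnbhs0P; exists 1 => // t t0 t1; split. Qed.

Lemma near_small (d : R) : 0 < d -> \forall t \near dnbhs (0 : C), cabs t < d.
Proof. by move=> d0; apply/dnbhs0P; exists d. Qed.

Lemma divLt_cvg0 (c : R) : c / Lt t @[t --> dnbhs (0 : C)] --> (0 : R).
Proof.
apply/cvgrPdist_le => /= e e0.
near=> t.
have tL : `|c| / e + 1 <= Lt t by near: t; exact: near_Lt.
have L0 : 0 < Lt t by apply: lt_le_trans tL; rewrite ltr_pwDr// divr_ge0// ltW.
rewrite sub0r normrN normrM normfV [`|Lt t|]gtr0_norm// ler_pdivrMr//.
have : `|c| / e <= Lt t by lra.
by rewrite ler_pdivrMr// mulrC.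
Unshelve. all: by end_near. Qed.

(** Multiplicative constants between norms become [c / Lt t] after logarithms and division, and
    disappear in the limit. *)
Lemma lim_le (f g : C -> R) (a b c : R) :
  f t @[t --> dnbhs (0 : C)] --> a -> g t @[t --> dnbhs (0 : C)] --> b ->
  (\forall t \near dnbhs (0 : C), f t <= g t + c / Lt t) -> a <= b.
Proof.
move=> fa gb H.
have gc : (g t + c / Lt t) @[t --> dnbhs (0 : C)] --> b + 0.
  by apply: cvgD => //; exact: divLt_cvg0.
rewrite addr0 in gc.
exact: (ler_cvg_to fa gc H).
Qed.

Lemma ln_pow_bound (t : C) (x c : R) (k : nat) : t != 0 -> 0 < c -> 0 < x ->
  (x <= c / cabs t ^+ k -> ln x <= k%:R * Lt t + ln c) /\
  (c / cabs t ^+ k <= x -> k%:R * Lt t + ln c <= ln x).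
Proof.
move=> t0 c0 x0; have tp : 0 < cabs t by rewrite cabs_gt0.
have E : ln (c / cabs t ^+ k) = k%:R * Lt t + ln c.
  rewrite lnM ?posrE ?invr_gt0 ?exprn_gt0// addrC; congr (_ + _).
  by rewrite -exprVn lnXn ?invr_gt0// mulr_natl.
have p0 : 0 < c / cabs t ^+ k by rewrite divr_gt0// exprn_gt0.
by split=> h; rewrite -E ler_ln ?posrE.
Qed.

Lemma holX k : hol (fun z : C => z ^+ k).
Proof. by move=> z _; apply: cdiffX; exact: cdiff_id. Qed.
Lemma holM (f g : C -> C) : hol f -> hol g -> hol (fun z : C => f z * g z).
Proof. by move=> hf hg z zD; apply: cdiffM; [exact: hf|exact: hg]. Qed.
Lemma holD (f g : C -> C) : hol f -> hol g -> hol (fun z : C => f z + g z).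
Proof. by move=> hf hg z zD; apply: cdiffD; [exact: hf|exact: hg]. Qed.
Lemma holN (f : C -> C) : hol f -> hol (fun z : C => - f z).
Proof. by move=> hf z zD; apply: cdiffN; exact: hf. Qed.
Lemma holB (f g : C -> C) : hol f -> hol g -> hol (fun z : C => f z - g z).
Proof. by move=> hf hg; apply: holD => //; exact: holN. Qed.

Lemma holo_hol (f : C -> C) : holo_on (@cdisk R) f <-> hol f.
Proof. by rewrite holo_onP. Qed.

Lemma hol_near_le (f : C -> C) (c : R) : hol f -> cabs (f 0) < c ->
  \forall t \near dnbhs (0 : C), cabs (f t) <= c.
Proof.
move=> hf fc; have cf := cdiff_cts (hf 0 ltac:(by rewrite cabs0)).
have [d d0 H] := cf (c - cabs (f 0)) ltac:(by lra).
apply/dnbhs0P; exists d => // t _ td; have := H t; rewrite subr0 => /(_ td) h.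
by have := cabsD (f t - f 0) (f 0); rewrite subrK; lra.
Qed.

Lemma hol_near_ge (f : C -> C) : hol f -> f 0 != 0 ->
  \forall t \near dnbhs (0 : C), cabs (f 0) / 2 <= cabs (f t).
Proof.
move=> hf; rewrite -cabs_gt0 => f0; have cf := cdiff_cts (hf 0 ltac:(by rewrite cabs0)).
have [d d0 H] := cf (cabs (f 0) / 2) ltac:(by lra).
apply/dnbhs0P; exists d => // t _ td; have := H t; rewrite subr0 => /(_ td) h.
by have := cabsD (f 0 - f t) (f t); rewrite subrK cabsB; lra.
Qed.

End NearZero.

(** * Pole orders and norms near the puncture *)

Section Rep.
Variables (R : realType) (G : groupType) (rho : G -> 'I_2 -> 'I_2 -> R[i] -> R[i]).
Local Notation C := R[i].
Local Notation "x ** y" := (@monoid.mul G x y) (at level 40, left associativity).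
Local Notation e1 := (@monoid.one G).
Local Notation "x ^v" := (@monoid.inv G x) (at level 3, format "x ^v").
Local Notation M := (eval_rep rho).
Hypothesis hrho : is_SL2M_hom rho.
Implicit Types (g h : G) (t : C).

Lemma M_det t g : cpdisk t -> \det (M t g) = 1.
Proof. by case: hrho => _ H _; exact: H. Qed.

Lemma M_mul t g h : cpdisk t -> M t (g ** h) = M t g *m M t h.
Proof. by case: hrho => _ _ H; exact: H. Qed.

Lemma M_adj t g : cpdisk t -> adj2 (M t g) *m M t g = 1%:M.
Proof. by move=> /(M_det g) /mul_adj2. Qed.

Lemma M_one t : cpdisk t -> M t e1 = 1%:M.
Proof.
move=> tD; transitivity (adj2 (M t e1) *m (M t e1 *m M t e1)).
  by rewrite mulmxA M_adj// mul1mx.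
by rewrite -M_mul// mulg1 M_adj.
Qed.

Lemma M_inv t g : cpdisk t -> M t (g^v) = adj2 (M t g).
Proof.
move=> tD; rewrite -[RHS]mulmx1 -(M_one tD) -(mulgV g) M_mul// mulmxA M_adj// mul1mx //.
Qed.

Lemma M_ge1 t g : cpdisk t -> 1 <= opnorm (M t g).
Proof. by move=> tD; apply: opn_ge1; exact: M_det. Qed.

Lemma M_gt0 t g : cpdisk t -> 0 < opnorm (M t g).
Proof. by move=> tD; apply: lt_le_trans (M_ge1 g tD). Qed.

Definition polar_le g (k : nat) := exists E : 'I_2 -> 'I_2 -> C -> C,
  (forall i j, hol (E i j)) /\ forall i j t, cpdisk t -> rho g i j t = E i j t / t ^+ k.

Lemma polar_ex g : exists k, polar_le g k.
Proof.
have [kf Hk] : {kf : 'I_2 -> 'I_2 -> nat & forall i j, exists E, hol E /\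
    forall t, cpdisk t -> rho g i j t = E t / t ^+ kf i j}.
  have H i j : exists k : nat, exists E, hol E /\ forall t, cpdisk t -> rho g i j t = E t / t ^+ k.
    case: hrho => /(_ g i j)[_ [k [E [hE HE]]]] _ _; exists k, E.
    by split => //; exact/holo_hol.
  by exists (fun i j => sval (cid (H i j))) => i j; case: (cid (H i j)).
pose k := (\sum_i \sum_j kf i j)%N.
have kk i j : (kf i j <= k)%N.
  by rewrite /k (bigD1 i)//= (bigD1 j)//= -addnA leq_addr.
exists k; exists (fun i j t => t ^+ (k - kf i j) * sval (cid (Hk i j)) t); split=> i j.
  by case: (cid _) => E [hE HE] /=; apply: holM => //; exact: holX.
move=> t tD; case: (cid _) => E [hE HE] /=; rewrite HE//.
have t0 : t != 0 by case: tD.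
rewrite -{2}(subnK (kk i j)) exprD; field.
by rewrite !expf_neq0.
Qed.

Lemma polar_leP g (k : nat) : polar_le g k <-> forall i j, ord_ge (rho g i j) (- k%:Z).
Proof.
split.
  move=> [E [hE HE]] i j; exists (E i j); split; first exact/holo_hol.
  by move=> t tD; rewrite HE// mulrC exprnN.
move=> H; exists (fun i j => sval (cid (H i j))); split=> i j.
  by case: (cid _) => E [hE HE] /=; exact/holo_hol.
move=> t tD; case: (cid _) => E [hE HE] /=; rewrite HE// mulrC; congr (_ * _).
by rewrite exprnN.
Qed.

Lemma dnbhs0_ex (P : C -> Prop) : (\forall t \near dnbhs (0 : C), P t) -> exists t, P t.
Proof.
move=> /dnbhs0P[d d0 H]; have d2 : 0 < d / 2 by rewrite divr_gt0.
exists (d / 2)%:C%C; apply: H; first by rewrite -cabs_gt0 cabs_real gtr0_norm.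
by rewrite cabs_real gtr0_norm//; lra.
Qed.

(** If all entries vanished at 0, the norm would drop below 1 near 0, against determinant 1.
    Negative pole orders are excluded in this way. *)
Lemma polar_small g (E : 'I_2 -> 'I_2 -> C -> C) : (forall i j, hol (E i j)) ->
  (forall i j t, cpdisk t -> rho g i j t = E i j t) -> exists i j, E i j 0 != 0.
Proof.
move=> hE HE; apply: contrapT => nH.
have E0 i j : E i j 0 = 0.
  by apply/eqP; apply: contraT => h; exfalso; apply: nH; exists i, j.
have : exists t, [/\ cpdisk t & forall i j, cabs (E i j t) <= 1 / 4].
  have key i j : \forall t \near dnbhs (0 : C), cabs (E i j t) <= 1 / 4.
    by apply: hol_near_le => //; rewrite E0 cabs0; lra.
  apply: dnbhs0_ex; near=> t; split; first by near: t; exact: near_pdisk.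
  move=> i j; case: (ord2P i) => ->; case: (ord2P j) => ->; near: t; exact: key.
move=> [t [tD Ht]].
have : opnorm (M t g) <= 2 * (1 / 4) by apply: opn_le => i j; rewrite mxE HE.
by have := M_ge1 g tD; lra.
Unshelve. all: by end_near. Qed.

(** [k] is the least pole order that serves all entries. By minimality and [hol_div] some numerator
    is nonzero at 0, and it bounds the norm from below. *)
Lemma nalog_asym g : exists k : nat, nalog rho g = k%:R /\
  exists c1 c2 : R, [/\ 0 < c1, 0 < c2 & \forall t \near dnbhs (0 : C),
    c1 / cabs t ^+ k <= opnorm (M t g) <= c2 / cabs t ^+ k].
Proof.
have [k0 Hk0] := polar_ex g.
have [k [Pk kmin]] : exists k, polar_le g k /\ forall k', polar_le g k' -> (k <= k')%N.
  have ex : exists k, `[< polar_le g k >] by exists k0; apply/asboolP.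
  case: (ex_minnP ex) => k /asboolP Pk kmin; exists k; split => // k' Pk'.
  by apply: kmin; apply/asboolP.
have [E [hE HE]] := Pk.
have [i [j Eij]] : exists i j, E i j 0 != 0.
  case: k kmin {Pk} HE => [|k] kmin HE.
    by apply: (@polar_small g) => // i j t tD; rewrite HE// expr0 divr1.
  apply: contrapT => nH.
  have E0 i j : E i j 0 = 0.
    by apply/eqP; apply: contraT => h; exfalso; apply: nH; exists i, j.
  have := kmin k; rewrite ltnn => /(_ _)/negP; apply; last by [].
  have dv i j : exists F, hol F /\ forall z, E i j z = z * F z.
    by have [F hF HF] := hol_div (hE i j) (E0 i j); exists F.
  exists (fun i j => sval (cid (dv i j))); split=> i j.
    by case: (cid _) => F [].
  move=> t tD; case: (cid _) => F [hF HF] /=; have t0 : t != 0 by case: tD.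
  by rewrite HE// HF exprS; field; rewrite expf_neq0.
exists k; split.
  (* The infimum ranges over all integers. Negative ones are ruled out by [polar_small], and among
     the others [k] is the least. *)
  rewrite /nalog; apply/eqP; rewrite eq_le; apply/andP; split.
    apply: ge_inf.
      exists 0 => _ [n [-> Hn]]; rewrite ler0z leNgt; apply/negP => n0.
      pose F  i' j' := sval (cid (Hn i' j')).
      have hF  i' j' : hol (F i' j') by rewrite /F; case: (cid _) => F' [h _] /=; exact/holo_hol.
      have HF  i' j' t : cpdisk t -> rho g  i' j' t = t ^ (- n) * F  i' j' t.
        by rewrite /F; case: (cid _) => F' [_ h] /=; exact: h.
      have [p nE] : exists p : nat, - n = p.+1%:Z.
        by case: n n0 {Hn F hF HF} => // p _; exists p; rewrite NegzE opprK.
      have [||i' [j']] := @polar_small g (fun i j t => t ^+ p.+1 * F i j t).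
      - by move=> ? ?; apply: holM => //; exact: holX.
      - by move=> ? ? t tD; rewrite HF// nE.
      - by rewrite expr0n /= mul0r eqxx.
    by exists k%:Z; split; [|exact/polar_leP].
  apply: lb_le_inf; first by exists k%:R, k%:Z; split; [|exact/polar_leP].
  move=> _ [n [-> Hn]]; have [n0|n0] := leP 0 n.
    case: n n0 Hn => // n _ Hn; rewrite -pmulrn ler_nat; apply: kmin; exact/polar_leP.
  exfalso.
  pose F  i' j' := sval (cid (Hn i' j')).
  have hF  i' j' : hol (F i' j') by rewrite /F; case: (cid _) => F' [h _] /=; exact/holo_hol.
  have HF  i' j' t : cpdisk t -> rho g  i' j' t = t ^ (- n) * F  i' j' t.
    by rewrite /F; case: (cid _) => F' [_ h] /=; exact: h.
  have [p nE] : exists p : nat, - n = p.+1%:Z.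
    by case: n n0 {Hn F hF HF} => // p _; exists p; rewrite NegzE opprK.
  have [||i' [j']] := @polar_small g (fun i j t => t ^+ p.+1 * F i j t).
  - by move=> ? ?; apply: holM => //; exact: holX.
  - by move=> ? ? t tD; rewrite HF// nE.
  - by rewrite expr0n /= mul0r eqxx.
pose B := \sum_i' \sum_j' (cabs (E i' j' 0) + 1).
have EB i' j' : cabs (E i' j' 0) < B.
  apply: lt_le_trans (_ : cabs (E i' j' 0) + 1 <= _); first by rewrite ltrDl.
  rewrite /B (bigD1 i')//= (bigD1 j')//= -addrA lerDl addr_ge0//.
    by apply: sumr_ge0 => ? _; rewrite addr_ge0// cabs_ge0.
  by apply: sumr_ge0 => ? _; apply: sumr_ge0 => ? _; rewrite addr_ge0// cabs_ge0.
have B0 : 0 < B by apply: le_lt_trans (EB i j); exact: cabs_ge0.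
exists (cabs (E i j 0) / 2), (2 * B); split.
- by rewrite divr_gt0// cabs_gt0.
- by rewrite mulr_gt0.
have key i' j' : \forall t \near dnbhs (0 : C), cabs (E i' j' t) <= B by exact: hol_near_le.
near=> t.
have tD : cpdisk t by near: t; exact: near_pdisk.
have t0 : 0 < cabs t by rewrite cabs_gt0; case: tD.
have tk : 0 <= (cabs t ^+ k)^-1 by rewrite invr_ge0 exprn_ge0// ltW.
have ent i' j' : cabs (M t g i' j') = cabs (E i' j' t) / cabs t ^+ k.
  by rewrite mxE HE// cabsM cabsV cabsX.
apply/andP; split.
  apply: le_trans (opn_entry _ i j); rewrite ent ler_wpM2r//.
  by near: t; exact: hol_near_ge.
rewrite -mulrA; apply: opn_le => i' j'; rewrite ent ler_wpM2r//.
by case: (ord2P i') => ->; case: (ord2P j') => ->; near: t; exact: key.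
Unshelve. all: by end_near. Qed.

Definition Nt t g : R := ln (opnorm (M t g)) / Lt t.

Lemma NtE t g : Nt t g = ln (opnorm (M t g)) / Lt t. Proof. by []. Qed.

Lemma Nt_ge0 t g : cpdisk t -> 0 <= Nt t g.
Proof.
move=> tD; case: (tD) => t1 t0; apply: divr_ge0; last exact/ltW/Lt_gt0.
by apply: ln_ge0; exact: M_ge1.
Qed.

Lemma Nt_mul t g h : cpdisk t -> Nt t (g ** h) <= Nt t g + Nt t h.
Proof.
move=> tD; case: (tD) => t1 t0; rewrite -mulrDl ler_pM2r ?invr_gt0 ?Lt_gt0//.
rewrite -lnM ?posrE ?M_gt0// ler_ln ?posrE ?M_gt0 ?mulr_gt0 ?M_gt0//.
by rewrite M_mul// opnM.
Qed.

Lemma Nt_one t : cpdisk t -> Nt t e1 = 0.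
Proof. by move=> tD; rewrite /Nt M_one// opn1 ln1 mul0r. Qed.

Lemma Nt_cvg g : Nt t g @[t --> dnbhs (0 : C)] --> nalog rho g.
Proof.
have [k [-> [c1 [c2 [c10 c20 H]]]]] := nalog_asym g.
have sq c : (k%:R + c / Lt t) @[t --> dnbhs (0 : C)] --> (k%:R : R).
  by have := cvgD (cvg_cst (k%:R : R)) (divLt_cvg0 c); rewrite addr0; apply.
apply: squeeze_cvgr (sq (ln c1)) (sq (ln c2)).
near=> t.
have tD : cpdisk t by near: t; exact: near_pdisk.
case: (tD) => t1 t0.
have L0 := Lt_gt0 t0 t1.
have /andP[h1 h2] : c1 / cabs t ^+ k <= opnorm (M t g) <= c2 / cabs t ^+ k by near: t.
have [_ b1] := ln_pow_bound k t0 c10 (M_gt0 g tD).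
have [b2 _] := ln_pow_bound k t0 c20 (M_gt0 g tD).
rewrite /Nt; apply/andP; split.
  by rewrite ler_pdivlMr// mulrDl divfK ?gt_eqF// b1.
by rewrite ler_pdivrMr// mulrDl divfK ?gt_eqF// b2.
Unshelve. all: by end_near. Qed.

End Rep.

Lemma cvg_maxr (R : realType) (I : Type) (F : set_system I) (FF : Filter F)
    (f g : I -> R) (a b : R) : f i @[i --> F] --> a -> g i @[i --> F] --> b ->
  Num.max (f i) (g i) @[i --> F] --> Num.max a b.
Proof.
move=> /cvgrPdist_le fa /cvgrPdist_le gb; apply/cvgrPdist_le => /= e e0.
have fe := fa e e0; have ge := gb e e0; near=> i.
have h1 : `|a - f i| <= e by near: i.
have h2 : `|b - g i| <= e by near: i.
move: h1 h2; rewrite !ler_norml.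
by case: (leP a b) => ?; case: (leP (f i) (g i)) => ? /andP[? ?] /andP[? ?]; apply/andP; split; lra.
Unshelve. all: by end_near. Qed.

(** * The limit length and the dichotomy for commutators *)

Section Rep2.
Variables (R : realType) (G : groupType) (rho : G -> 'I_2 -> 'I_2 -> R[i] -> R[i]).
Local Notation C := R[i].
Local Notation "x ** y" := (@monoid.mul G x y) (at level 40, left associativity).
Local Notation e1 := (@monoid.one G).
Local Notation "x ^v" := (@monoid.inv G x) (at level 3, format "x ^v").
Local Notation M := (eval_rep rho).
Local Notation Nt := (Nt rho).
Local Notation N := (nalog rho).
Hypothesis hrho : is_SL2M_hom rho.
Implicit Types (g h k : G) (t : C).

Let Mgt0 t g : cpdisk t -> 0 < opnorm (M t g) := M_gt0 hrho g (t := t).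

Lemma expNt t g : cpdisk t -> expR (Lt t * Nt t g) = opnorm (M t g).
Proof.
move=> tD; case: (tD) => t1 t0; rewrite NtE mulrC divfK ?gt_eqF ?Lt_gt0//.
by rewrite lnK// posrE Mgt0.
Qed.

Lemma le_of_expLt t (x y c : R) : cpdisk t -> 0 < c ->
  expR (Lt t * x) <= c * expR (Lt t * y) -> x <= y + ln c / Lt t.
Proof.
move=> [t1 t0] c0; have L0 := Lt_gt0 t0 t1.
have cE : c = expR (ln c) by rewrite lnK ?posrE.
rewrite {1}cE -expRD ler_expR => H.
by rewrite -(ler_pM2l L0) mulrDr [Lt t * (_ / _)]mulrC divfK ?gt_eqF//; lra.
Qed.

Lemma nalog_ge0 g : 0 <= N g.
Proof.
apply: (@lim_le _ (fun=> 0) (fun t => Nt t g) _ _ 0); [exact: cvg_cst|exact: Nt_cvg|].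
by apply: filterS (near_pdisk R) => t tD; rewrite mul0r addr0 Nt_ge0.
Qed.

Lemma nalog_mul g h : N (g ** h) <= N g + N h.
Proof.
apply: (@lim_le _ (fun t => Nt t (g ** h)) (fun t => Nt t g + Nt t h) _ _ 0).
- exact: Nt_cvg.
- by apply: cvgD; exact: Nt_cvg.
by apply: filterS (near_pdisk R) => t tD; rewrite mul0r addr0 Nt_mul.
Qed.

Lemma nalog_one : N e1 <= 0.
Proof.
apply: (@lim_le _ (fun t => Nt t e1) (fun=> 0) _ _ 0); [exact: Nt_cvg|exact: cvg_cst|].
by apply: filterS (near_pdisk R) => t tD; rewrite mul0r addr0 Nt_one.
Qed.

Lemma Nt_inv t g : cpdisk t -> Nt t (g^v) <= Nt t g + ln 2 / Lt t.
Proof.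
move=> tD; apply: le_of_expLt => //; rewrite !expNt// M_inv//.
exact: opn_adj2.
Qed.

Lemma nalog_inv g : N (g^v) = N g.
Proof.
have H h : N (h^v) <= N h.
  apply: (@lim_le _ (fun t => Nt t (h^v)) (fun t => Nt t h) _ _ (ln 2)).
  - exact: Nt_cvg.
  - exact: Nt_cvg.
  by apply: filterS (near_pdisk R) => t tD; exact: Nt_inv.
by apply/eqP; rewrite eq_le H -{1}(invgK g) H.
Qed.

Lemma Nt_4pt t g h k : cpdisk t ->
  Nt t (g ** k^v) + Nt t h <=
  Num.max (Nt t (g ** h^v) + Nt t k) (Nt t g + Nt t (h ** k^v)) + ln 8 / Lt t.
Proof.
move=> tD; case: (tD) => t1 t0; have L0 := Lt_gt0 t0 t1.
apply: le_of_expLt => //.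
have := pluecker (M t g) (M t h) (M t k).
rewrite -!(M_inv hrho)// -!(M_mul hrho)// -!expNt// -!expRD -!mulrDr => H.
apply: le_trans H _.
have -> : 8 * expR (Lt t * Num.max (Nt t (g ** h^v) + Nt t k) (Nt t g + Nt t (h ** k^v))) =
  4 * (expR (Lt t * Num.max (Nt t (g ** h^v) + Nt t k) (Nt t g + Nt t (h ** k^v))) +
       expR (Lt t * Num.max (Nt t (g ** h^v) + Nt t k) (Nt t g + Nt t (h ** k^v)))) by ring.
by rewrite ler_pM2l//; apply: lerD; rewrite ler_expR ler_pM2l// le_max lexx ?orbT.
Qed.

Lemma nalog_4pt g h k :
  N (g ** k^v) + N h <= Num.max (N (g ** h^v) + N k) (N g + N (h ** k^v)).
Proof.
apply: (@lim_le _ (fun t => Nt t (g ** k^v) + Nt t h)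
  (fun t => Num.max (Nt t (g ** h^v) + Nt t k) (Nt t g + Nt t (h ** k^v))) _ _ (ln 8)).
- by apply: cvgD; exact: Nt_cvg.
- by apply: cvg_maxr; apply: cvgD; exact: Nt_cvg.
by apply: filterS (near_pdisk R) => t tD; exact: Nt_4pt.
Qed.

(** Each determinant is meromorphic in [t] with holomorphic numerator [P], so [hol_order] applies;
    its radius does not depend on the pair, which makes the first alternative uniform. *)
Lemma comm_cases :
  (exists2 eta : R, 0 < eta & forall g h t, cpdisk t -> cabs t < eta ->
     detcomm (M t g) (M t h) = 0) \/
  exists g h (c : R) (j : nat), 0 < c /\ \forall t \near dnbhs (0 : C),
     c * cabs t ^+ j <= cabs (detcomm (M t g) (M t h)).
Proof.
have [eta eta0 Heta] := hol_order R.
have [H|] := pselect (forall g h t, cpdisk t -> cabs t < eta -> detcomm (M t g) (M t h) = 0).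
  by left; exists eta.
move=> /existsNP[g /existsNP[h nH]]; right; exists g, h.
have [kg [E [hE HE]]] := polar_ex hrho g; have [kh [F [hF HF]]] := polar_ex hrho h.
pose P z := dc4 (E ord0 ord0 z) (E ord0 ord_max z) (E ord_max ord0 z) (E ord_max ord_max z)
                (F ord0 ord0 z) (F ord0 ord_max z) (F ord_max ord0 z) (F ord_max ord_max z).
have hP : hol P.
  apply: holB; first by apply: holN; move=> z zD; apply: cdiffX; move: z zD;
    apply: holB; apply: holM.
  by apply: holM; apply: holB; do ?[apply: holB; do ?apply: holD]; apply: holM.
(* [dc4] is quadratic in each matrix, so the denominators enter squared. As [cabs t < 1], dividing
   by them only increases the modulus. *)
have dP t : cpdisk t -> detcomm (M t g) (M t h) = P t / (t ^+ kg * t ^+ kh) ^+ 2.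
  move=> tD; have t0 : t != 0 by case: tD.
  rewrite detcommE !mxE !HE// !HF// /P /dc4; field.
  by rewrite !expf_neq0.
have [P0|[j [u [hu u0 Hu]]]] := Heta P hP.
  by exfalso; apply: nH => t tD te; rewrite dP// P0// mul0r.
exists (cabs (u 0) / 2), j; split; first by rewrite divr_gt0// cabs_gt0.
near=> t.
have tD : cpdisk t by near: t; exact: near_pdisk.
have ut : cabs (u 0) / 2 <= cabs (u t) by near: t; exact: hol_near_ge.
have t0 : 0 < cabs t by rewrite cabs_gt0; case: tD.
have t1 : cabs t < 1 by case: tD.
have tk n : 0 <= cabs t ^+ n <= 1.
  by apply/andP; split; [apply: exprn_ge0; exact: ltW|apply: exprn_ile1; exact: ltW].
rewrite dP// cabsM cabsV !cabsX cabsM !cabsX Hu cabsM cabsX.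
apply: le_trans (_ : cabs t ^+ j * cabs (u t) <= _).
  by rewrite mulrC ler_wpM2l// exprn_ge0// ltW.
apply: ler_peMr; first by rewrite mulr_ge0 ?cabs_ge0 ?exprn_ge0 ?cabs_ge0.
have [/andP[x0 x1] /andP[y0 y1]] := (tk kg, tk kh).
rewrite invf_ge1; last by rewrite exprn_gt0// mulr_gt0// exprn_gt0.
by apply: exprn_ile1; [exact: mulr_ge0|exact: mulr_ile1].
Unshelve. all: by end_near. Qed.

End Rep2.

(** * Invariant lines and growth of vectors *)

Section Rep3.
Variables (R : realType) (G : groupType) (rho : G -> 'I_2 -> 'I_2 -> R[i] -> R[i]).
Local Notation C := R[i].
Local Notation "x ** y" := (@monoid.mul G x y) (at level 40, left associativity).
Local Notation e1 := (@monoid.one G).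
Local Notation "x ^v" := (@monoid.inv G x) (at level 3, format "x ^v").
Local Notation M := (eval_rep rho).
Local Notation Nt := (Nt rho).
Local Notation N := (nalog rho).
Hypothesis hrho : is_SL2M_hom rho.
Implicit Types (g h k : G) (t p q : C).

Lemma app_mul (A B : 'M[C]_2) p q :
  app1 (A *m B) p q = app1 A (app1 B p q) (app2 B p q) /\
  app2 (A *m B) p q = app2 A (app1 B p q) (app2 B p q).
Proof. by rewrite /app1 /app2 !mulmx2; split; ring. Qed.

Lemma app_one p q : app1 1%:M p q = p /\ app2 1%:M p q = q.
Proof. by rewrite /app1 /app2 !mxE /= ?mulr1n ?mulr0n; split; ring. Qed.

Lemma app_scale (A : 'M[C]_2) (c p q : C) :
  app1 A (c * p) (c * q) = c * app1 A p q /\ app2 A (c * p) (c * q) = c * app2 A p q.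
Proof. by rewrite /app1 /app2; split; ring. Qed.

Definition eig t (v : C * C) g :=
  exists la : C, app1 (M t g) v.1 v.2 = la * v.1 /\ app2 (M t g) v.1 v.2 = la * v.2.

Lemma eig_of_wedge t v g : v != (0, 0) ->
  app1 (M t g) v.1 v.2 * v.2 = app2 (M t g) v.1 v.2 * v.1 -> eig t v g.
Proof.
case: v => p q /= v0 H; have [p0|p0] := eqVneq p 0.
  have q0 : q != 0 by apply: contra v0 => /eqP ->; rewrite p0.
  exists (app2 (M t g) p q / q) => /=; rewrite divfK//; split=> //.
  apply: (mulIf q0); rewrite H p0; ring.
exists (app1 (M t g) p q / p) => /=; rewrite divfK//; split=> //.
by apply: (mulIf p0); rewrite -H; field.
Qed.

Lemma eig_mul t v g h : cpdisk t -> eig t v g -> eig t v h -> eig t v (g ** h).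
Proof.
move=> tD [la [a1 a2]] [mu [b1 b2]]; exists (la * mu); rewrite M_mul//.
have [-> ->] := app_mul (M t g) (M t h) v.1 v.2; rewrite b1 b2.
by have [-> ->] := app_scale (M t g) mu v.1 v.2; rewrite a1 a2; split; ring.
Qed.

Lemma eig_neq0 t v g (la : C) : cpdisk t -> v != (0, 0) ->
  app1 (M t g) v.1 v.2 = la * v.1 -> app2 (M t g) v.1 v.2 = la * v.2 -> la != 0.
Proof.
case: v => p q /= tD v0 a1 a2; apply: contra v0 => /eqP l0.
have := app_mul (M t (g^v)) (M t g) p q; rewrite -M_mul// mulVg M_one//.
rewrite a1 a2 l0 !mul0r; have [-> ->] := app_one p q.
by rewrite /app1 /app2 !mulr0 addr0 => -[-> ->]; rewrite eqxx.
Qed.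

Lemma eig_inv t v g : cpdisk t -> v != (0, 0) -> eig t v g -> eig t v (g^v).
Proof.
move=> tD v0 [la [a1 a2]]; have l0 := eig_neq0 tD v0 a1 a2.
exists la^-1; have := app_mul (M t (g^v)) (M t g) v.1 v.2; rewrite -M_mul// mulVg M_one//.
rewrite a1 a2; have [-> ->] := app_one v.1 v.2.
have [-> ->] := app_scale (M t (g^v)) la v.1 v.2.
by move=> [h1 h2]; split; apply: (mulfI l0); rewrite mulVKf// -?h1 -?h2.
Qed.

(* A group is not the union of two proper subgroups. *)
Lemma common_eigenline t : cpdisk t -> (forall g h, detcomm (M t g) (M t h) = 0) ->
  exists2 v : C * C, v != (0, 0) & forall g, eig t v g.
Proof.
move=> tD H; have n10 : (1 : C) != 0 by rewrite oner_eq0.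
have [sc|] := pselect (forall g, M t g ord0 ord_max = 0 /\ M t g ord_max ord0 = 0 /\
    M t g ord0 ord0 = M t g ord_max ord_max).
  exists (1, 0); first by rewrite xpair_eqE (negPf n10).
  move=> g; have [b0 [c0 ad]] := sc g; exists (M t g ord0 ord0) => /=.
  by rewrite /app1 /app2 b0 c0; split; ring.
move=> /existsNP[g0 /common_line[v1 [v2 [v10 v20 HB]]]].
have U g : eig t v1 g \/ eig t v2 g.
  by have [h|h] := HB _ (H g0 g); [left|right]; exact: eig_of_wedge h.
have [all1|/existsNP[g ng]] := pselect (forall g, eig t v1 g); first by exists v1.
have [all2|/existsNP[h nh]] := pselect (forall g, eig t v2 g); first by exists v2.
have g2 : eig t v2 g by case: (U g).
have h1 : eig t v1 h by case: (U h).
case: (U (g ** h)) => gh; exfalso.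
  by apply: ng; rewrite -(mulgK h g); apply: eig_mul => //; exact: eig_inv.
by apply: nh; rewrite -(mulKg g h); apply: eig_mul => //; exact: eig_inv.
Qed.

(** [phi g] is the normalised logarithm of the eigenvalue of [g] on the common eigenline,
    multiplicative because the line is shared. The last inequality is [triangular_product], with
    [6 = 4 + 2]. *)
Lemma reducible_char t : cpdisk t -> (forall g h, detcomm (M t g) (M t h) = 0) ->
  exists phi : G -> R, [/\ forall g h, phi (g ** h) = phi g + phi h,
    forall g, phi g <= Nt t g &
    forall g h, Nt t (g ** h) <= Num.max (phi g + Nt t h) (Nt t g - phi h) + ln 6 / Lt t].
Proof.
move=> tD H; case: (tD) => t1 t0; have L0 := Lt_gt0 t0 t1.
have [v v0 Hv] := common_eigenline tD H.
pose la g := sval (cid (Hv g)).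
have laP g : app1 (M t g) v.1 v.2 = la g * v.1 /\ app2 (M t g) v.1 v.2 = la g * v.2.
  by rewrite /la; case: (cid _).
have la0 g : la g != 0 by have [a b] := laP g; exact: eig_neq0 tD v0 a b.
have uniq_la (x y : C) : x * v.1 = y * v.1 -> x * v.2 = y * v.2 -> x = y.
  case: v v0 {Hv la laP la0} => p q /= v0 h1 h2; have [p0|p0] := eqVneq p 0.
    have q0 : q != 0 by apply: contra v0 => /eqP ->; rewrite p0.
    exact: (mulIf q0).
  exact: (mulIf p0).
have laM g h : la (g ** h) = la g * la h.
  have [a1 a2] := laP g; have [b1 b2] := laP h; have [c1 c2] := laP (g ** h).
  move: c1 c2; rewrite M_mul//; have [-> ->] := app_mul (M t g) (M t h) v.1 v.2.
  rewrite b1 b2; have [-> ->] := app_scale (M t g) (la h) v.1 v.2; rewrite a1 a2 => c1 c2.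
  by apply: uniq_la; rewrite -?c1 -?c2; ring.
have vn0 : 0 < vn v.1 v.2.
  case: v v0 {Hv la laP la0 uniq_la laM} => p q /= v0.
  rewrite /vn lt_max !cabs_gt0 -negb_and; apply: contra v0 => /andP[/eqP -> /eqP ->].
  by [].
have la_le g : cabs (la g) <= opnorm (M t g).
  have := vn_mul (M t g) v.1 v.2; have [a b] := laP g.
  rewrite -/(app1 (M t g) v.1 v.2) -/(app2 (M t g) v.1 v.2) a b.
  have -> : vn (la g * v.1) (la g * v.2) = cabs (la g) * vn v.1 v.2.
    by rewrite /vn !cabsM maxr_pMr// cabs_ge0.
  by rewrite ler_pM2r.
pose phi g := ln (cabs (la g)) / Lt t.
have lagt g : 0 < cabs (la g) by rewrite cabs_gt0.
have ephi g : expR (Lt t * phi g) = cabs (la g).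
  by rewrite /phi mulrC divfK ?gt_eqF// lnK// posrE.
exists phi; split.
- by move=> g h; rewrite /phi laM cabsM lnM ?posrE// mulrDl.
- by move=> g; rewrite /phi ler_pM2r ?invr_gt0// ler_ln ?posrE// (M_gt0 hrho).
move=> g h; apply: le_of_expLt => //; rewrite !expNt//.
have [a1 a2] := laP g; have [b1 b2] := laP h.
rewrite M_mul//.
have vv : (v.1, v.2) != (0, 0) by case: (v) v0.
have := triangular_product vv (M_det hrho h tD) a1 a2 b1 b2 (la0 h) (la_le h).
move=> T; apply: le_trans T _.
rewrite -!ephi -!(expNt hrho)// -expRN -!expRD -mulrN -!mulrDr.
set X := phi g + Nt t h; set Y := Nt t g - phi h.
have -> : 6 * expR (Lt t * Num.max X Y) =
  4 * expR (Lt t * Num.max X Y) + 2 * expR (Lt t * Num.max X Y) by ring.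
by apply: lerD; rewrite ler_pM2l// ler_expR ler_pM2l// le_max lexx ?orbT.
Qed.

Definition psi t p q g : R := ln (vnA (M t g) p q / vn p q) / Lt t.

Section Psi.
Variables (t : C) (tD : cpdisk t).

Let L0 : 0 < Lt t. Proof. by case: (tD) => t1 t0; exact: Lt_gt0. Qed.

Lemma vn_gt0 p q : (p, q) != (0, 0) -> 0 < vn p q.
Proof.
move=> v0; rewrite /vn lt_max !cabs_gt0 -negb_and; apply: contra v0 => /andP[/eqP -> /eqP ->].
by [].
Qed.

Lemma vn_le_inv p q g : vn p q <= opnorm (M t (g^v)) * vnA (M t g) p q.
Proof.
have := vn_mul (M t (g^v)) (app1 (M t g) p q) (app2 (M t g) p q).
rewrite -/(app1 (M t (g^v)) _ _) -/(app2 (M t (g^v)) _ _).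
have [<- <-] := app_mul (M t (g^v)) (M t g) p q.
by rewrite -M_mul// mulVg M_one//; have [-> ->] := app_one p q.
Qed.

Lemma vnA_gt0 p q g : (p, q) != (0, 0) -> 0 < vnA (M t g) p q.
Proof.
move=> /vn_gt0 v0; have := lt_le_trans v0 (vn_le_inv p q g).
by rewrite pmulr_rgt0// (M_gt0 hrho).
Qed.

Lemma expPsi p q g : (p, q) != (0, 0) -> expR (Lt t * psi t p q g) = vnA (M t g) p q / vn p q.
Proof.
move=> v0; rewrite /psi mulrC divfK ?gt_eqF//; apply: lnK.
by rewrite posrE; apply: divr_gt0; [exact: vnA_gt0|exact: vn_gt0].
Qed.

Lemma psi_le p q g : (p, q) != (0, 0) -> psi t p q g <= Nt t g.
Proof.
move=> v0; rewrite -(ler_pM2l L0) -ler_expR expPsi// expNt// ler_pdivrMr ?vn_gt0//.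
exact: vn_mul.
Qed.

Lemma psi_ge p q g : (p, q) != (0, 0) -> - Nt t (g^v) <= psi t p q g.
Proof.
move=> v0; rewrite -(ler_pM2l L0) -ler_expR expPsi// mulrN expRN expNt//.
rewrite ler_pdivlMr ?vn_gt0// ler_pdivrMl ?(M_gt0 hrho)//; exact: vn_le_inv.
Qed.

Lemma app_neq0 p q g : (p, q) != (0, 0) -> (app1 (M t g) p q, app2 (M t g) p q) != (0, 0).
Proof.
move=> v0; have := vnA_gt0 g v0; apply: contraTneq => -[h1 h2].
by rewrite /vnA h1 h2 /vn cabs0 maxxx ltxx.
Qed.

(** An exact cocycle relation, where [Nt] is only subadditive. It is what allows an estimate for one
    block to be iterated. *)
Lemma psi_mul p q g h : (p, q) != (0, 0) ->
  psi t p q (g ** h) = psi t (app1 (M t h) p q) (app2 (M t h) p q) g + psi t p q h.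
Proof.
move=> v0; have w0 := app_neq0 h v0.
rewrite /psi -mulrDl -lnM; [|by rewrite posrE; apply: divr_gt0; [exact: vnA_gt0|exact: vn_gt0]|by rewrite posrE; apply: divr_gt0; [exact: vnA_gt0|exact: vn_gt0]].
congr (ln _ / _); rewrite {1}/vnA M_mul//.
have [-> ->] := app_mul (M t g) (M t h) p q.
rewrite -/(vnA (M t g) _ _) -/(vnA (M t h) p q) mulrA divfK//.
by rewrite gt_eqF// vnA_gt0.
Qed.

(** If [g] and [h] both lose much on the same vector, [contract_pair] aligns their rows, so
    [g ** h^v] is short. Two independent walks can thus both lose only when their Gromov product is
    large. *)
Lemma psi_pair p q g h : (p, q) != (0, 0) ->
  Num.min (Nt t g - psi t p q g) (Nt t h - psi t p q h) <=
  Nt t g + Nt t h - Nt t (g ** h^v) + ln 4 / Lt t.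
Proof.
move=> v0; set m := Num.min _ _.
suff : Nt t (g ** h^v) <= Nt t g + Nt t h - m + ln 4 / Lt t by lra.
apply: le_of_expLt => //; rewrite expNt// M_mul// M_inv//.
have vp := vn_gt0 v0.
have := contract_pair (M t g) (M t h) p q; rewrite -ler_pdivlMl// => T.
apply: le_trans T _.
have -> : (vn p q)^-1 * (2 * (vnA (M t g) p q * opnorm (M t h) + vnA (M t h) p q * opnorm (M t g))) =
  2 * (vnA (M t g) p q / vn p q * opnorm (M t h) + vnA (M t h) p q / vn p q * opnorm (M t g)).
  by field; rewrite gt_eqF.
rewrite -!expPsi// -!expNt// -!expRD -!mulrDr.
set Z := expR (Lt t * (Nt t g + Nt t h - m)).
have -> : 4 * Z = 2 * (Z + Z) by ring.
have m1 : m <= Nt t g - psi t p q g by rewrite ge_min lexx.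
have m2 : m <= Nt t h - psi t p q h by rewrite ge_min lexx orbT.
by rewrite ler_pM2l//; apply: lerD; rewrite ler_expR ler_pM2l//; lra.
Qed.

End Psi.

(* Both [g] and [h] almost fix the direction of the rows of [f]. *)
Lemma aligned_commutator f g h (c D : R) (j : nat) : 0 < c ->
  (\forall t \near dnbhs (0 : C), c * cabs t ^+ j <= cabs (detcomm (M t g) (M t h))) ->
  D <= N (f ** g) + N f - N (f ** g ** f^v) ->
  D <= N (f ** h) + N f - N (f ** h ** f^v) ->
  D <= j%:R + 2 * (N g + N h).
Proof.
move=> c0 Hc Dg Dh.
have : 2 * N f - j%:R <= N g + N h + Num.max (N h + N (f ** g ** f^v)) (N g + N (f ** h ** f^v)).
  apply: (@lim_le _ (fun t => 2 * Nt t f - j%:R) (fun t => Nt t g + Nt t h +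
    Num.max (Nt t h + Nt t (f ** g ** f^v)) (Nt t g + Nt t (f ** h ** f^v))) _ _ (ln (112 / c))).
  - by apply: cvgB; [apply: cvgM; [exact: cvg_cst|exact: Nt_cvg]|exact: cvg_cst].
  - apply: cvgD; first by apply: cvgD; exact: Nt_cvg.
    by apply: cvg_maxr; apply: cvgD; exact: Nt_cvg.
  near=> t.
  have tD : cpdisk t by near: t; exact: near_pdisk.
  have Ht : c * cabs t ^+ j <= cabs (detcomm (M t g) (M t h)) by near: t.
  case: (tD) => t1 t0; have L0 := Lt_gt0 t0 t1.
  apply: le_of_expLt => //; first by rewrite divr_gt0.
  have tp : 0 < cabs t by rewrite cabs_gt0.
  have -> : expR (Lt t * (2 * Nt t f - j%:R)) = opnorm (M t f) ^+ 2 * cabs t ^+ j.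
    rewrite -(expNt hrho)// -expRM_natl.
    have -> : cabs t ^+ j = expR (- (Lt t * j%:R)).
      rewrite /Lt lnV ?posrE// mulNr opprK mulrC expRM_natl lnK// posrE//.
    by rewrite -expRD; congr expR; ring.
  have := commutator_bound (M t f) (M t g) (M t h).
  rewrite -(M_inv hrho)// -!(M_mul hrho)// => T.
  have T2 : opnorm (M t f) ^+ 2 * (c * cabs t ^+ j) <=
      opnorm (M t f) ^+ 2 * cabs (detcomm (M t g) (M t h)).
    by rewrite ler_wpM2l// exprn_ge0// opn_ge0.
  have {T T2} := le_trans T2 T.
  rewrite -!(expNt hrho)// -!expRD -!mulrDr.
  set Z := expR (Lt t * (_ + Num.max _ _)) => T.
  rewrite [leRHS]mulrAC ler_pdivlMr//.
  have -> : expR (Lt t * Nt t f) ^+ 2 * cabs t ^+ j * c = expR (Lt t * Nt t f) ^+ 2 * (c * cabs t ^+ j) by ring.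
  apply: le_trans T _.
  have -> : 112 * Z = 56 * (Z + Z) by ring.
  rewrite -mulrA ler_pM2l// [X in X <= _]mulrDr -!expRD -!mulrDr.
  by apply: lerD; rewrite ler_expR ler_pM2l// lerD2l le_max lexx ?orbT.
have h1 := nalog_mul hrho f g; have h2 := nalog_mul hrho f h.
have : Num.max (N h + N (f ** g ** f^v)) (N g + N (f ** h ** f^v)) <= 2 * N f + N g + N h - D.
  by rewrite ge_max; apply/andP; split; lra.
by move: (Num.max _ _) => x h3 h4; lra.
Unshelve. all: by end_near. Qed.

End Rep3.

(** * Comparison of the drifts *)

Section WordLength.
Variables (R : realType) (G : groupType) (S : seq G) (m : G -> R).
Local Notation "x ** y" := (@monoid.mul G x y) (at level 40, left associativity).
Local Notation e1 := (@monoid.one G).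
Hypothesis hS : sym_gen_set S.

Lemma word_lengthP (g : G) : word_of_len S g (word_length S g) /\
  forall k, word_of_len S g k -> (word_length S g <= k)%N.
Proof.
rewrite /word_length; set A := [set n | _]; suff : exists n, A n by move=> /(xgetPex 0%N).
have [_ /(_ g)[s [sS gs]]] := hS.
have ex : exists n, `[< word_of_len S g n >] by exists (size s); apply/asboolP; exists s.
case: (ex_minnP ex) => n /asboolP nP nmin; exists n; split=> // k kP.
by apply: nmin; apply/asboolP.
Qed.

Lemma gprod_cat (s t : seq G) : gprod (s ++ t) = gprod s ** gprod t.
Proof.
elim: s => [|a s IH] /=; first by rewrite mul1g.
by rewrite /gprod /= -!/(gprod _) IH mulgA.
Qed.

Lemma word_length_mul (g h : G) :
  (word_length S (g ** h) <= word_length S g + word_length S h)%N.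
Proof.
have [[s [sS sn gE]] _] := word_lengthP g; have [[t [tS tn hE]] _] := word_lengthP h.
have [_ min] := word_lengthP (g ** h); apply: min; exists (s ++ t); split.
- by rewrite all_cat sS.
- by rewrite size_cat sn tn.
- by rewrite gprod_cat -gE -hE.
Qed.

(** Adding 1 makes the weight at least 1 and turns subadditivity of the word length into
    submultiplicativity. *)
Definition wlen (g : G) : R := 1 + (word_length S g)%:R.

Lemma wlen_ge1 g : 1 <= wlen g. Proof. by rewrite lerDl. Qed.

Lemma wlen_mul g h : wlen (g ** h) <= wlen g * wlen h.
Proof.
rewrite /wlen; have := word_length_mul g h; rewrite -(ler_nat R) natrD.
set a := (word_length S g)%:R; set b := (word_length S h)%:R => H.
have := mulr_ge0 (ler0n R (word_length S g)) (ler0n R (word_length S h)).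
by rewrite -/a -/b; lra.
Qed.

(** A natural number is at most its power with exponent [1 + d], so the moment hypothesis provides a
    first moment. *)
Lemma wlen_summ : prob_on m -> (exists2 delta : R, 0 < delta &
     (\esum_(g in [set: G]) (m g * powR ((word_length S g)%:R) (1 + delta))%:E < +oo)%E) ->
  summ (fun g => m g * wlen g).
Proof.
move=> [m0 msum] [d d0 Hd].
under eq_fun do rewrite /wlen mulrDr mulr1.
apply: summD.
  by rewrite /summ; under eq_esum do rewrite ger0_norm//; rewrite msum ltry.
rewrite /summ; apply: le_lt_trans Hd; apply: le_esum => g _; rewrite lee_fin.
rewrite ger0_norm ?mulr_ge0//; apply: ler_wpM2l => //.
have [->|n0] := posnP (word_length S g); first exact: powR_ge0.
rewrite -[leLHS]powRr1//; apply: ler_powR; first by rewrite ler1n.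
by rewrite lerDl ltW.
Qed.

End WordLength.

(** * Upper and lower bounds for the drift at small parameters *)

Section Lower.
Variables (R : realType) (G : groupType) (W : walk R G).
Variable rho : G -> 'I_2 -> 'I_2 -> R[i] -> R[i].
Local Notation C := R[i].
Local Notation "x ** y" := (@monoid.mul G x y) (at level 40, left associativity).
Local Notation e1 := (@monoid.one G).
Local Notation "x ^v" := (@monoid.inv G x) (at level 3, format "x ^v").
Local Notation M := (eval_rep rho).
Local Notation Nt := (Nt rho).
Local Notation N := (nalog rho).
Local Notation En := (En W).
Local Notation adm := (adm W).
Local Notation dom := (dom W).
Hypothesis hrho : is_SL2M_hom rho.
Variables (K : R).
Hypothesis K0 : 0 <= K.
Hypothesis domNt : \forall t \near dnbhs (0 : C), dom K (Nt t).
Implicit Types (g h : G) (t : C).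

Lemma dom_nalog : dom K N.
Proof.
move=> g; rewrite ger0_norm ?(nalog_ge0 hrho)//.
apply: (@lim_le _ (fun t => Nt t g) (fun=> K * wt W g) _ _ 0).
- exact: Nt_cvg.
- exact: cvg_cst.
apply: filterS domNt => t /(_ g); rewrite mul0r addr0; apply: le_trans; exact: ler_norm.
Qed.

Lemma adm_nalog : adm N. Proof. exact: dom_adm dom_nalog. Qed.

Lemma En_Nt_cvg n : En n (fun g => `|Nt t g - N g|) @[t --> dnbhs (0 : C)] --> (0 : R).
Proof.
apply: (@En_dct _ _ W n _ (dnbhs (0 : C)) _ (2 * K) (fun t g => `|Nt t g - N g|)).
  apply: filterS domNt => t d g; rewrite normr_id; apply: le_trans (ler_normB _ _) _.
  by have := d g; have := dom_nalog g; lra.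
move=> g; have := @Nt_cvg _ _ rho hrho g => /cvgrPdist_le H; apply/cvgrPdist_le => e e0.
by apply: filterS (H e e0) => t; rewrite sub0r normrN normr_id distrC.
Qed.

Lemma near_En_Nt n (d : R) : 0 < d ->
  \forall t \near dnbhs (0 : C), En n (fun g => `|Nt t g - N g|) <= d.
Proof.
move=> d0; have /cvgrPdist_le/(_ d d0) := En_Nt_cvg n.
apply: filterS => t; rewrite sub0r normrN; apply: le_trans; exact: ler_norm.
Qed.

Definition drift_of t (l : R) := [/\ 0 <= l, n%:R^-1 * En n (Nt t) @[n --> \oo] --> l &
  forall n, n%:R * l <= En n (Nt t)].

Lemma drift_ex t : cpdisk t -> dom K (Nt t) -> exists l, drift_of t l.
Proof.
move=> tD d; apply: (walk_drift (dom_adm d)) => [g|g h]; first exact: Nt_ge0.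
exact: Nt_mul.
Qed.

Lemma drift_ge t l (c : R) (n : nat) : drift_of t l -> (0 < n)%N ->
  (forall k : nat, k%:R * (n%:R * c) <= En (k * n) (Nt t)) -> c <= l.
Proof.
move=> [_ cl _] n0 H; apply/ler_addgt0Pr => e e0.
move/cvgrPdist_le: cl => /(_ e e0)[k _ Hk].
have kk : (k <= k.+1 * n)%N by apply: leq_trans (leq_pmulr _ n0); exact: leqnSn.
have := Hk _ kk; rewrite /= ler_norml => /andP[h1 _].
have := H k.+1; rewrite mulrA -natrM => h2.
have p0 : (0 : R) < (k.+1 * n)%:R by rewrite ltr0n muln_gt0.
have : c <= (k.+1 * n)%:R^-1 * En (k.+1 * n) (Nt t) by rewrite ler_pdivlMl.
by move: h1; move: (_^-1 * _) => u h1 h3; lra.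
Qed.

Variable l0 : R.
Hypothesis l00 : 0 < l0.
Hypothesis cl0 : n%:R^-1 * En n N @[n --> \oo] --> l0.
Hypothesis ll0 : forall n, n%:R * l0 <= En n N.

Lemma upper_drift (e : R) : 0 < e ->
  \forall t \near dnbhs (0 : C), forall l, drift_of t l -> l <= l0 + e.
Proof.
move=> e0; have e20 : 0 < e / 2 by rewrite divr_gt0.
move/cvgrPdist_le: cl0 => /(_ _ e20)[k _ /(_ k.+1 (leqnSn k))].
set n := k.+1; rewrite distrC ler_norml => /andP[_ h].
have n0 : (0 : R) < n%:R by rewrite ltr0n.
have near_n := near_En_Nt n e20.
near=> t => l [_ _ ll].
have d : dom K (Nt t) by near: t.
have h2 : En n (fun g => `|Nt t g - N g|) <= e / 2 by near: t.
have h3 : En n (Nt t) - En n N <= e / 2.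
  rewrite -EnB ?(dom_adm d)//; [|exact: dom_adm d|exact: adm_nalog].
  apply: le_trans (ler_norm _) (le_trans (En_norm n _) h2).
  by apply: admB; [exact: dom_adm d|exact: adm_nalog].
have h4 : n%:R^-1 * En n (Nt t) <= l0 + e.
  have -> : n%:R^-1 * En n (Nt t) = n%:R^-1 * En n N + n%:R^-1 * (En n (Nt t) - En n N) by ring.
  have : n%:R^-1 * (En n (Nt t) - En n N) <= e / 2.
    rewrite ler_pdivrMl//; apply: le_trans h3 _; apply: ler_peMl; [exact: ltW|by rewrite ler1n].
  by lra.
apply: le_trans h4; rewrite ler_pdivlMl//; exact: ll.
Unshelve. all: by end_near. Qed.

Lemma conc_nalog (d : R) : 0 < d -> exists i0 : nat, forall i, (i0 <= i)%N ->
    En (2 ^ i) (fun g => `|N g - (2 ^ i)%:R * l0|) <= d * (2 ^ i)%:R.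
Proof.
move=> d0; apply: (walk_concentration d0 adm_nalog _ _ _ cl0 ll0).
- exact: nalog_ge0.
- exact: nalog_mul.
- exact: nalog_one.
Qed.

Lemma En_hom (phi : G -> R) n : adm phi -> (forall g h, phi (g ** h) = phi g + phi h) ->
  En n phi = n%:R * E1 W phi.
Proof.
move=> ap hp; have p1 : phi e1 = 0 by have := hp e1 e1; rewrite mulg1; lra.
elim: n => [|n IH]; first by rewrite mul0r /= p1.
rewrite -[n.+1]addn1 En_add En1.
have -> : (fun h => En n (fun g => phi (g ** h))) = (fun h => n%:R * E1 W phi + phi h).
  apply/funext => h; have -> : (fun g => phi (g ** h)) = (fun g => phi g + phi h).
    by apply/funext => g; exact: hp.
  by rewrite EnD ?IH ?En_cst//; exact: adm_cst.
by rewrite E1D// ?E1_cst ?natrD ?mulrDl ?mul1r//; exact: adm_cst.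
Qed.

(** With [a] the mean of [phi], two bounds meet: [|a|] is at most the drift at [t], and computing
    the mean length at the fixed time [n + n] in two ways shows that [|a|] is at least [l0 - e]. *)
Lemma lower_drift_reducible (eta e : R) : 0 < eta -> 0 < e ->
  (forall g h t, cpdisk t -> cabs t < eta -> detcomm (M t g) (M t h) = 0) ->
  \forall t \near dnbhs (0 : C), forall l, drift_of t l -> l0 - e <= l.
Proof.
move=> eta0 e0 Hred.
pose d := e / 8; have d0 : 0 < d by rewrite divr_gt0.
have [i1 Hi1] := conc_nalog d0.
have [j0 Hj0] := walk_lln W (K + 1) 1 d0.
pose i := (i1 + j0)%N; pose n := (2 ^ i)%N.
have cn : En n (fun g => `|N g - n%:R * l0|) <= d * n%:R by apply: Hi1; rewrite leq_addr.
have jn : (j0 <= n)%N.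
  by apply: leq_trans (leq_addl i1 j0) _; exact: ltnW (ltn_expl _ (ltnSn 1)).
have n1 : (1 : R) <= n%:R by rewrite ler1n expn_gt0.
have n0 : (0 : R) < n%:R by lra.
have nn1 := near_En_Nt n d0; have nn2 := near_En_Nt (n + n) d0.
near=> t => l dl.
have tD : cpdisk t by near: t; exact: near_pdisk.
have dN : dom K (Nt t) by near: t.
have te : cabs t < eta by near: t; exact: near_small.
have b1 : En n (fun g => `|Nt t g - N g|) <= d by near: t.
have b2 : En (n + n) (fun g => `|Nt t g - N g|) <= d by near: t.
have L1 : (ln 6 + ln 2) / d + (ln 6 + ln 2) + 1 <= Lt t by near: t; exact: near_Lt.
have ln6 : (0 : R) <= ln 6 by apply: ln_ge0; rewrite ler1n.
have ln2 : (0 : R) <= ln 2 by apply: ln_ge0; rewrite ler1n.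
have L0 : 0 < Lt t.
  by apply: lt_le_trans L1; rewrite ltr_pwDr// !addr_ge0// divr_ge0 ?addr_ge0// ltW.
have sd : 0 <= (ln 6 + ln 2) / d by rewrite divr_ge0 ?addr_ge0// ltW.
have c6 : ln 6 / Lt t <= d.
  rewrite ler_pdivrMr// mulrC -ler_pdivrMr//.
  have : ln 6 / d <= (ln 6 + ln 2) / d by rewrite ler_pM2r ?invr_gt0// lerDl.
  by lra.
have c2 : ln 2 / Lt t <= 1 by rewrite ler_pdivrMr//; lra.
have c20 : 0 <= ln 2 / Lt t by rewrite divr_ge0// ltW.
have [phi [hom le_N prodN]] := reducible_char hrho tD (fun g h => Hred g h t tD te).
have p1 : phi e1 = 0 by have := hom e1 e1; rewrite mulg1; lra.
have p1le : phi e1 <= 0 by rewrite p1.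
have p1ge : - phi e1 <= 0 by rewrite p1 oppr0.
have inv g : phi (g^v) = - phi g by have := hom g (g^v); rewrite mulgV p1; lra.
have le_N' g : - phi g <= Nt t g + ln 2 / Lt t.
  by rewrite -inv; apply: le_trans (le_N _) _; exact: Nt_inv.
have N0 g : 0 <= Nt t g by exact: Nt_ge0.
have aN := dom_adm dN.
have dphi : dom (K + 1) phi.
  move=> g; have := dN g; rewrite ger0_norm// => h; rewrite ler_norml mulrDl mul1r.
  by have := le_N g; have := le_N' g; have := wt_ge1 W g; have := w_ge0 W g; lra.
have dphi' : dom (K + 1) (fun g => - phi g) by move=> g; rewrite normrN; exact: dphi.
have ap := dom_adm dphi; have ap' := dom_adm dphi'.
pose a := E1 W phi.
(* [phi] is below [Nt t], and [- phi] is so up to [ln 2 / Lt t], the cost of inversion. Blocks of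
   [k0.+1] steps reduce this loss to [u] per step. *)
have la : `|a| <= l.
  rewrite ler_norml; apply/andP; split.
    rewrite lerNl; apply/ler_addgt0Pr => u u0.
    have [k0 Hk0] : exists k0 : nat, ln 2 / Lt t / u <= k0.+1%:R.
      by exists (Num.truncn (ln 2 / Lt t / u)); exact: ltW (truncnS_gt _).
    rewrite -lerBlDr; apply: (drift_ge (n := k0.+1) dl) => // k.
    case: k => [|k]; first by rewrite mul0n mul0r /=.
    apply: le_trans (_ : En (k.+1 * k0.+1) (fun g => - phi g - ln 2 / Lt t) <= _); last first.
      by apply: En_le => // [|g]; [by apply: admB => //; exact: adm_cst|rewrite lerBlDr].
    rewrite EnB// ?En_cst ?EnN ?En_hom//; last exact: adm_cst.
    rewrite natrM -/a.
    have h1 : ln 2 / Lt t <= k0.+1%:R * u by rewrite -ler_pdivrMr.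
    have : k0.+1%:R * u <= k.+1%:R * (k0.+1%:R * u).
      by apply: ler_peMl; [rewrite mulr_ge0 ?ltW|rewrite ler1n].
    by lra.
  apply: (drift_ge (n := 1) dl) => // k.
  rewrite muln1 mul1r -En_hom//.
  exact: En_le.
suff : l0 - e <= `|a| by move=> h; exact: le_trans h la.
(* Each alternative in [prodN] pairs one full length, about [n l0], with one value of [phi] or
   [- phi], which rarely exceeds [n |a|] by much. *)
have up : En (n + n) (Nt t) <= n%:R * l0 + n%:R * `|a| + 4 * d * n%:R + 3 * d.
  rewrite En_add.
  pose P g := `|Nt t g - n%:R * l0| + Num.max (phi g - n%:R * a) 0.
  pose P' g := `|Nt t g - n%:R * l0| + Num.max (- phi g - n%:R * (- a)) 0.
  have amax (f : G -> R) (c : R) : adm f -> adm (fun g => Num.max (f g - c) 0).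
    move=> af; apply: (@adm_le _ _ _ _ (fun g => `|f g - c|)).
      by move=> g; case: (leP (f g - c) 0); rewrite ?normr0.
    by apply/adm_abs/admB => //; exact: adm_cst.
  have aabs : adm (fun g => `|Nt t g - n%:R * l0|) by apply/adm_abs/admB => //; exact: adm_cst.
  have aP : adm P by apply: admD => //; exact: amax.
  have aP' : adm P' by apply: admD => //; exact: (amax (fun g => - phi g)).
  pose cc := n%:R * l0 + n%:R * `|a| + ln 6 / Lt t.
  have pw g h : Nt t (g ** h) <= cc + P g + P' h.
    apply: le_trans (prodN g h) _.
    have x1 : phi g - n%:R * a <= Num.max (phi g - n%:R * a) 0 by rewrite le_max lexx.
    have x2 : - phi h - n%:R * (- a) <= Num.max (- phi h - n%:R * (- a)) 0 by rewrite le_max lexx.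
    have x3 : 0 <= Num.max (phi g - n%:R * a) 0 by rewrite le_max lexx orbT.
    have x4 : 0 <= Num.max (- phi h - n%:R * (- a)) 0 by rewrite le_max lexx orbT.
    have y1 := ler_norm (Nt t g - n%:R * l0); have y2 := ler_norm (Nt t h - n%:R * l0).
    have y3 := normr_ge0 (Nt t g - n%:R * l0); have y4 := normr_ge0 (Nt t h - n%:R * l0).
    have z1 : n%:R * a <= n%:R * `|a| by rewrite ler_pM2l// ler_norm.
    have z2 : - (n%:R * a) <= n%:R * `|a| by rewrite -mulrN ler_pM2l// -normrN ler_norm.
    rewrite -lerBrDr ge_max /cc /P /P'; apply/andP; split; lra.
  have EP : En n (fun g => `|Nt t g - n%:R * l0|) <= d * n%:R + d.
    apply: le_trans (_ : En n (fun g => `|Nt t g - N g| + `|N g - n%:R * l0|) <= _).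
      apply: En_le => //.
        by apply: admD; apply/adm_abs/admB => //; [exact: adm_nalog|exact: adm_nalog|exact: adm_cst].
      move=> g; have -> : Nt t g - n%:R * l0 = (Nt t g - N g) + (N g - n%:R * l0) by ring.
      exact: ler_normD.
    rewrite EnD; [|by apply/adm_abs/admB => //; exact: adm_nalog
                  |by apply/adm_abs/admB => //; [exact: adm_nalog|exact: adm_cst]].
    by lra.
  have F1 : En n (fun g => Num.max (phi g - n%:R * a) 0) <= d * n%:R.
    have s1 g h : phi (g ** h) <= phi g + phi h by rewrite hom.
    have := Hj0 n phi jn dphi s1 p1le.
    by rewrite muln1 En1.
  have F2 : En n (fun g => Num.max (- phi g - n%:R * (- a)) 0) <= d * n%:R.
    have s1 g h : - phi (g ** h) <= - phi g + - phi h by rewrite hom opprD.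
    have := Hj0 n (fun g => - phi g) jn dphi' s1 p1ge.
    by rewrite muln1 En1 -En1 EnN// En1.
  have EP1 : En n P <= d * n%:R + d + d * n%:R by rewrite EnD//; [lra|exact: amax].
  have EP2 : En n P' <= d * n%:R + d + d * n%:R.
    by rewrite EnD//; [lra|exact: (amax (fun g => - phi g))].
  apply: le_trans (_ : En n (fun h => cc + En n P + P' h) <= _).
    apply: En_le; [exact: adm_En|by apply: admD => //; exact: adm_cst|].
    move=> h; apply: le_trans (_ : En n (fun g => cc + P g + P' h) <= _).
      apply: En_le => //; first exact: adm_tr.
      by apply: admD; [apply: admD => //; exact: adm_cst|exact: adm_cst].
    rewrite EnD; [|by apply: admD => //; exact: adm_cst|exact: adm_cst].
    by rewrite EnD ?En_cst//; exact: adm_cst.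
  by rewrite EnD ?En_cst//; [rewrite /cc; lra|exact: adm_cst].
have low : (n + n)%:R * l0 - d <= En (n + n) (Nt t).
  have := ll0 (n + n).
  have : En (n + n) N - En (n + n) (Nt t) <= d.
    rewrite -(EnB _ adm_nalog aN).
    apply: le_trans (ler_norm _) (le_trans (En_norm _ _) _).
      by apply: admB => //; exact: adm_nalog.
    by under eq_fun do rewrite distrC.
  by lra.
rewrite -(ler_pM2l n0); move: low; rewrite natrD /d => low.
have := le_trans low up; rewrite /d => H.
have : e * 1 <= e * n%:R by rewrite ler_pM2l.
by lra.
Unshelve. all: by end_near. Qed.

(** Dominated convergence in each of the two walks. The weight says nothing about inverses, so the
    bound goes through [Nt_inv], whose error accounts for the 1 in [B]. *)
Lemma near_En2_Nt n (d : R) : 0 < d -> \forall t \near dnbhs (0 : C),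
  En n (fun g => En n (fun h => `|Nt t (g ** h^v) - N (g ** h^v)|)) <= d.
Proof.
move=> d0.
pose B := 4 * K + 1; have B0 : 0 <= B by rewrite addr_ge0// mulr_ge0.
have bound : \forall t \near dnbhs (0 : C), forall g h,
    `|Nt t (g ** h^v) - N (g ** h^v)| <= B * (wt W g * wt W h).
  near=> t => g h.
  have tD : cpdisk t by near: t; exact: near_pdisk.
  have dN : dom K (Nt t) by near: t.
  have L1 : ln 2 + 1 <= Lt t by near: t; exact: near_Lt.
  have ln2 : (0 : R) <= ln 2 by apply: ln_ge0; rewrite ler1n.
  have L0 : 0 < Lt t by lra.
  have c2 : ln 2 / Lt t <= 1 by rewrite ler_pdivrMr//; lra.
  apply: le_trans (ler_normB _ _) _; rewrite !ger0_norm ?(nalog_ge0 hrho)//; last exact: Nt_ge0.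
  have h1 := Nt_mul hrho g (h^v) tD; have h2 := Nt_inv hrho h tD.
  have h3 := nalog_mul hrho g (h^v); rewrite (nalog_inv hrho) in h3.
  have a1 := le_trans (ler_norm _) (dN g); have a2 := le_trans (ler_norm _) (dN h).
  have a3 := le_trans (ler_norm _) (dom_nalog g); have a4 := le_trans (ler_norm _) (dom_nalog h).
  have w1 := wt_ge1 W g; have w2 := wt_ge1 W h.
  have g1 : K * wt W g <= K * (wt W g * wt W h).
    by rewrite ler_wpM2l// ler_peMr// w_ge0.
  have g2 : K * wt W h <= K * (wt W g * wt W h).
    by rewrite ler_wpM2l// ler_peMl// w_ge0.
  have g3 : 1 <= wt W g * wt W h by nra.
  by rewrite /B mulrDl mul1r -mulrA; lra.
have : En n (fun g => En n (fun h => `|Nt t (g ** h^v) - N (g ** h^v)|)) @[t --> dnbhs (0 : C)] --> (0 : R).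
  apply: (@En_dct _ _ W n _ (dnbhs (0 : C)) _ (B * wt W e1 * Lam W ^+ n)
    (fun t g => En n (fun h => `|Nt t (g ** h^v) - N (g ** h^v)|))).
    apply: filterS bound => t bt g.
    have D : dom (B * wt W g) (fun h => `|Nt t (g ** h^v) - N (g ** h^v)|).
      by move=> h; rewrite normr_id -mulrA; exact: bt.
    by apply: le_trans (En_dom n D) _; rewrite -!mulrA [wt W g * _]mulrC !mulrA.
  move=> g.
  apply: (@En_dct _ _ W n _ (dnbhs (0 : C)) _ (B * wt W g)
    (fun t h => `|Nt t (g ** h^v) - N (g ** h^v)|)).
    by apply: filterS bound => t bt h; rewrite normr_id -mulrA; exact: bt.
  move=> h; have := @Nt_cvg _ _ rho hrho (g ** h^v) => /cvgrPdist_le H; apply/cvgrPdist_le => e e0.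
  by apply: filterS (H e e0) => t; rewrite sub0r normrN normr_id distrC.
move=> /cvgrPdist_le/(_ d d0).
apply: filterS => t; rewrite sub0r normrN; apply: le_trans; exact: ler_norm.
Unshelve. all: by end_near. Qed.

(** The hypothesis holds for every starting vector, hence also for the vector moved by the first
    block; the cocycle relation adds up the blocks. *)
Lemma drift_ge_psi t l (c : R) (n : nat) : cpdisk t -> dom K (Nt t) -> drift_of t l -> (0 < n)%N ->
  (forall p q, (p, q) != (0, 0) -> n%:R * c <= En n (psi rho t p q)) -> c <= l.
Proof.
move=> tD dN dl n0 H; have aN := dom_adm dN.
have tD' := tD; case: tD' => t1 t0; have L0 := Lt_gt0 t0 t1.
have apsi p q : (p, q) != (0, 0) -> adm (psi rho t p q).
  move=> v0; apply: (@adm_le _ _ _ _ (fun g => Nt t g + (Nt t g + `|ln 2 / Lt t|))).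
    move=> g; have h1 := psi_le hrho tD g v0; have h2 := psi_ge hrho tD g v0.
    have h3 := Nt_inv hrho g tD; have h4 := ler_norm (ln 2 / Lt t); have h5 := Nt_ge0 hrho g tD.
    by have h6 := normr_ge0 (ln 2 / Lt t); rewrite ler_norml; lra.
  by apply: admD => //; apply: admD => //; exact: adm_cst.
have v10 : ((1 : C), (0 : C)) != (0, 0) by rewrite xpair_eqE oner_eq0.
suff gen k p q : (p, q) != (0, 0) -> k%:R * (n%:R * c) <= En (k * n) (psi rho t p q).
  apply: (drift_ge dl n0) => k; apply: le_trans (gen k 1 0 v10) _.
  by apply: En_le => //; [exact: apsi|move=> g; exact: psi_le].
elim: k p q => [|k IH] p q v0.
  rewrite mul0r mul0n /=; have := psi_mul hrho tD e1 e1 v0; rewrite mulg1.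
  rewrite (M_one hrho)//; have [-> ->] := app_one p q; lra.
rewrite mulSn addnC En_add -natr1 mulrDl mul1r.
have aps : adm (fun h => k%:R * (n%:R * c) + psi rho t p q h) by apply: admD; [exact: adm_cst|exact: apsi].
apply: le_trans (_ : En n (fun h => k%:R * (n%:R * c) + psi rho t p q h) <= _).
  by rewrite EnD ?En_cst//; [rewrite lerD2l H|exact: adm_cst|exact: apsi].
apply: En_le => //; first exact: adm_En (apsi _ _ v0).
move=> h; have w0 := app_neq0 hrho tD h v0.
have -> : (fun g => psi rho t p q (g ** h)) =
  (fun g => psi rho t (app1 (M t h) p q) (app2 (M t h) p q) g + psi rho t p q h).
  by apply/funext => g; exact: psi_mul.
by rewrite EnD ?En_cst//; [rewrite lerD2r IH|exact: apsi|exact: adm_cst].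
Qed.

(** [X g] is the loss of [g] on a given vector and [P] the probability of a loss of at least [s].
    Two independent losses force a large Gromov product by [psi_pair], so [P * P] is controlled by
    [spread]. The time [n] and the neighbourhood of 0 are fixed before the vector, as [drift_ge_psi]
    requires. *)
Lemma lower_drift_spread (e : R) : 0 < e -> spread W N ->
  \forall t \near dnbhs (0 : C), forall l, drift_of t l -> l0 - e <= l.
Proof.
move=> e0 sp.
(* Budget out of [e * n%:R]: an eighth for [s], an eighth for rare large losses (through [ka]), an
   eighth for deviations of [Nt t] from [n%:R * l0]; the rest covers the error in the mean. *)
pose e' := e / 32; have e'0 : 0 < e' by rewrite divr_gt0.
pose d := Num.min 1 (e / 32); have d0 : 0 < d by rewrite lt_min ltr01 divr_gt0.
have [d1 d2] : d <= 1 /\ d <= e / 32 by rewrite !ge_min !lexx orbT.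
pose ka := e / (8 * (2 * l0 + 1)).
have l1 : 0 < 2 * l0 + 1 by rewrite addr_gt0 ?mulr_gt0.
have ka0 : 0 < ka by rewrite divr_gt0// mulr_gt0.
pose eta := ka ^+ 2 / 2; have eta0 : 0 < eta by rewrite divr_gt0// exprn_gt0.
have [i1 Hi1] := conc_nalog d0.
have [i hi Hsp] := sp e' eta e'0 eta0 i1.
have cn := Hi1 i hi; move: Hsp cn; set n := (2 ^ i)%N => Hsp cn.
have n1 : (1 : R) <= n%:R by rewrite ler1n expn_gt0.
have n0 : (0 : R) < n%:R by lra.
pose d3 := Num.min d (eta * (e' * n%:R) / 3).
have en0 : 0 < e' * n%:R by rewrite mulr_gt0.
have d30 : 0 < d3 by rewrite lt_min d0 divr_gt0// mulr_gt0.
have [d3d d3e] : d3 <= d /\ d3 <= eta * (e' * n%:R) / 3 by split; rewrite /d3 ge_min lexx ?orbT.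
have nn1 := near_En_Nt n d30; have nn2 := near_En2_Nt n d30.
near=> t => l dl.
have tD : cpdisk t by near: t; exact: near_pdisk.
have dN : dom K (Nt t) by near: t.
have b1 : En n (fun g => `|Nt t g - N g|) <= d3 by near: t.
have b2 : En n (fun g => En n (fun h => `|Nt t (g ** h^v) - N (g ** h^v)|)) <= d3 by near: t.
have L1 : ln 2 / d + ln 4 / (e' * n%:R) + 1 <= Lt t by near: t; exact: near_Lt.
have ln2 : (0 : R) <= ln 2 by apply: ln_ge0; rewrite ler1n.
have ln4 : (0 : R) <= ln 4 by apply: ln_ge0; rewrite ler1n.
have q2 : 0 <= ln 2 / d by rewrite divr_ge0// ltW.
have q4 : 0 <= ln 4 / (e' * n%:R) by rewrite divr_ge0// ltW.
have L0 : 0 < Lt t by lra.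
have c2 : ln 2 / Lt t <= d by rewrite ler_pdivrMr// mulrC -ler_pdivrMr//; lra.
have c20 : 0 <= ln 2 / Lt t by rewrite divr_ge0// ltW.
have c4 : ln 4 / Lt t <= e' * n%:R by rewrite ler_pdivrMr// mulrC -ler_pdivrMr//; lra.
have aN := dom_adm dN; have aN0 := adm_nalog.
have N0 g : 0 <= Nt t g by exact: Nt_ge0.
apply: (drift_ge_psi tD dN dl (n := n)); first by rewrite expn_gt0.
move=> p q v0.
pose X g := Nt t g - psi rho t p q g.
have X0 g : 0 <= X g by rewrite subr_ge0; exact: psi_le.
have Xle g : X g <= 2 * Nt t g + d.
  have h2 := psi_ge hrho tD g v0; have h3 := Nt_inv hrho g tD.
  by rewrite /X; lra.
have aX : adm X.
  apply: (@adm_le _ _ _ _ (fun g => 2 * Nt t g + d)).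
    by move=> g; rewrite ger0_norm.
  by apply: admD; [exact: admZ|exact: adm_cst].
(* Of the four units [e' * n%:R], one absorbs [ln 4 / Lt t] and one is the threshold of [spread];
   the remainder still forces [D g h] to reach one unit. *)
pose s := 4 * e' * n%:R.
pose P := En n (fun g => (s <= X g)%R%:R).
have P0 : 0 <= P by apply: En_ge0; [exact: adm_bool|].
have PP : P * P <= 2 * eta.
  have -> : P * P = En n (fun g => En n (fun h => (s <= X g)%R%:R * (s <= X h)%R%:R)).
    rewrite /P -EnZ; last exact: adm_bool.
    by apply: eq_En => g; rewrite EnZ 1?mulrC//; exact: adm_bool.
  pose D g h := `|Nt t g - N g| + `|Nt t h - N h| + `|Nt t (g ** h^v) - N (g ** h^v)|.
  pose c := (e' * n%:R)^-1; have c0 : 0 < c by rewrite invr_gt0.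
  have adif : adm (fun g => `|Nt t g - N g|) by apply/adm_abs/admB.
  have a2q : adm2 W (fun h g => `|Nt t (g ** h^v) - N (g ** h^v)|).
    apply: (@adm2_le _ _ _ _ (fun h g => Nt t g + (Nt t h + `|ln 2 / Lt t|) + (N g + N h))).
      move=> h g; rewrite normr_id; apply: le_trans (ler_normB _ _) _.
      rewrite !ger0_norm ?(nalog_ge0 hrho)//.
      have h1 := Nt_mul hrho g (h^v) tD; have h2 := Nt_inv hrho h tD.
      have h3 := nalog_mul hrho g (h^v); rewrite (nalog_inv hrho) in h3.
      by lra.
    apply: adm2D; last by apply: adm2D; [exact: (adm2_snd aN0)|exact: (adm2_fst aN0)].
    apply: adm2D; first exact: (adm2_snd aN).
    by apply: (@adm2_fst _ _ W (fun h => _)); apply: admD => //; exact: adm_cst.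
  have a2D : adm2 W (fun h g => D g h).
    by apply: adm2D => //; apply: adm2D; [exact: (adm2_snd adif)|exact: (adm2_fst adif)].
  have pw g h : (s <= X g)%R%:R * (s <= X h)%R%:R <=
      (e' * n%:R <= Qp N g h)%R%:R + c * D g h.
    have D0 : 0 <= D g h by rewrite !addr_ge0.
    have [h1|_] := leP s (X g); last by rewrite mul0r addr_ge0// mulr_ge0// ltW.
    have [h2|_] := leP s (X h); last by rewrite mulr0 addr_ge0// mulr_ge0// ltW.
    rewrite mulr1; have [_|h3] := leP (e' * n%:R) (Qp N g h).
      by rewrite lerDl mulr_ge0// ltW.
    rewrite add0r /c mulrC ler_pdivlMr// mul1r.
    have pr := psi_pair hrho tD g h v0.
    have : s <= Num.min (X g) (X h) by rewrite le_min h1 h2.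
    move=> /le_trans /(_ pr) h4.
    have y1 := ler_norm (Nt t g - N g); have y2 := ler_norm (Nt t h - N h).
    have y3 := ler_norm (- (Nt t (g ** h^v) - N (g ** h^v))); rewrite normrN in y3.
    by move: h3 h4; rewrite /Qp /D /s; lra.
  have a2U : adm2 W (fun h g => (e' * n%:R <= Qp N g h)%R%:R + c * D g h).
    by apply: adm2D; [exact: (adm2_bool W (fun h g => e' * n%:R <= Qp N g h))|exact: adm2Z].
  have a2L : adm2 W (fun h g => (s <= X g)%R%:R * (s <= X h)%R%:R).
    have := adm2_bool W (fun h g => (s <= X g) && (s <= X h)).
    by apply: adm2_le => h g; rewrite -natrM mulnb ger0_norm.
  have inner (F : G -> G -> R) g : adm2 W (fun h g => F g h) -> adm (fun h => F g h).
    move=> [B B0 HB]; exists (B * wt W g); first by rewrite mulr_ge0// w_ge0.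
    by move=> h; rewrite -mulrA [wt W g * _]mulrC.
  apply: le_trans (_ : En n (fun g => En n (fun h =>
      (e' * n%:R <= Qp N g h)%R%:R + c * D g h)) <= _).
    apply: En_le; [exact: (adm2_En n a2L)|exact: (adm2_En n a2U)|].
    move=> g; apply: En_le; [exact: (inner _ g a2L)|exact: (inner _ g a2U)|exact: pw].
  have step g : En n (fun h => (e' * n%:R <= Qp N g h)%R%:R + c * D g h) =
      En n (fun h => (e' * n%:R <= Qp N g h)%R%:R) + c * (`|Nt t g - N g| +
        En n (fun h => `|Nt t h - N h|) + En n (fun h => `|Nt t (g ** h^v) - N (g ** h^v)|)).
    have aq := inner (fun g h => `|Nt t (g ** h^v) - N (g ** h^v)|) g a2q.
    rewrite EnD; [|exact: adm_bool|by apply: admZ; exact: (inner _ g a2D)].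
    rewrite EnZ; last exact: (inner _ g a2D).
    congr (_ + c * _); rewrite EnD//; last by apply: admD => //; exact: adm_cst.
    by rewrite EnD ?En_cst//; exact: adm_cst.
  under eq_fun do rewrite step.
  have aq := adm2_En n a2q.
  have as1 : adm (fun g => `|Nt t g - N g| + En n (fun h => `|Nt t h - N h|)).
    by apply: admD => //; exact: adm_cst.
  rewrite EnD; [|exact: (adm2_En n (adm2_bool W (fun h g => e' * n%:R <= Qp N g h)))
                |by apply: admZ; apply: admD].
  rewrite EnZ; last by apply: admD.
  rewrite EnD// EnD// ?En_cst; last exact: adm_cst.
  have : c * (En n (fun g => `|Nt t g - N g|) + En n (fun h => `|Nt t h - N h|) +
      En n (fun g => En n (fun h => `|Nt t (g ** h^v) - N (g ** h^v)|))) <= eta.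
    rewrite /c mulrC ler_pdivrMr//; lra.
  by move: Hsp; lra.
have Pka : P <= ka.
  rewrite leNgt; apply/negP => h; have : ka * ka < P * P by rewrite ltr_pM// ltW.
  by move: PP; rewrite /eta expr2; lra.
have aabs : adm (fun g => `|Nt t g - n%:R * l0|) by apply/adm_abs/admB => //; exact: adm_cst.
have EP : En n (fun g => `|Nt t g - n%:R * l0|) <= d * n%:R + d.
  apply: le_trans (_ : En n (fun g => `|Nt t g - N g| + `|N g - n%:R * l0|) <= _).
    apply: En_le => //.
      by apply: admD; apply/adm_abs/admB => //; exact: adm_cst.
    move=> g; have -> : Nt t g - n%:R * l0 = (Nt t g - N g) + (N g - n%:R * l0) by ring.
    exact: ler_normD.
  rewrite EnD; [|by apply/adm_abs/admB|by apply/adm_abs/admB => //; exact: adm_cst].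
  by lra.
(* Outside the event [s <= X g] the loss is below [s]; on it [Xle] bounds the loss by about twice
   the expected length. *)
have EX : En n X <= s + ((2 * n%:R * l0 + d) * P + 2 * (d * n%:R + d)).
  apply: le_trans (_ : En n (fun g => s + ((2 * n%:R * l0 + d) * (s <= X g)%R%:R +
      2 * `|Nt t g - n%:R * l0|)) <= _).
    apply: En_le => //.
      by apply: admD; [exact: adm_cst|apply: admD; apply: admZ => //; exact: adm_bool].
    move=> g; have y0 := normr_ge0 (Nt t g - n%:R * l0).
    have s0 : 0 <= s by rewrite !mulr_ge0// ltW.
    have [h|h] := leP s (X g); last by rewrite mulr0 add0r; lra.
    by have := Xle g; have := ler_norm (Nt t g - n%:R * l0); rewrite mulr1; lra.
  have ab : adm (fun g => (s <= X g)%R%:R) by exact: adm_bool.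
  rewrite EnD; [|exact: adm_cst|by apply: admD; exact: admZ].
  rewrite En_cst EnD; [|exact: admZ|exact: admZ].
  by rewrite !EnZ// -/P lerD2l lerD2l ler_pM2l.
have low : n%:R * l0 - d <= En n (Nt t).
  have := ll0 n; have : En n N - En n (Nt t) <= d.
    rewrite -(EnB _ aN0 aN).
    apply: le_trans (ler_norm _) (le_trans (En_norm _ _) _); first exact: admB.
    by under eq_fun do rewrite distrC; exact: le_trans b1 d3d.
  by lra.
have -> : psi rho t p q = (fun g => Nt t g - X g) by apply/funext => g; rewrite /X; ring.
rewrite EnB//.
have k1 : ka * (2 * l0 + 1) = e / 8 by rewrite /ka; field; rewrite gt_eqF.
have k2 : (2 * n%:R * l0 + d) * P <= n%:R * (e / 8).
  apply: le_trans (_ : (n%:R * (2 * l0 + 1)) * ka <= _).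
    apply: ler_pM => //.
      by rewrite addr_ge0 ?mulr_ge0 ?ltW.
    by lra.
  by rewrite -mulrA [_ * ka]mulrC k1.
have k3 : d * 1 <= d * n%:R by rewrite ler_pM2l.
have k4 : d * n%:R <= e / 32 * n%:R by rewrite ler_pM2r.
have k5 : 0 < e * n%:R by rewrite mulr_gt0.
by move: EX; rewrite /s /e'; lra.
Unshelve. all: by end_near. Qed.

End Lower.

(** * Uniform domination by word length and the conclusion *)

Section Assembly.
Variables (R : realType) (G : groupType) (S : seq G) (m : G -> R).
Variable rho : G -> 'I_2 -> 'I_2 -> R[i] -> R[i].
Local Notation C := R[i].
Local Notation M := (eval_rep rho).
Local Notation Nt := (Nt rho).
Local Notation N := (nalog rho).
Hypothesis hS : sym_gen_set S.
Hypothesis hrho : is_SL2M_hom rho.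
Variable W : walk R G.
Hypothesis stepW : step W = m.
Hypothesis wtW : wt W = wlen R S.

Lemma near_all (s : seq G) (P : G -> C -> Prop) :
  (forall g, \forall t \near dnbhs (0 : C), P g t) ->
  \forall t \near dnbhs (0 : C), forall g, g \in s -> P g t.
Proof.
move=> H; elim: s => [|a s IH]; first by apply: filterE => t g; rewrite in_nil.
by apply: filterS2 (H a) IH => t Pa IH g; rewrite in_cons => /orP[/eqP -> //|]; exact: IH.
Qed.

(** On one neighbourhood of 0 the finitely many generators are controlled by their limits;
    subadditivity along words extends this to all of [G]. Finite generation enters here. *)
Lemma near_domNt : exists2 K : R, 0 <= K & \forall t \near dnbhs (0 : C), dom W K (Nt t).
Proof.
pose K := \sum_(s <- S) (N s + 1).
have N1 s : 0 <= N s + 1 by rewrite addr_ge0// nalog_ge0.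
have K0 : 0 <= K by apply: sumr_ge0.
exists K => //.
have near_s g : \forall t \near dnbhs (0 : C), Nt t g <= N g + 1.
  have := @Nt_cvg _ _ rho hrho g => /cvgrPdist_le/(_ 1 ltr01).
  by apply: filterS => t; rewrite ler_norml => /andP[h _]; lra.
have nS := near_all S near_s.
near=> t => g.
have tD : cpdisk t by near: t; exact: near_pdisk.
have bS s : s \in S -> Nt t s <= K.
  have b : forall s, s \in S -> Nt t s <= N s + 1 by near: t.
  move=> sS; apply: le_trans (b s sS) _.
  rewrite /K (big_rem s)//= lerDl; exact: sumr_ge0.
have [[s [sS sn gE]] _] := word_lengthP hS g.
have word (L : seq G) : all (fun x => x \in S) L -> Nt t (gprod L) <= K * (size L)%:R.
  elim: L => [|a L IH] /=; first by rewrite (Nt_one hrho)// mulr0.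
  move=> /andP[aS LS]; apply: le_trans (Nt_mul hrho _ _ tD) _.
  by rewrite -natr1 mulrDr mulr1; have := bS a aS; have := IH LS; lra.
rewrite ger0_norm ?Nt_ge0// wtW /wlen {1}gE; apply: le_trans (word s sS) _.
by rewrite sn ler_wpM2l// lerDr.
Unshelve. all: by end_near. Qed.

Lemma chi_drift t (K l : R) : cpdisk t -> dom W K (Nt t) -> drift_of W rho t l ->
  chi m rho t / ln (cabs t)^-1 = l.
Proof.
move=> tD dN [l0 cl _]; case: (tD) => t1 t0; have L0 := Lt_gt0 t0 t1.
have aN := dom_adm dN.
have fE : (fun g => ln (opnorm (M t g))) = (fun g => Lt t * Nt t g).
  by apply/funext => g; rewrite NtE mulrC divfK// gt_eqF.
have seqE : (fun n : nat => n%:R^-1 * fine (int_conv m n (fun g => ln (opnorm (M t g))))) =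
    (fun n : nat => Lt t * (n%:R^-1 * En W n (Nt t))).
  apply/funext => n; rewrite fE -stepW int_conv_En /=; [|exact: admZ|].
    by rewrite EnZ// mulrCA.
  by move=> g; rewrite mulr_ge0 ?Nt_ge0// ltW.
rewrite /chi seqE -/(Lt t).
have c : (Lt t * (n%:R^-1 * En W n (Nt t))) @[n --> \oo] --> Lt t * l.
  by apply: cvgM => //; exact: cvg_cst.
by rewrite (cvg_lim _ c)// mulrC mulKf// gt_eqF.
Qed.

Lemma chi_na_drift (l : R) : adm W N -> n%:R^-1 * En W n N @[n --> \oo] --> l ->
  chi_na m rho = l.
Proof.
move=> aN cl; rewrite /chi_na.
have -> : (fun n : nat => n%:R^-1 * fine (int_conv m n N)) = (fun n : nat => n%:R^-1 * En W n N).
  by apply/funext => n; rewrite -stepW int_conv_En//; exact: nalog_ge0.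
exact: cvg_lim.
Qed.

Lemma chi_cvg : supp_generates m ->
  (fun t : C => chi m rho t / ln (cabs t)^-1) @ dnbhs (0 : C) --> chi_na m rho.
Proof.
move=> gen; have [K K0 dK] := near_domNt.
have aN := adm_nalog hrho dK.
have [l [l0 cl ll]] := walk_drift aN (nalog_ge0 hrho) (nalog_mul hrho).
rewrite (chi_na_drift aN cl).
apply/cvgrPdist_le => /= e e0.
have up := upper_drift hrho dK cl e0.
have low : \forall t \near dnbhs (0 : C), forall l', drift_of W rho t l' -> l - e <= l'.
  (* For limit drift 0 the bound is immediate, drifts being non-negative; the tree argument concerns
     positive drift. *)
  move: l0; rewrite le_eqVlt => /orP[/eqP lz|l0].
    by apply: filterE => t l' [l'0 _ _]; rewrite -lz; lra.
  have [[eta eta0 Hred]|[g [h [c [j [c0 Hc]]]]]] := comm_cases hrho.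
    exact: (lower_drift_reducible hrho dK cl ll eta0 e0 Hred).
  have [sp|al] := spread_or_aligned (nalog_ge0 hrho) (nalog_inv hrho) (nalog_mul hrho)
    (nalog_one hrho) (nalog_4pt hrho) aN l0 cl ll.
    exact: (lower_drift_spread hrho K0 dK l0 cl ll e0 sp).
  exfalso.
  have genW : supp_generates (step W) by rewrite stepW.
  (* One more than [aligned_commutator] permits. *)
  pose D := j%:R + 2 * (N g + N h) + 1.
  have [f Hf] := aligned_fix (nalog_ge0 hrho) (nalog_inv hrho) (nalog_mul hrho)
    (nalog_one hrho) (nalog_4pt hrho) l0 genW al [:: g; h] D.
  have fg := Hf g ltac:(by rewrite !inE eqxx).
  have fh := Hf h ltac:(by rewrite !inE eqxx orbT).
  have := aligned_commutator hrho c0 Hc fg fh.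
  by rewrite /D; lra.
near=> t.
have tD : cpdisk t by near: t; exact: near_pdisk.
have dN : dom W K (Nt t) by near: t.
have [lt dlt] := drift_ex hrho tD dN.
rewrite (chi_drift tD dN dlt).
have h1 : lt <= l + e by move: lt dlt; near: t.
have h2 : l - e <= lt by move: lt dlt {h1}; near: t.
by rewrite ler_norml; apply/andP; split; lra.
Unshelve. all: by end_near. Qed.

End Assembly.

Theorem theoremA (R : realType) (G : groupType) (S : seq G) (m : G -> R)
    (rho : G -> 'I_2 -> 'I_2 -> R[i] -> R[i]) :
  sym_gen_set S ->
  prob_on m ->
  supp_generates m ->
  (exists2 delta : R, 0 < delta &
     (\esum_(g in [set: G]) (m g * powR ((word_length S g)%:R) (1 + delta))%:E < +oo)%E) ->
  is_SL2M_hom rho ->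
  (fun t : R[i] => chi m rho t / ln (cabs t)^-1) @ dnbhs (0 : R[i])
    --> chi_na m rho.
Proof.
move=> hS hm gen mom hrho.
pose W := Walk hm.1 hm.2 (wlen_ge1 R S) (wlen_mul R hS) (wlen_summ hm mom).
exact: (@chi_cvg R G S m rho hS hrho W).
Qed.
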